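(* Let $n\ge 2$, let $1\le q<\frac{n}{n-1}$ and let $O$ be an open subset of $\mathbb R^n$ with $V(O)<\infty$. If $\mathsf h_{q,d}(O)$ is attained by a set $E\subseteq O$, i.e. $\mathsf h_{q,d}(O)=P_{BV,d}(E)/\big(V(E)\big)^{\frac1q}$, then $\partial E\cap\partial O\neq\emptyset$.
   Context: $V$ is $n$-dimensional Lebesgue measure. $\omega_n$ is the volume of the unit ball of $\mathbb R^n$ and $du$ is the standard surface area measure on $\mathbb S^{n-1}$ (total mass $n\omega_n$). $BV(\mathbb R^n)$ is the space of $f\in L^1(\mathbb R^n)$ whose distributional derivative $Df$ is a finite $\mathbb R^n$-valued Radon measure; $|Df|$ is its variation measure and $\sigma_f=dDf/d|Df|$ the Radon–Nikodym derivative. For $f\in BV(\mathbb R^n)$, $$\|f\|_{BV,d(\mathbb R^n)}=\left(\int_{\mathbb S^{n-1}}\Big(\int_{\mathbb R^n}|u\cdot\sigma_f|\,d|Df|\Big)^{-n}\frac{du}{n\omega_n}\right)^{-\frac1n},$$ with conventions $0^{-n}=\infty$, $\infty^{-1/n}=0$. For measurable $E\subseteq\mathbb R^n$, the affine perimeter is $P_{BV,d}(E)=\|1_E\|_{BV,d(\mathbb R^n)}$, with $P_{BV,d}(E)=+\infty$ if $1_E\notin BV(\mathbb R^n)$. The affine $q$-Cheeger constant of $O$ is $$\mathsf h_{q,d}(O)=\inf_{D\subset O}\frac{P_{BV,d}(D)}{\big(V(D)\big)^{\frac1q}},$$ where $D$ ranges over the measurable subsets of $O$ with $V(D)>0$ (and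 $E$ is one of these). *)

(* Defs.v *)
From HB Require Import structures.
From mathcomp Require Import all_boot all_order all_algebra.
From mathcomp Require Import all_classical all_reals all_analysis.
From mathcomp Require Import measurable_realfun.
From mathcomp Require Import ring lra.

Set Implicit Arguments.
Unset Strict Implicit.
Unset Printing Implicit Defensive.
Import Order.TTheory GRing.Theory Num.Theory.
Import numFieldNormedType.Exports.
Local Open Scope classical_set_scope.
Local Open Scope ring_scope.

Definition rV_display : measure_display.
Proof. exact: default_measure_display. Qed.

(* 'rV[R]_n carries the library's sup-norm topology, which is the usual topology
   of R^n; it is made a measurable space with the Borel sigma-algebra. *)
Section borel.
Context {R : realType} {n : nat}.
Let B := <<s (@open 'rV[R]_n) >>.
Let B0 : B set0. Proof. exact: sigma_algebra0. Qed.
Let BC A : B A -> B (~` A). Proof. exact: sigma_algebraC. Qed.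
Let Bcup (F : (set 'rV[R]_n)^nat) : (forall i, B (F i)) -> B (\bigcup_i F i).
Proof. exact: sigma_algebra_bigcup. Qed.
HB.instance Definition _ := @isMeasurable.Build rV_display
  'rV[R]_n B B0 BC Bcup.
End borel.


Section borel_theory.
Context {R : realType}.

Lemma measurable_rV_coord n (i : 'I_n) :
  measurable_fun [set: 'rV[R]_n] (fun x => x ord0 i : R).
Proof.
apply: (measurability _ (RGenOpens.measurableE R)).
move=> _ [_ [a [b ->]] <-]; rewrite setTI; apply: sub_sigma_algebra.
by apply: open_comp => [x _|]; [exact: coord_continuous|exact: interval_open].
Qed.

Lemma measurable_fun_rV d (T : measurableType d) n (D : set T)
    (f : T -> 'rV[R]_n) :
  (forall i, measurable_fun D (fun x => f x ord0 i : R)) -> measurable_fun D f.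
Proof.
move=> mf mD; apply: (@measurability _ _ _ _ _ _ (@open 'rV[R]_n)) => //.
move=> _ [U oU <-].
pose box (c : 'rV[rat]_n * nat) := [set v : 'rV[R]_n | forall i,
  (`](ratr (c.1 ord0 i) - c.2.+1%:R^-1),
     (ratr (c.1 ord0 i) + c.2.+1%:R^-1)[%classic : set R) (v ord0 i)].
have mbox c : measurable (D `&` f @^-1` box c).
  rewrite (_ : _ `&` _ = D `&` \bigcap_(i in [set: 'I_n])
     (D `&` (fun x => f x ord0 i) @^-1`
     `](ratr (c.1 ord0 i) - c.2.+1%:R^-1), (ratr (c.1 ord0 i) + c.2.+1%:R^-1)[)).
    apply: measurableI => //; apply: fin_bigcap_measurable => // i _.
    exact: mf.
  apply/seteqP; split => [x [Dx xc]|x [Dx xc]]; split => // i.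
    by move=> _; split => //; exact: xc.
  by have [] := xc i Logic.I.
rewrite (_ : _ `&` _ =
  \bigcup_c (if `[< box c `<=` U >] then D `&` f @^-1` box c else set0)).
  apply: countable_bigcupT_measurable => // c; by case: ifPn.
apply/seteqP; split => [x [Dx Ufx]|x [c _]]; last first.
  by case: ifPn => // /asboolP cU [Dx /cU].
move: oU; rewrite openE => /(_ _ Ufx) /= /nbhs_ballP[e /= e0 eU].
pose k := Num.trunc (2 / e).
have ke : 2 * k.+1%:R^-1 < e.
  rewrite ltr_pdivrMr// -ltr_pdivrMl// mulrC.
  by rewrite truncnS_gt.
have /(_ _)/cid q i : exists q : rat,
    f x ord0 i - k.+1%:R^-1 < ratr q < f x ord0 i + k.+1%:R^-1.
  have : f x ord0 i - k.+1%:R^-1 < f x ord0 i + k.+1%:R^-1.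
    by rewrite ltrD2l gtrN// invr_gt0.
  by move=> /rat_in_itvoo[q]; rewrite in_itv/=; exists q.
exists (\row_i sval (q i), k) => //.
have bU : box (\row_i sval (q i), k) `<=` U.
  move=> v vb; apply: eU; split => // i j; have -> : i = ord0 by exact: ord1.
  have := vb j; rewrite /= in_itv/= mxE.
  case: (q j) => r /=.
  move: (k.+1%:R^-1) ke (f x ord0 j) (v ord0 j) (ratr r : R) => t ke fx vj rr.
  rewrite /ball /= ltr_norml => /andP[? ?] /andP[? ?]; apply/andP; split; lra.
rewrite asboolT//; split => // i; rewrite /= in_itv/= mxE.
case: (q i) => r /=; move: (k.+1%:R^-1) (f x ord0 i) (ratr r : R) => t fx rr.
by move=> /andP[? ?]; apply/andP; split; lra.
Qed.

End borel_theory.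

Section lebesgue_step.
Context {R : realType} {n : nat}.
Variable mu : {sigma_finite_measure set 'rV[R]_n -> \bar R}.
Local Notation RxRn := (measurableTypeR R * 'rV[R]_n)%type.

Definition cons_rV (p : RxRn) : 'rV[R]_n.+1 := row_mx (p.1)%:M p.2.

Let decons (v : 'rV[R]_n.+1) : RxRn :=
  (v ord0 ord0, \row_j v ord0 (lift ord0 j)).

Let cons_rV0 p : cons_rV p ord0 ord0 = p.1.
Proof.
rewrite /cons_rV mxE; case: splitP => //= k _.
by rewrite (ord1 k) mxE eqxx mulr1n.
Qed.

Let cons_rVS p j : cons_rV p ord0 (lift ord0 j) = p.2 ord0 j.
Proof.
rewrite /cons_rV mxE; case: splitP => //= k; first by rewrite (ord1 k).
by rewrite /bump /= => -[] jk; congr (_ _ _); apply: val_inj.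
Qed.

Let cons_rVK p : decons (cons_rV p) = p.
Proof.
case: p => x v; rewrite /decons cons_rV0; congr pair => /=.
by apply/rowP => j; rewrite mxE cons_rVS.
Qed.

Let measurable_cons_rV : measurable_fun [set: RxRn] cons_rV.
Proof.
apply: measurable_fun_rV => i.
have [->|[j ->]] : i = ord0 \/ exists j, i = lift ord0 j.
  by case: (unliftP ord0 i) => [j|] ->; [right; exists j|left].
- by under eq_fun do rewrite cons_rV0; exact: measurable_fst.
- under eq_fun do rewrite cons_rVS.
  apply: (@measurableT_comp _ _ _ _ _ _ (fun v : 'rV[R]_n => v ord0 j : R)).
    exact: measurable_rV_coord.
  exact: measurable_snd.
Qed.

Let measurable_decons : measurable_fun [set: 'rV[R]_n.+1] decons.
Proof.
apply/measurable_fun_pairP; split; first exact: measurable_rV_coord.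
apply: measurable_fun_rV => j; rewrite /decons /=.
by under eq_fun do rewrite mxE; exact: measurable_rV_coord.
Qed.

Definition lebesgue_rV_step : set 'rV[R]_n.+1 -> \bar R :=
  pushforward (lebesgue_measure \x mu)%E cons_rV.

Let step0 : lebesgue_rV_step set0 = 0%E. Proof. exact: measure0. Qed.

Let step_ge0 A : (0 <= lebesgue_rV_step A)%E. Proof. exact: measure_ge0. Qed.

Let step_sigma_additive : semi_sigma_additive lebesgue_rV_step.
Proof. exact: measure_semi_sigma_additive. Qed.

HB.instance Definition _ := isMeasure.Build _ _ _ lebesgue_rV_step
  step0 step_ge0 step_sigma_additive.

Let step_sigma_finite : sigma_finite setT lebesgue_rV_step.
Proof.
have /sigma_finiteP[F [TF ndF Foo]] := sigma_finiteT (@lebesgue_measure R).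
have /sigma_finiteP[G [TG ndG Goo]] := sigma_finiteT mu.
exists (fun k => decons @^-1` (F k `*` G k)).
  rewrite -preimage_bigcup (_ : \bigcup_k (F k `*` G k) = setT) ?preimage_setT//.
  apply/seteqP; split => // -[x v] _.
  have [[i _ Fix] [j _ Gjv]] : (\bigcup_k F k) x /\ (\bigcup_k G k) v.
    by rewrite -TF -TG.
  exists (maxn i j) => //; split => /=.
  - by move: x Fix; exact/subsetPset/ndF/leq_maxl.
  - by move: v Gjv; exact/subsetPset/ndG/leq_maxr.
move=> k; have [mF Fkoo] := Foo k; have [mG Gkoo] := Goo k; split.
  by rewrite -[X in measurable X]setTI; apply: measurable_decons => //;
    exact: measurableX.
rewrite /lebesgue_rV_step /pushforward.
rewrite (_ : cons_rV @^-1` _ = F k `*` G k); last first.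
  rewrite -comp_preimage (_ : decons \o cons_rV = id) ?preimage_id//.
  by apply/funext => p; exact: cons_rVK.
by rewrite product_measure1E// lte_mul_pinfty// ge0_fin_numE.
Qed.

HB.instance Definition _ := Measure_isSigmaFinite.Build _ _ _ lebesgue_rV_step
  step_sigma_finite.

End lebesgue_step.

(* n-dimensional Lebesgue measure on Borel sets, as the n-fold product of
   one-dimensional Lebesgue measure; it starts from the point mass on R^0. *)
Fixpoint lebesgue_rV {R : realType} (n : nat) :
    {sigma_finite_measure set 'rV[R]_n -> \bar R} :=
  if n is m.+1 then lebesgue_rV_step (lebesgue_rV m) else \d_ (0 : 'rV[R]_0).

Section euclidean.
Context {R : realType} {n : nat}.
Implicit Types u v : 'rV[R]_n.

(* The norm of 'rV[R]_n in the library is the sup norm; enorm is the Euclidean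
   one. *)
Definition dotr u v : R := \sum_i u ord0 i * v ord0 i.

Definition enorm v : R := Num.sqrt (dotr v v).

Lemma dotr_ge0 v : 0 <= dotr v v.
Proof. by apply: sumr_ge0 => i _; rewrite -expr2 sqr_ge0. Qed.

Lemma enorm_ge0 v : 0 <= enorm v. Proof. exact: sqrtr_ge0. Qed.

Lemma enorm0 : enorm 0 = 0.
Proof.
by rewrite /enorm /dotr big1 ?sqrtr0// => i _; rewrite !mxE mulr0.
Qed.

Lemma dotr_CS u v : dotr u v ^+ 2 <= dotr u u * dotr v v.
Proof.
set A := dotr u u; set B := dotr v v; set C := dotr u v.
have E : 0 <= B * (A * B - C ^+ 2).
  suff -> : B * (A * B - C ^+ 2) =
      \sum_i (u ord0 i * B - v ord0 i * C) ^+ 2.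
    by apply: sumr_ge0 => i _; exact: sqr_ge0.
  transitivity (\sum_i ((u ord0 i * u ord0 i) * B ^+ 2 +
      (u ord0 i * v ord0 i) * (- (B * C) *+ 2) + (v ord0 i * v ord0 i) * C ^+ 2)).
    by rewrite !big_split/= -!mulr_suml -/(dotr u u) -/(dotr u v) -/(dotr v v) -/A -/B -/C; ring.
  by apply: eq_bigr => i _; ring.
have [B0|B0] := eqVneq B 0.
  suff -> : C = 0 by rewrite B0 mulr0 expr0n.
  apply: big1 => i _; suff -> : v ord0 i = 0 by rewrite mulr0.
  apply/eqP; rewrite -sqrf_eq0 expr2.
  move: B0 => /eqP; rewrite /B /dotr psumr_eq0 => [/allP/(_ i)|j _].
    by rewrite mem_index_enum => /(_ isT).
  by rewrite -expr2 sqr_ge0.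
have {}B0 : 0 < B by rewrite lt_neqAle eq_sym B0 dotr_ge0.
by rewrite -subr_ge0 -(pmulr_rge0 _ B0).
Qed.

Lemma enormD u v : enorm (u + v) <= enorm u + enorm v.
Proof.
rewrite -(@ler_pXn2r _ 2)// ?nnegrE ?enorm_ge0 ?addr_ge0 ?enorm_ge0//.
rewrite sqrrD !sqr_sqrtr ?dotr_ge0//.
have -> : dotr (u + v) (u + v) = dotr u u + dotr u v *+ 2 + dotr v v.
  rewrite /dotr -sumrMnl -!big_split/=; apply: eq_bigr => i _.
  by rewrite !mxE; ring.
rewrite lerD2r lerD2l lerMn2r/=; apply: le_trans (ler_norm _) _.
by rewrite -sqrtrM ?dotr_ge0// -sqrtr_sqr ler_wsqrtr// dotr_CS.
Qed.

Lemma enorm_sum (I : Type) (s : seq I) (F : I -> 'rV[R]_n) :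
  enorm (\sum_(i <- s) F i) <= \sum_(i <- s) enorm (F i).
Proof.
elim: s => [|i s ih]; first by rewrite !big_nil enorm0.
by rewrite !big_cons (le_trans (enormD _ _))// lerD2l.
Qed.

Lemma enorm_le v : enorm v <= \sum_i `|v ord0 i|.
Proof.
rewrite -[leRHS]ger0_norm ?sumr_ge0// -sqrtr_sqr ler_wsqrtr//.
rewrite expr2 mulr_suml /dotr ler_sum// => i _.
rewrite -expr2 -real_normK ?num_real// expr2 ler_wpM2l//.
by rewrite (bigD1 i)//= lerDl sumr_ge0.
Qed.

Lemma measurable_enorm : measurable_fun [set: 'rV[R]_n] (@enorm).
Proof.
apply: (@measurableT_comp _ _ _ _ _ _ (@Num.sqrt R)).
  by apply: continuous_measurable_fun; exact: sqrt_continuous.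
apply: measurable_sum => i; apply: measurable_funM; exact: measurable_rV_coord.
Qed.

End euclidean.

Section surface.
Context {R : realType} (n : nat).

Definition unit_ball : set 'rV[R]_n := [set x | enorm x <= 1].

Definition unit_sphere : set 'rV[R]_n := [set x | enorm x = 1].

(* normalize 0 = 0; the origin is negligible below. *)
Definition normalize (x : 'rV[R]_n) : 'rV[R]_n := (enorm x)^-1 *: x.

Lemma measurable_unit_ball : measurable unit_ball.
Proof.
rewrite (_ : unit_ball = setT `&` @enorm R n @^-1` `]-oo, 1]).
  exact: measurable_enorm.
by rewrite setTI; apply/seteqP; split => x /=; rewrite in_itv.
Qed.

Lemma measurable_normalize : measurable_fun [set: 'rV[R]_n] normalize.
Proof.
apply: measurable_fun_rV => i; rewrite /normalize.
under eq_fun do rewrite mxE.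
apply: measurable_funM; last exact: measurable_rV_coord.
under eq_fun do rewrite -powR_inv1 ?enorm_ge0//.
apply: (@measurableT_comp _ _ _ _ _ _ (fun x : R => x `^ -1)).
  exact: measurable_powR.
exact: measurable_enorm.
Qed.

Definition cone_measure : set 'rV[R]_n -> \bar R :=
  pushforward (mrestr (lebesgue_rV n) measurable_unit_ball) normalize.

Let cone_measure0 : cone_measure set0 = 0%E.
Proof. by apply: measure0; exact: measurable_normalize. Qed.

Let cone_measure_ge0 A : (0 <= cone_measure A)%E.
Proof. by apply: measure_ge0; exact: measurable_normalize. Qed.

Let cone_measure_sigma_additive : semi_sigma_additive cone_measure.
Proof.
apply: measure_semi_sigma_additive; exact: measurable_normalize.
Qed.

HB.instance Definition _ := isMeasure.Build _ _ _ cone_measure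
  cone_measure0 cone_measure_ge0 cone_measure_sigma_additive.

(* Surface area by the cone formula
   H^(n-1)(A) = n * V({x in the unit ball : x / |x| in A}) for A in the sphere;
   the total mass is n * omega_n. *)
Definition surface_measure : set 'rV[R]_n -> \bar R :=
  mscale n%:R%:nng cone_measure.

HB.instance Definition _ := Measure.on surface_measure.

Lemma surface_measureE A : surface_measure A =
  (n%:R%:E * lebesgue_rV n (normalize @^-1` A `&` unit_ball))%E.
Proof. by []. Qed.

End surface.

Section variation.
Context d (T : measurableType d) {R : realType} (n : nat).
Variable mu : 'I_n -> {charge set T -> \bar R}.

Definition vec_charge (A : set T) : 'rV[R]_n := \row_i fine (mu i A).

Definition measurable_partition (A : set T) : set ((set T)^nat) :=
  [set F | [/\ forall k, measurable (F k), trivIset setT F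
             & \bigcup_k F k = A]].

(* |mu|(A) = sup of sum_k |mu(F_k)| over countable measurable partitions of A.
   A nonmeasurable A has no such partition, and then the value is 0. *)
Definition variation (A : set T) : \bar R :=
  maxe 0%E (ereal_sup [set (\sum_(0 <= k <oo) (enorm (vec_charge (F k)))%:E)%E
                      | F in measurable_partition A]).

Local Open Scope ereal_scope.
Let g A : \bar R := (enorm (vec_charge A))%:E.

Let g_ge0 A : 0 <= g A. Proof. by rewrite lee_fin enorm_ge0. Qed.

Let g0 : g set0 = 0.
Proof.
rewrite /g (_ : vec_charge set0 = 0%R) ?enorm0//.
by apply/rowP => i; rewrite !mxE charge0.
Qed.

Let variation_ge0 A : 0 <= variation A.
Proof. by rewrite /variation le_max lexx. Qed.

Let variation_ub A F : measurable_partition A F ->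
  \sum_(0 <= k <oo) g (F k) <= variation A.
Proof.
move=> AF; rewrite /variation le_max; apply/orP; right.
by apply: ereal_sup_ubound; exists F.
Qed.

Let partition1 A : measurable A ->
  measurable_partition A (fun k => if k is 0%N then A else set0).
Proof.
move=> mA; split; first by case.
- by apply/trivIsetP => -[|i] [|j] _ _ // _; rewrite ?(set0I, setI0).
- apply/seteqP; split => [x [[|k] _]//|x Ax]; by exists 0%N.
Qed.

Let variation_lub A x : measurable A -> (forall F, measurable_partition A F ->
  \sum_(0 <= k <oo) g (F k) <= x) -> variation A <= x.
Proof.
move=> mA Ax; rewrite /variation ge_max; apply/andP; split.
  apply: le_trans (Ax _ (partition1 mA)).
  by apply: nneseries_ge0 => k _ _; exact: g_ge0.
by apply: ge_ereal_sup => _ [F AF <-]; exact: Ax.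
Qed.

Let g_sigma_sub F : (forall k, measurable (F k)) -> trivIset setT F ->
  g (\bigcup_k F k) <= \sum_(0 <= k <oo) g (F k).
Proof.
move=> mF tF; have mUF := bigcupT_measurable _ mF.
pose u N := (\sum_(0 <= k < N) vec_charge (F k))%R.
have ui N i : u N ord0 i = fine (\sum_(0 <= k < N) mu i (F k)).
  rewrite /u summxE -sum_fine//; last by move=> k _; exact: fin_num_measure.
  by apply: eq_bigr => k _; rewrite mxE.
have ucvg i : (fun N => u N ord0 i) @ \oo --> fine (mu i (\bigcup_k F k)).
  under eq_fun do rewrite ui.
  apply: fine_cvg; rewrite fineK; last exact: fin_num_measure.
  exact: charge_semi_sigma_additive.
have gcvg : (fun N => (enorm (u N))%:E) @ \oo --> g (\bigcup_k F k).
  apply: cvg_EFin; first by near=> N.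
  rewrite /enorm /dotr.
  apply: (@cvg_comp _ _ _ _ (@Num.sqrt R)); last exact: sqrt_continuous.
  apply: cvg_big => [|i _]; first exact: add_continuous.
  by rewrite mxE; apply: cvgM; exact: ucvg.
rewrite -(cvg_lim _ gcvg)//; apply: lime_le; first by apply/cvg_ex; eexists; exact: gcvg.
near=> N; apply: (@le_trans _ _ (\sum_(0 <= k < N) g (F k))).
  by rewrite /g sumEFin lee_fin enorm_sum.
by apply: nneseries_lim_ge => k _ _; exact: g_ge0.
Unshelve. all: by end_near. Qed.


Let variation_lty A : measurable A -> variation A < +oo.
Proof.
move=> mA.
have /(_ _)/cid nu i : exists nu : {measure set T -> \bar R},
    forall B, measurable B -> nu B < +oo /\ `|mu i B| <= nu B.
  have [P [N PN]] := Hahn_decomposition (mu i).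
  exists (charge_variation PN) => B mB; split; last exact: abse_charge_variation.
  by rewrite ltey_eq /charge_variation fin_numD !fin_num_measure.
apply: (@le_lt_trans _ _ (\sum_i sval (nu i) A)); last first.
  by apply: lte_sum_pinfty => i _; case: (nu i) => m /= /(_ _ mA)[].
apply: variation_lub => // F [mF tF FA].
apply: (@le_trans _ _ (\sum_(0 <= k <oo) \sum_i sval (nu i) (F k))).
  apply: lee_nneseries => [k _ _|k _]; first exact: g_ge0.
  rewrite /g; apply: (@le_trans _ _ (\sum_i `|mu i (F k)|)); last first.
    by apply: lee_sum => i _; case: (nu i) => m /= /(_ _ (mF k))[].
  rewrite (eq_bigr (fun i => (`|vec_charge (F k) ord0 i|)%:E)); last first.
    by move=> i _; rewrite mxE -abse_EFin fineK// fin_num_measure.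
  by rewrite sumEFin lee_fin enorm_le.
rewrite nneseries_sum//; apply: lee_sum => i _.
have := @measure_semi_sigma_additive _ _ _ (sval (nu i)) F mF tF.
by rewrite FA => /(_ mA)/cvg_lim <-.
Qed.

Let variationU A B : measurable A -> measurable B -> A `&` B = set0 ->
  variation A + variation B <= variation (A `|` B).
Proof.
move=> mA mB AB0.
have key F G : measurable_partition A F -> measurable_partition B G ->
    \sum_(0 <= k <oo) g (F k) + \sum_(0 <= k <oo) g (G k) <= variation (A `|` B).
  move=> [mF tF FA] [mG tG GB].
  pose H k := if odd k then G k./2 else F k./2.
  have pH : measurable_partition (A `|` B) H.
    have FG i j : F i `&` G j = set0.
      apply/seteqP; split => // x [Fx Gx]; rewrite -AB0; split.
        by rewrite -FA; exists i.
      by rewrite -GB; exists j.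
    split.
    - by move=> k; rewrite /H; case: ifP.
    - apply/trivIsetP => i j _ _ ij; rewrite /H.
      case: ifPn => oi; case: ifPn => oj; last 3 first.
      + by rewrite setIC FG.
      + by rewrite FG.
      + move/trivIsetP : tF; apply => //; apply: contra ij => /eqP ij.
        by rewrite -(odd_double_half i) -(odd_double_half j) ij (negbTE oi) (negbTE oj).
      + move/trivIsetP : tG; apply => //; apply: contra ij => /eqP ij.
        by rewrite -(odd_double_half i) -(odd_double_half j) ij oi oj.
    - rewrite -FA -GB; apply/seteqP; split => [x [k _]|x].
        by rewrite /H; case: ifP => _ Hx; [right|left]; exists k./2.
      move=> [[k _ Fx]|[k _ Gx]].
      + by exists k.*2 => //; rewrite /H odd_double doubleK.
      + by exists k.*2.+1 => //; rewrite /H /= odd_double uphalf_double.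
  rewrite -nneseriesD//; [|by move=> *; exact: g_ge0..].
  apply: lime_le.
    by apply: is_cvg_nneseries => k _ _; rewrite adde_ge0.
  near=> N; apply: le_trans (variation_ub pH).
  apply: le_trans (@nneseries_lim_ge _ (fun k => g (H k)) xpredT 0 N.*2 _); last first.
    by move=> k _ _; exact: g_ge0.
  rewrite le_eqVlt; apply/orP; left; apply/eqP.
  elim: (N) => [|M ih]; first by rewrite !big_geq.
  rewrite doubleS !big_nat_recr//= ih /H /= odd_double/= doubleK uphalf_double.
  by rewrite addeA.
have fB G : measurable_partition B G -> \sum_(0 <= k <oo) g (G k) \is a fin_num.
  move=> pG; rewrite ge0_fin_numE; last by apply: nneseries_ge0 => *; exact: g_ge0.
  exact: le_lt_trans (variation_ub pG) (variation_lty mB).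
have fA : variation A \is a fin_num by rewrite ge0_fin_numE ?variation_lty.
rewrite addeC -leeBrDr//; apply: variation_lub => // G pG.
rewrite leeBrDr// addeC -leeBrDr ?fB//; apply: variation_lub => // F pF.
by rewrite leeBrDr ?fB//; exact: key.
Unshelve. all: by end_near. Qed.

Let variation_le A B : measurable A -> measurable B -> A `<=` B ->
  variation A <= variation B.
Proof.
move=> mA mB AB; rewrite -(setDUK AB).
apply: le_trans (variationU mA (measurableD mB mA) _).
  by rewrite leeDl// variation_ge0.
by rewrite setDE setICA setICr setI0.
Qed.

Let variation0 : variation set0 = 0.
Proof.
apply/eqP; rewrite eq_le variation_ge0 andbT; apply: variation_lub => // F [_ _ F0].
rewrite eseries0// => k _ _; rewrite (_ : F k = set0)//.
by apply/seteqP; split => // x Fx; rewrite -F0; exists k.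
Qed.

Let variation_sigma_additive : semi_sigma_additive variation.
Proof.
move=> F mF tF mUF.
suff -> : variation (\bigcup_k F k) = \sum_(0 <= k <oo) variation (F k).
  by apply: is_cvg_nneseries => k _ _; exact: variation_ge0.
apply/eqP; rewrite eq_le; apply/andP; split.
  apply: variation_lub => // P [mP tP PF].
  apply: (@le_trans _ _ (\sum_(0 <= k <oo) \sum_(0 <= j <oo) g (P k `&` F j))).
    apply: lee_nneseries => [k _ _|k _]; first exact: g_ge0.
    rewrite [in leLHS](_ : P k = \bigcup_j (P k `&` F j)); last first.
      rewrite -setI_bigcupr; apply/esym/setIidPl; rewrite -PF.
      exact: bigcup_sup.
    apply: g_sigma_sub => [j|]; first exact: measurableI.
    exact: trivIset_setIl.
  rewrite nneseries_interchange//.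
  apply: lee_nneseries => [j _ _|j _].
    by apply: nneseries_ge0 => *; exact: g_ge0.
  apply: variation_ub; split => [k||]; first exact: measurableI.
  - exact: trivIset_setIr.
  - by rewrite -setI_bigcupl PF; apply/setIidPr; exact: bigcup_sup.
apply: lime_le; first by apply: is_cvg_nneseries => k _ _; exact: variation_ge0.
near=> N; apply: (@le_trans _ _ (variation (\big[setU/set0]_(j < N) F j))).
  elim: (N) => [|M ih]; first by rewrite big_geq// variation_ge0.
  rewrite big_nat_recr//= big_ord_recr/=.
  apply: le_trans (variationU _ _ _) => //; first by rewrite leeD2r.
    exact: bigsetU_measurable.
  rewrite -bigcup_mkord setI_bigcupl; apply: bigcup0 => i /= iM.
  by move/trivIsetP : tF; apply => //; rewrite ltn_eqF.
apply: variation_le => //; first exact: bigsetU_measurable.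
by rewrite -bigcup_mkord; apply: bigcup_subset.
Unshelve. all: by end_near. Qed.

HB.instance Definition _ := isMeasure.Build _ _ _ variation
  variation0 variation_ge0 variation_sigma_additive.

Let variation_fin : fin_num_fun variation.
Proof. by move=> A mA; rewrite ge0_fin_numE ?variation_lty. Qed.

HB.instance Definition _ := Measure_isFinite.Build _ _ _ variation variation_fin.

End variation.

Section integral_charge.
Context d (T : measurableType d) {R : realType}.
Variable nu : {charge set T -> \bar R}.

(* The integral of f against the signed measure nu, through its Jordan
   decomposition; the value does not depend on the Hahn decomposition chosen. *)
Definition integral_charge (f : T -> R) : \bar R :=
  let (P, hP) := cid (Hahn_decomposition nu) in
  let (N, hPN) := cid hP in
  (\int[jordan_pos hPN]_x (f x)%:E - \int[jordan_neg hPN]_x (f x)%:E)%E.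

End integral_charge.

Section volume.
Context {R : realType} (n : nat).

(* Lebesgue (not merely Borel) measurability: every subset of a null set is
   measurable. *)
Definition lebesgue_measurable : set (set 'rV[R]_n) :=
  ((lebesgue_rV n)^*)%mu.-cara.-measurable.

Definition vol :
    set (caratheodory_type ((@lebesgue_rV R n)^*)%mu) -> \bar R :=
  @completed_measure_extension _ _ _ (lebesgue_rV n).

HB.instance Definition _ := Measure.on vol.

End volume.
Arguments vol {R n}.

Section BV.
Context {R : realType} {n : nat}.
Implicit Types (f phi : 'rV[R]_n -> R) (u x : 'rV[R]_n).

Definition partial (i : 'I_n) f : 'rV[R]_n -> R :=
  fun x => 'D_(delta_mx ord0 i) f x.

Definition smooth f :=
  forall (s : seq 'I_n) x, differentiable (foldr partial f s) x.

Definition test_function phi :=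
  smooth phi /\ compact (closure [set x | phi x != 0]).

(* The components of Df are finite signed Borel measures; on R^n these are
   automatically Radon. *)
Definition is_distributional_gradient f
    (D : 'I_n -> {charge set 'rV[R]_n -> \bar R}) :=
  forall phi, test_function phi -> forall i,
    (\int[vol]_x (f x * partial i phi x)%:E = - integral_charge (D i) phi)%E.

Definition BV f :=
  vol.-integrable setT (EFin \o f) /\ exists D, is_distributional_gradient f D.

(* For f in BV the measures are unique; the value for other f is irrelevant. *)
Definition distributional_gradient f :
    'I_n -> {charge set 'rV[R]_n -> \bar R} :=
  if pselect (exists D, is_distributional_gradient f D) is left h
  then sval (cid h) else fun=> czero.

Definition grad_variation f : {finite_measure set 'rV[R]_n -> \bar R} :=
  variation (distributional_gradient f).

(* sigma_f = dDf/d|Df| *)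
Definition grad_density f x : 'rV[R]_n :=
  \row_i fine
    (Radon_Nikodym (distributional_gradient f i) (grad_variation f) x).

Local Open Scope ereal_scope.

Definition directional_variation f u : \bar R :=
  \int[grad_variation f]_x `|dotr u (grad_density f x)|%:E.

Definition omega : \bar R := vol (@unit_ball R n).

(* 0^-1 = +oo and +oo^-1 = 0 in \bar R, which are the conventions needed when
   the directional variation vanishes. *)
Definition affine_BV_norm f : \bar R :=
  ((\int[@surface_measure R n]_(u in @unit_sphere R n)
      ((directional_variation f u ^+ n)^-1 / (n%:R%:E * omega)))
    `^ n%:R^-1)^-1.

Definition affine_perimeter (E : set 'rV[R]_n) : \bar R :=
  if pselect (BV (\1_E)) then affine_BV_norm (\1_E) else +oo.

Definition affine_cheeger (q : R) (O : set 'rV[R]_n) : \bar R :=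
  ereal_inf [set affine_perimeter D / vol D `^ q^-1 |
    D in [set D | [/\ lebesgue_measurable D, D `<=` O & 0 < vol D]]].

End BV.

Definition boundary {T : topologicalType} (A : set T) : set T :=
  closure A `\` interior A.

(* Main.v *)
(* If the boundaries of E and O were disjoint, the closure of E would lie in O, so E
   could be deformed slightly inside O.  Deform E by a composition of shears
   x |-> x + t a_k(x) e_k, one per coordinate, where a_k(x) = x_k on a large ball and
   a_k = 0 far away: on the large ball this is the homothety of ratio 1 + t, which
   multiplies the affine perimeter by (1 + t)^(n-1) and V^(1/q) by (1 + t)^(n/q), with
   n/q > n - 1.  Outside the ball the relative error is O(t), on a set carrying
   arbitrarily little of V and |D1_E|; the ball is chosen first, then t, so that the
   deformed set stays in O.  For small t it has a smaller Cheeger ratio than E.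
   Shears change one coordinate at a time, so that both the change of variables for V
   and the transformation law of the gradient reduce to one-dimensional calculus. *)
Require Import Defs.
From HB Require Import structures.
From mathcomp Require Import all_boot all_order all_algebra.
From mathcomp Require Import all_classical all_reals all_analysis.
From mathcomp Require Import measurable_realfun.
From mathcomp Require Import ring lra.
Set Implicit Arguments.
Unset Strict Implicit.
Unset Printing Implicit Defensive.
Import Order.TTheory GRing.Theory Num.Theory.
Import numFieldNormedType.Exports.
Local Open Scope classical_set_scope.
Local Open Scope ring_scope.

(** * Signed measures and boxes *)

(** The gradient of an indicator is only a chosen witness, and the deformed set has no explicit
    description. Both are therefore carried over the original set: each gradient is the image under
    a map [S] of a density [g] times the fixed measure |D1_E|, each volume is an integral of a
    weight [w], and a shear updates [S], [g] and [w] pointwise. For the deformed set an upper bound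
    of the directional variations suffices, and any such representation gives one.

    The field is r a(x/r): bounds on its first derivatives do not involve r, so the O(t) constant is
    known before the radius, and the radius before t. To make the error outside the ball a relative
    one, the directional variations of E need a positive lower bound uniform in the direction; it
    comes from integrating by parts against the same field. Each component of the gradient is
    multiplied by 1 + t by every shear except the one in its own direction, hence the power n - 1.
    The field has compact support because O may be unbounded, and closure E may then come
    arbitrarily close to the complement of O. *)

Section integral_charge_difference.
Context d (T : measurableType d) {R : realType}.
Local Open Scope ereal_scope.

Lemma integrable_bounded (mu : {finite_measure set T -> \bar R}) (f : T -> R) (M : R) :
  measurable_fun setT f -> (forall x, `|f x| <= M)%R ->
  mu.-integrable setT (EFin \o f).
Proof.
move=> mf fM; apply: (measurable_bounded_integrable _ _ mf) => //.
  exact: fin_num_fun_lty.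
exists M; split; first exact: num_real.
by move=> x Mx y _; apply: le_trans (fM y) _; exact: ltW.
Qed.

(** The Jordan parts satisfy p - q = m1 - m2, hence p + m2 = q + m1 as measures, and integrating [f]
    against both sums gives the claim. This frees [integral_charge] from the Hahn decomposition
    hidden in its definition. *)
Lemma integral_chargeE (nu : {charge set T -> \bar R})
    (m1 m2 : {finite_measure set T -> \bar R}) (f : T -> R) (M : R) :
  (forall A, measurable A -> nu A = m1 A - m2 A) ->
  measurable_fun setT f -> (forall x, `|f x| <= M)%R ->
  integral_charge nu f = \int[m1]_x (f x)%:E - \int[m2]_x (f x)%:E.
Proof.
move=> nuE mf fM; rewrite /integral_charge.
case: (cid _) => P hP; case: (cid _) => N hPN.
set p := jordan_pos hPN; set q := jordan_neg hPN.
have E A : measurable A -> p A + m2 A = q A + m1 A.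
  move=> mA; have : m1 A - m2 A = p A - q A.
    by rewrite -nuE// (jordan_decomp hPN mA) /cadd/= cscaleN1.
  have : p A \is a fin_num by exact: fin_num_measure.
  have : q A \is a fin_num by exact: fin_num_measure.
  have : m1 A \is a fin_num by exact: fin_num_measure.
  have : m2 A \is a fin_num by exact: fin_num_measure.
  move: (p A) (q A) (m1 A) (m2 A) => [x||] [y||] [z||] [t||] //= _ _ _ _.
  rewrite -!EFinD => -[h]; congr EFin; lra.
have ip (mu : {finite_measure set T -> \bar R}) : mu.-integrable setT (EFin \o f).
  exact: integrable_bounded fM.
have I : \int[p]_x (f x)%:E + \int[m2]_x (f x)%:E =
         \int[q]_x (f x)%:E + \int[m1]_x (f x)%:E.
  rewrite -(@integral_measure_add _ _ _ p m2 _ measurableT (EFin \o f) (ip p) (ip m2)).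
  rewrite -(@integral_measure_add _ _ _ q m1 _ measurableT (EFin \o f) (ip q) (ip m1)).
  apply: eq_measure_integral => A mA _; rewrite /measure_add/= /msum !big_ord_recl !big_ord0/= !adde0.
  exact: E.
have : \int[p]_x (f x)%:E \is a fin_num by apply: integrable_fin_num (ip p).
have : \int[q]_x (f x)%:E \is a fin_num by apply: integrable_fin_num (ip q).
have : \int[m1]_x (f x)%:E \is a fin_num by apply: integrable_fin_num (ip m1).
have : \int[m2]_x (f x)%:E \is a fin_num by apply: integrable_fin_num (ip m2).
move: (\int[p]_x _) (\int[q]_x _) (\int[m1]_x _) (\int[m2]_x _) I.
move=> [x||] [y||] [z||] [t||] //=.
by move=> [h] _ _ _ _; rewrite -!EFinB; congr EFin; lra.
Qed.

End integral_charge_difference.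

Section boxes.
Context {R : realType} {n : nat}.
Implicit Types a b : 'I_n -> R.

Definition box a b : set 'rV[R]_n := [set v | forall i, a i < v ord0 i < b i].

Lemma boxE a b : box a b =
  \bigcap_(i in [set: 'I_n]) ((fun v : 'rV[R]_n => v ord0 i : R) @^-1` `]a i, b i[).
Proof.
apply/seteqP; split => [v abv i _|v abv i]; first by rewrite /= in_itv/=.
by have := abv i Logic.I; rewrite /= in_itv.
Qed.

Lemma measurable_box a b : measurable (box a b).
Proof.
rewrite boxE; apply: fin_bigcap_measurable => // i _.
by rewrite -[X in measurable X]setTI; exact: measurable_rV_coord.
Qed.

(** A slab in one coordinate is a union of boxes whose other sides are ]-k, k[. So the coordinates
    are measurable for the sigma-algebra of boxes, and with them the identity into the Borel
    space. *)
Lemma measurable_box_gen :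
  @measurable _ 'rV[R]_n = <<s [set B | exists a b, B = box a b] >>.
Proof.
apply/seteqP; split; last first.
  apply: smallest_sub; first exact: sigma_algebra_measurable.
  by move=> _ [a [b ->]]; exact: measurable_box.
pose G := [set B : set 'rV[R]_n | exists a b, B = box a b].
pose f : g_sigma_algebraType G -> 'rV[R]_n := id.
have mf : measurable_fun setT f.
  apply: measurable_fun_rV => i.
  apply: (measurability _ (RGenOpens.measurableE R)).
  move=> _ [_ [a [b ->]] <-]; rewrite setTI.
  rewrite (_ : _ @^-1` _ = \bigcup_(k : nat)
     box (fun j => if j == i then a else - k%:R) (fun j => if j == i then b else k%:R)).
    apply: bigcupT_measurable => k; apply: sub_sigma_algebra.
    by eexists; eexists; reflexivity.
  apply/seteqP; split => [v|v [k _ /(_ i)]]; last by rewrite eqxx /= in_itv.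
  rewrite /= in_itv/= => /andP[av vb].
  pose m := \sum_j `|v ord0 j|.
  exists (Num.trunc m).+1 => // j.
  case: eqP => [->|_]; first by rewrite /f av vb.
  rewrite -ltr_norml; apply: le_lt_trans (truncnS_gt m).
  by rewrite /m (bigD1 j)//= lerDl sumr_ge0.
by move=> A mA; rewrite -[A]setTI; exact: mf.
Qed.

(** Boxes are stable under intersection, and the cubes ]-k, k[^n exhaust the space. *)
Lemma measure_box_unique (m1 m2 : {measure set 'rV[R]_n -> \bar R}) :
  (forall a b, m1 (box a b) = m2 (box a b)) ->
  (forall a b, m1 (box a b) < +oo)%E ->
  forall A, measurable A -> m1 A = m2 A.
Proof.
move=> m12 m1oo; apply: (measure_unique
  [set B | exists a b, B = box a b] (fun k => box (fun=> - k%:R) (fun=> k%:R))).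
- exact: measurable_box_gen.
- move=> _ _ [a [b ->]] [a' [b' ->]].
  exists (fun i => Num.max (a i) (a' i)), (fun i => Num.min (b i) (b' i)).
  apply/seteqP; split => [v [h1 h2] i|v h]; last first.
    by split => i; have := h i; rewrite gt_max lt_min => /andP[/andP[? ?] /andP[? ?]]; apply/andP.
  by have := h1 i; have := h2 i; rewrite gt_max lt_min => /andP[-> ->] /andP[-> ->].
- by move=> k; eexists; eexists; reflexivity.
- apply/seteqP; split => // v _; pose m := \sum_j `|v ord0 j|.
  exists (Num.trunc m).+1 => // j; rewrite -ltr_norml.
  by apply: le_lt_trans (truncnS_gt m); rewrite /m (bigD1 j)//= lerDl sumr_ge0.
- by move=> _ [a [b ->]].
- by move=> k.
Qed.

End boxes.

(** * Smooth and test functions *)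

Section flat.
Context {R : realType}.
Implicit Types (s : R) (m : nat).

(** For m = 0 this is the classical exp(-1/s). The powers s^-m are included so that the span of the
    family is closed under differentiation. *)
Definition flat m s : R := if 0 < s then s ^- m * expR (- s^-1) else 0.

Lemma flat_ge0 m s : 0 <= flat m s.
Proof.
rewrite /flat; case: ifPn => // s0.
by rewrite mulr_ge0 ?expR_ge0// invr_ge0 exprn_ge0// ltW.
Qed.

(** The bound exp(x) >= x^(m+2) / (m+2)! at x = 1/s. Quadratic decay is what makes the difference
    quotient at 0 tend to 0. *)
Lemma flat_le_sqr m s : flat m s <= m.+2`!%:R * s ^+ 2.
Proof.
rewrite /flat; case: ifPn => s0; last by rewrite mulr_ge0// sqr_ge0.
have si0 : 0 <= s^-1 by rewrite invr_ge0 ltW.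
have F0 : 0 < (m.+2`!%:R : R) by rewrite ltr0n fact_gt0.
have := expR_ge1Dxn m.+1 si0; set F := (m.+2`!)%:R in F0 * => h.
have {}h : s^-1 ^+ m.+2 <= F * expR s^-1.
  rewrite mulrC -ler_pdivrMr//; apply: le_trans h; by rewrite lerDr.
rewrite expRN ler_pdivrMr ?expR_gt0//.
rewrite [leRHS](_ : _ = s ^+ 2 * (F * expR s^-1)); last by ring.
apply: le_trans (ler_wpM2l _ h); last exact: sqr_ge0.
rewrite -exprVn le_eqVlt; apply/orP; left; apply/eqP.
rewrite (exprS _ m.+1) (exprS _ m); move: (s^-1 ^+ m) => z; field.
by rewrite gt_eqF.
Qed.

Lemma is_derive_flat m s :
  is_derive s 1 (flat m) (flat m.+2 s - m%:R * flat m.+1 s).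
Proof.
have [s0|s0|s0] := ltgtP s 0.
- have -> : flat m.+2 s - m%:R * flat m.+1 s = 0.
    by rewrite /flat ltNge (ltW s0)/= mulr0 subr0.
  apply: (near_eq_is_derive (f := cst (0 : R))).
  near=> x; rewrite /flat ifN// -leNgt; apply: ltW; near: x.
  exact: lt_nbhsl.
- have sn0 : s != 0 by rewrite gt_eqF.
  have dV : is_derive s 1 (fun x : R => x^-1) (- s ^- 2).
    have := @is_deriveV R id s 1 1 sn0 (is_derive_id _ _).
    by rewrite /GRing.scale/= mulr1.
  have dX := @is_deriveX _ _ (fun x : R => x^-1) m s 1 _ dV.
  have dN : is_derive s 1 (fun x : R => - x^-1) (s ^- 2).
    by have := @is_deriveN _ _ _ _ _ _ _ dV; rewrite opprK.
  have dE : is_derive s 1 (fun x : R => expR (- x^-1)) (expR (- s^-1) * (s ^- 2)).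
    exact: (@is_derive1_comp _ expR (fun x : R => - x^-1)).
  have h := @is_deriveM _ _ _ _ _ _ _ _ dX dE.
  apply: is_derive_eq.
    apply: near_eq_is_derive h; near=> x.
    rewrite /flat ifT; last by near: x; exact: lt_nbhsr.
    by rewrite -exprVn /GRing.mul/= exprfctE.
  rewrite /flat s0 /GRing.scale/= !exprfctE -!exprVn.
  case: m {h dX} => [|m].
    by rewrite !mul0r !expr0 !mulr0 !mul1r subr0 addr0 mulrC.
  by rewrite /= !exprS; ring.
- have -> : flat m.+2 s - m%:R * flat m.+1 s = 0.
    by rewrite s0 /flat ltxx mulr0 subr0.
  rewrite {}s0.
  have dq : (fun h : R => h^-1 *: (flat m (h *: 1 + 0) - flat m 0)) @ 0^' --> (0 : R).
    apply/cvgr0Pnorm_le => e e0.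
    near=> h.
    rewrite /= {2}/flat ltxx subr0 addr0 /GRing.scale/= mulr1 normrM normfV.
    rewrite (ger0_norm (flat_ge0 _ _)).
    have h0 : h != 0 by near: h; exact: nbhs_dnbhs_neq.
    rewrite mulrC ler_pdivrMr ?normr_gt0//.
    apply: le_trans (flat_le_sqr _ _) _.
    rewrite -real_normK ?num_real// expr2 mulrA ler_wpM2r//.
    rewrite mulrC -ler_pdivlMr ?ltr0n ?fact_gt0//.
    near: h; apply: dnbhs0_le.
    by rewrite divr_gt0// ltr0n fact_gt0.
  by split; [apply/cvg_ex; exists 0|apply/cvg_lim].
Unshelve. all: by end_near. Qed.

End flat.

Section derive_shear.
Context {R : realType} {V : normedModType R}.
Implicit Types (f b : V -> R) (c : R) (e x v : V).

Lemma differentiable_affine_shear c b e x : differentiable b x ->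
  differentiable (fun y => c *: y + b y *: e) x.
Proof.
move=> db.
have dZ : differentiable (fun y : V => c *: y) x by exact: differentiableZ.
exact: differentiableD dZ (differentiableZl e db).
Qed.

Lemma derive_shear f c b e v x :
  differentiable b x -> differentiable f (c *: x + b x *: e) ->
  'D_v (f \o (fun y => c *: y + b y *: e)) x =
  c * 'D_v f (c *: x + b x *: e) + 'D_v b x * 'D_e f (c *: x + b x *: e).
Proof.
move=> db df; have ds := differentiable_affine_shear c e db.
have dc : differentiable (f \o (fun y => c *: y + b y *: e)) x.
  exact: differentiable_comp.
rewrite (deriveE _ dc) !(deriveE _ df) (deriveE _ db) diff_comp//.
have h2 : is_diff x (fun y => b y *: e) (fun z => 'd b x z *: e).
  by apply: DiffDef; [exact: differentiableZl|exact: diffZl].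
have h := is_diffD (is_diff_scaler c x) h2.
have -> : 'd (fun y => c *: y + b y *: e) x = (fun z => c *: z + 'd b x z *: e) :> (_ -> _).
  exact: (@diff_val _ _ _ _ _ _ _ h).
by rewrite /comp linearD !linearZ.
Qed.

Lemma derive_comp1 (h : R -> R) (dh : R) f v x :
  is_derive (f x) 1 h dh -> differentiable f x ->
  'D_v (h \o f) x = dh * 'D_v f x.
Proof.
move=> [dh1 dh2] df; have dh3 := (derivable1_diffP h (f x)).1 dh1.
have dc : differentiable (h \o f) x by exact: differentiable_comp.
rewrite (deriveE _ dc) (deriveE _ df) diff_comp// /comp diff1E//.
by rewrite derive1E dh2 mulrC.
Qed.

End derive_shear.

(** * Closure properties of smooth functions *)

Section smooth_functions.
Context {R : realType} {n : nat}.
Implicit Types (f g : 'rV[R]_n -> R) (i j : 'I_n) (x v : 'rV[R]_n).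

(** [smooth] quantifies over lists of partial derivatives. This form, recursive in the order,
    supports inductions in which the function itself varies: the partials of a product or a
    composition are sums of products of the same kind. *)
Fixpoint smooth_upto (m : nat) f : Prop :=
  (forall x, differentiable f x) /\
  if m is m'.+1 then forall i, smooth_upto m' (partial i f) else True.

Lemma smooth_uptoW m f : smooth_upto m.+1 f -> smooth_upto m f.
Proof.
by elim: m f => [|m ih] f [df pf]; split => // i; apply: ih; exact: pf.
Qed.

Lemma smooth_upto_diff m f x : smooth_upto m f -> differentiable f x.
Proof. by case: m => [|m] []. Qed.

Lemma smooth_partial i f : smooth f -> smooth (partial i f).
Proof. by move=> sf s x; have := sf (rcons s i) x; rewrite foldr_rcons. Qed.

Lemma smooth_diff f x : smooth f -> differentiable f x.
Proof. by move=> sf; have := sf [::] x. Qed.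

Lemma smoothP f : smooth f <-> forall m, smooth_upto m f.
Proof.
split => [sf m|sf s].
  elim: m f sf => [|m ih] f sf; (split; first by move=> x; exact: smooth_diff) => //.
  by move=> i; apply: ih; exact: smooth_partial.
elim/last_ind: s f sf => [|s i ih] f sf x; first by have [] := sf 0%N.
by rewrite foldr_rcons; apply: ih => m; have [_ /(_ i)] := sf m.+1.
Qed.

Lemma partialD i f g : (forall x, differentiable f x) ->
  (forall x, differentiable g x) ->
  partial i (f \+ g) = partial i f \+ partial i g.
Proof.
move=> df dg; apply/funext => x; rewrite /partial.
by apply: deriveD; exact: diff_derivable.
Qed.

Lemma partialM i f g : (forall x, differentiable f x) ->
  (forall x, differentiable g x) ->
  partial i (f \* g) = (f \* partial i g) \+ (g \* partial i f).
Proof.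
move=> df dg; apply/funext => x; rewrite /partial.
by apply: deriveM; exact: diff_derivable.
Qed.

Lemma partial_cst i (c : R) : partial i (cst c) = cst 0.
Proof. by apply/funext => x; rewrite /partial derive_cst. Qed.

Lemma partial_coord i j : partial i (fun x => x ord0 j) = cst (i == j)%:R.
Proof.
apply/funext => x; rewrite /partial deriveE; last exact: differentiable_coord.
pose f : 'rV[R]_n -> R := fun N => N ord0 j.
have fl : linear f by move=> k v w; rewrite /f !mxE.
pose F : {linear 'rV[R]_n -> R} := HB.pack f (GRing.isLinear.Build _ _ _ _ _ fl).
have -> : (fun x0 : 'rV[R]_n => x0 ord0 j) = F by [].
rewrite diff_lin; last exact: coord_continuous.
by rewrite /F/= /f mxE eqxx/= eq_sym.
Qed.

Lemma smooth_uptoD m f g : smooth_upto m f -> smooth_upto m g ->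
  smooth_upto m (f \+ g).
Proof.
have D (u v : 'rV[R]_n -> R) : (forall x, differentiable u x) ->
    (forall x, differentiable v x) -> forall x, differentiable (u \+ v) x.
  by move=> du dv x; exact: differentiableD.
elim: m f g => [|m ih] f g [df pf] [dg pg].
  by split => //; exact: D.
split => [|i]; first exact: D.
by rewrite partialD//; apply: ih; [exact: pf|exact: pg].
Qed.

Lemma smooth_uptoM m f g : smooth_upto m f -> smooth_upto m g ->
  smooth_upto m (f \* g).
Proof.
elim: m f g => [|m ih] f g sf sg.
  by split => //; move=> x; apply: differentiableM;
    [exact: smooth_upto_diff sf|exact: smooth_upto_diff sg].
have [df pf] := sf; have [dg pg] := sg.
split => [x|i]; first exact: differentiableM.
rewrite partialM//; apply: smooth_uptoD; apply: ih; by [exact: smooth_uptoW|exact: pf|exact: pg].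
Qed.

Lemma smooth_upto_cst m (c : R) : smooth_upto m (cst c).
Proof.
elim: m c => [|m ih] c; (split; first by move=> x; exact: differentiable_cst) => //.
by move=> i; rewrite partial_cst.
Qed.

Lemma smoothD f g : smooth f -> smooth g -> smooth (f \+ g).
Proof. by move=> /smoothP sf /smoothP sg; apply/smoothP => m; exact: smooth_uptoD. Qed.

Lemma smoothM f g : smooth f -> smooth g -> smooth (f \* g).
Proof. by move=> /smoothP sf /smoothP sg; apply/smoothP => m; exact: smooth_uptoM. Qed.

Lemma smooth_cst (c : R) : smooth (cst c : 'rV[R]_n -> R).
Proof. by apply/smoothP => m; exact: smooth_upto_cst. Qed.

Lemma smooth_coord i : smooth (fun x => x ord0 i).
Proof.
apply/smoothP => -[|m]; (split; first by move=> x; exact: differentiable_coord) => //.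
by move=> j; rewrite partial_coord; exact: smooth_upto_cst.
Qed.

Lemma smooth_prod (I : Type) (r : seq I) (F : I -> 'rV[R]_n -> R) :
  (forall k, smooth (F k)) -> smooth (fun x => \prod_(k <- r) F k x).
Proof.
move=> sF; elim: r => [|i r ih].
  by under eq_fun do rewrite big_nil; exact: smooth_cst.
by under eq_fun do rewrite big_cons; exact: smoothM.
Qed.

(** A partial of [flat m \o f] combines [flat] functions of higher index with a partial of f, so the
    induction on the order runs over all m at once. *)
Lemma smooth_flat m f : smooth f -> smooth (flat m \o f).
Proof.
have key k x : differentiable (flat k) (f x).
  by apply/derivable1_diffP; have [] := is_derive_flat k (f x).
move=> sf; have df x := smooth_diff x sf.
have dk k x : differentiable (flat k \o f) x by exact: differentiable_comp.
apply/smoothP => k; elim: k m => [|k ih] m; split => // i.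
have -> : partial i (flat m \o f) =
    ((flat m.+2 \o f) \+ (cst (- m%:R) \* (flat m.+1 \o f))) \* partial i f.
  apply/funext => x; rewrite /partial (derive_comp1 _ (is_derive_flat m (f x)))//.
  by rewrite [RHS]/= mulNr.
apply: smooth_uptoM; last by have /smoothP := smooth_partial i sf.
by apply: smooth_uptoD => //; apply: smooth_uptoM => //; exact: smooth_upto_cst.
Qed.

(* Covers both the rescaling x |-> c x and the shear x |-> x + b(x) e_k. *)
Definition shear (c : R) (b : 'rV[R]_n -> R) (k : 'I_n) x : 'rV[R]_n :=
  c *: x + b x *: delta_mx ord0 k.

Lemma differentiable_shear c b k x : differentiable b x ->
  differentiable (shear c b k) x.
Proof. exact: differentiable_affine_shear. Qed.

Lemma partial_shear f c b k i x : differentiable b x ->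
  differentiable f (shear c b k x) ->
  partial i (f \o shear c b k) x =
  c * partial i f (shear c b k x) + partial i b x * partial k f (shear c b k x).
Proof. exact: derive_shear. Qed.

(** A partial of [f \o shear c b k] is a combination of functions [partial j f \o shear c b k], so
    the induction on the order runs over all f at once. *)
Lemma smooth_shear f c b k : smooth f -> smooth b -> smooth (f \o shear c b k).
Proof.
move=> sf sb; apply/smoothP => m; elim: m f sf => [|m ih] f sf.
  split => //; move=> x; apply: differentiable_comp; last exact: smooth_diff.
  by apply: differentiable_shear; exact: smooth_diff.
split => [x|i].
  apply: differentiable_comp; last exact: smooth_diff.
  by apply: differentiable_shear; exact: smooth_diff.
have -> : partial i (f \o shear c b k) = (cst c \* (partial i f \o shear c b k))
    \+ (partial i b \* (partial k f \o shear c b k)).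
  by apply/funext => x; rewrite partial_shear//; exact: smooth_diff.
apply: smooth_uptoD; apply: smooth_uptoM.
- exact: smooth_upto_cst.
- by apply: ih; exact: smooth_partial.
- by have /smoothP := smooth_partial i sb.
- by apply: ih; exact: smooth_partial.
Qed.

End smooth_functions.

(** * Mean value theorem along lines and symmetry of second derivatives *)

Section line_derivative.
Context {R : realType} {V : normedModType R}.
Implicit Types (f : V -> R) (u v x y : V).

Lemma is_derive_line f v y (s : R) : differentiable f (y + s *: v) ->
  is_derive s 1 (fun r => f (y + r *: v)) ('D_v f (y + s *: v)).
Proof.
move=> df; have h1 : is_diff s (fun r : R => y + r *: v) (fun r => r *: v).
  have := is_diffD (is_diff_cst y s) (is_diff_scalel s v).
  by rewrite add0r.
have d1 : differentiable (fun r : R => y + r *: v) s by case: h1.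
have dc : differentiable (f \o (fun r : R => y + r *: v)) s.
  exact: differentiable_comp.
split; first exact: diff_derivable.
rewrite -[LHS]/('D_1 (f \o (fun r : R => y + r *: v)) s) (deriveE _ dc) (deriveE _ df).
rewrite diff_comp// /comp.
have -> : 'd (fun r : R => y + r *: v) s = (fun r => r *: v) :> (_ -> _).
  exact: (@diff_val _ _ _ _ _ _ _ h1).
by rewrite scale1r.
Qed.

Lemma MVT_line f v y (h : R) : (forall z, differentiable f z) -> 0 < h ->
  exists2 s, 0 < s < h & f (y + h *: v) - f y = h * 'D_v f (y + s *: v).
Proof.
move=> df h0; pose g (r : R) := f (y + r *: v).
have dg (r : R) : is_derive r 1 g ('D_v f (y + r *: v)) by exact: is_derive_line.
have [|c c0h] := @MVT R g (fun r : R => 'D_v f (y + r *: v)) 0 h h0 (fun r _ => dg r).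
  apply: continuous_subspaceT => r; apply: differentiable_continuous.
  by apply/derivable1_diffP; have [] := dg r.
by rewrite /g scale0r addr0 subr0 mulrC => ->; exists c.
Qed.

Lemma derive_shift f v w x : differentiable f (x + w) ->
  'D_v (fun y => f (y + w)) x = 'D_v f (x + w).
Proof.
move=> df; have E : (fun y => f (y + w)) = f \o (fun y => 1 *: y + (cst 1 : V -> R) y *: w).
  by apply/funext => y; rewrite /comp /cst !scale1r.
rewrite E derive_shear; last by rewrite /cst !scale1r.
  by rewrite derive_cst mul0r addr0 mul1r /cst !scale1r.
exact: differentiable_cst.
Qed.

(** The second difference over the parallelogram spanned by h u and h v is h^2 times a mixed
    derivative at some point of it, in either order of differentiation, by two uses of the mean
    value theorem. Continuity at x then compares the two mixed derivatives. *)
Lemma derive_comm f u v x : (forall z, differentiable f z) ->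
  (forall z, differentiable ('D_u f) z) -> (forall z, differentiable ('D_v f) z) ->
  {for x, continuous ('D_u ('D_v f))} -> {for x, continuous ('D_v ('D_u f))} ->
  'D_u ('D_v f) x = 'D_v ('D_u f) x.
Proof.
move=> df du dv cuv cvu.
have key a b (h : R) : (forall z, differentiable ('D_a f) z) -> 0 < h ->
    exists s t, [/\ 0 < s < h, 0 < t < h &
    f (x + h *: a + h *: b) - f (x + h *: a) - (f (x + h *: b) - f x) =
    h * h * 'D_b ('D_a f) (x + s *: a + t *: b)].
  move=> da h0; pose g := (f \o shift (h *: b)) - f.
  have ds z : differentiable (f \o shift (h *: b)) z by exact: differentiable_comp.
  have dg z : differentiable g z by exact: differentiableB.
  have [s s0h E] := MVT_line a x dg h0.
  have [t t0h F] := MVT_line b (x + s *: a) da h0.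
  exists s, t; split => //; rewrite -mulrA -F.
  move: E; rewrite /g -[(_ - _) x]/(f (x + h *: b) - f x).
  rewrite -[(_ - _) (x + h *: a)]/(f (x + h *: a + h *: b) - f (x + h *: a)) => ->.
  congr (_ * _); rewrite (deriveB (@diff_derivable _ _ _ _ _ a (ds _)) (@diff_derivable _ _ _ _ _ a (df _))).
  have E' : 'D_a (f \o shift (h *: b)) (x + s *: a) = 'D_a f (x + s *: a + h *: b).
    exact: derive_shift.
  by rewrite E'.
apply/eqP; rewrite -subr_eq0 -normr_le0; apply/ler_addgt0Pl => e e0; rewrite addr0.
have e20 : 0 < e / 2 by rewrite divr_gt0.
have /cvgrPdist_lt/(_ _ e20)/nbhs_ballP[d1 /= d10 H1] := cuv.
have /cvgrPdist_lt/(_ _ e20)/nbhs_ballP[d2 /= d20 H2] := cvu.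
pose d := Num.min d1 d2; have d0 : 0 < d by rewrite lt_min d10.
(* With h = d / (|u| + |v| + 1) every intermediate point lies within d of x; the + 1 covers u = v =
   0. *)
pose m := `|u| + `|v| + 1; have m0 : 0 < m by rewrite ltr_wpDl// addr_ge0.
pose h := d / m; have h0 : 0 < h by rewrite divr_gt0.
have near_x a b s t : (a = u /\ b = v) \/ (a = v /\ b = u) ->
    0 < s < h -> 0 < t < h -> `|x - (x + s *: a + t *: b)| < d.
  move=> ab /andP[s0 sh] /andP[t0 th].
  rewrite -addrA opprD addrA subrr add0r normrN.
  apply: le_lt_trans (ler_normD _ _) _; rewrite !normrZ !gtr0_norm//.
  apply: (@le_lt_trans _ _ (h * (`|u| + `|v|))).
    have -> : `|u| + `|v| = `|a| + `|b| by case: ab => -[-> ->] //; rewrite addrC.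
    by rewrite mulrDr lerD// ler_wpM2r// ltW.
  by rewrite /h mulrAC ltr_pdivrMr// ltr_pM2l// /m ltrDl.
have [s1 [t1 [s10 t10 E1]]] := key u v h du h0.
have [s2 [t2 [s20 t20 E2]]] := key v u h dv h0.
have : 'D_v ('D_u f) (x + s1 *: u + t1 *: v) = 'D_u ('D_v f) (x + s2 *: v + t2 *: u).
  apply: (@mulfI _ (h * h)); first by rewrite mulf_neq0// gt_eqF.
  have E0 : x + h *: u + h *: v = x + h *: v + h *: u by exact: addrAC.
  apply: (etrans (esym E1)); apply: etrans E2; rewrite E0.
  have aux (p q r t : R) : p - q - (r - t) = p - r - (q - t) by ring.
  exact: aux.
have /H2 : ball x d2 (x + s1 *: u + t1 *: v).
  rewrite -ball_normE /ball_ /=.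
  by apply: lt_le_trans (near_x _ _ _ _ (or_introl (conj erefl erefl)) s10 t10) _; rewrite ge_min lexx orbT.
have /H1 : ball x d1 (x + s2 *: v + t2 *: u).
  rewrite -ball_normE /ball_ /=.
  by apply: lt_le_trans (near_x _ _ _ _ (or_intror (conj erefl erefl)) s20 t20) _; rewrite ge_min lexx.
have aux (A B C D : R) : `|A - D| < e / 2 -> `|B - C| < e / 2 -> C = D -> `|A - B| <= e.
  move=> AD BC CD; rewrite (_ : A - B = (A - D) - (B - C)); last by rewrite CD; ring.
  by apply: le_trans (ler_normB _ _) _; rewrite (splitr e) lerD// ltW.
exact: aux.
Qed.

End line_derivative.

Lemma partialC {R : realType} {n : nat} i j (f : 'rV[R]_n -> R) : smooth f ->
  partial i (partial j f) = partial j (partial i f).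
Proof.
move=> sf; apply/funext => x; apply: derive_comm => [z|z|z||].
- exact: smooth_diff.
- exact: (smooth_diff z (smooth_partial i sf)).
- exact: (smooth_diff z (smooth_partial j sf)).
- apply: differentiable_continuous.
  exact: (smooth_diff x (smooth_partial i (smooth_partial j sf))).
- apply: differentiable_continuous.
  exact: (smooth_diff x (smooth_partial j (smooth_partial i sf))).
Qed.


Section smooth_step.
Context {R : realType}.
Implicit Types s : R.

Lemma flat0_gt0 : 0 < flat 0 1 :> R.
Proof. by rewrite /flat ltr01 expr0 invr1 mul1r expR_gt0. Qed.

Lemma flat0_mono : {homo (@flat R 0) : x y / x <= y}.
Proof.
move=> x y xy; rewrite {1}/flat; case: ifPn => x0; last exact: flat_ge0.
rewrite /flat (lt_le_trans x0 xy) expr0 invr1 !mul1r ler_expR lerN2.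
by rewrite lef_pV2// posrE// (lt_le_trans x0 xy).
Qed.

(** A smooth step from 0 on s <= 0 to 1 on s >= 1. It composes [flat 0] with itself, dividing only
    by the constant [flat 0 1], so smoothness needs no quotient of functions. *)
Definition sstep s : R := 1 - flat 0 (1 - flat 0 s / flat 0 1) / flat 0 1.

Lemma sstep_le1 s : sstep s <= 1.
Proof. by rewrite /sstep gerBl divr_ge0 ?flat_ge0. Qed.

Lemma sstep_ge0 s : 0 <= sstep s.
Proof.
rewrite /sstep subr_ge0 ler_pdivrMr ?flat0_gt0// mul1r.
by apply: flat0_mono; rewrite gerBl divr_ge0 ?flat_ge0.
Qed.

Lemma sstep0 s : s <= 0 -> sstep s = 0.
Proof.
move=> s0; rewrite /sstep {2}/flat ltNge s0/= mul0r subr0 divff ?subrr//.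
by rewrite gt_eqF// flat0_gt0.
Qed.

Lemma sstep1 s : 1 <= s -> sstep s = 1.
Proof.
move=> s1; rewrite /sstep {1}/flat ifN ?mul0r ?subr0//.
by rewrite -leNgt subr_le0 ler_pdivlMr ?flat0_gt0// mul1r flat0_mono.
Qed.

End smooth_step.

(** * Test functions and bumps on boxes *)

Section test_functions.
Context {R : realType} {n : nat}.
Implicit Types (f g phi : 'rV[R]_n -> R) (a b : 'I_n -> R) (x : 'rV[R]_n).

Lemma rV_norm_le x (M : R) : 0 <= M -> `|x| <= M <-> forall i, `|x ord0 i| <= M.
Proof.
move=> M0; split => [xM i|xM].
  apply: le_trans xM; have /mapP[j Hj ->] :
      `|x ord0 i| \in [seq `|x k.1 k.2| | k : 'I_1 * 'I_n].
    by apply/mapP; exists (ord0, i) => //=; rewrite mem_enum.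
  by rewrite -[leRHS]/(mx_norm x) mx_normrE; apply/bigmax_geP; right => /=; exists j.
rewrite -[leLHS]/(mx_norm x) mx_normrE; apply/bigmax_leP; split => // -[i j] _ /=.
by rewrite (ord1 i).
Qed.

Lemma rV_coord_le x i : `|x ord0 i| <= `|x|.
Proof. by have [+ _] := rV_norm_le x (normr_ge0 x); apply. Qed.

Lemma smooth_sstep f : smooth f -> smooth (@sstep R \o f).
Proof.
move=> sf.
have -> : sstep \o f = cst 1 \+ (cst (- (flat 0 1)^-1) \*
  (flat 0 \o (cst 1 \+ (cst (- (flat 0 1)^-1) \* (flat 0 \o f))))).
  apply/funext => x; rewrite /sstep /=; congr (1 + _); rewrite mulNr mulrC.
  by rewrite (mulNr _ (flat 0 (f x))) (mulrC _ (flat 0 (f x))).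
apply: smoothD; first exact: smooth_cst.
apply: smoothM; first exact: smooth_cst.
apply/smooth_flat/smoothD; first exact: smooth_cst.
by apply: smoothM; [exact: smooth_cst|exact: smooth_flat].
Qed.

(** The parameter k is a slope: for k > 0 the plateau begins at distance 1/k inside the faces, so
    the bumps tend to the indicator of the open box as k grows. *)
Definition box_bump (k : R) a b x : R :=
  \prod_i (sstep (k * (x ord0 i - a i)) * sstep (k * (b i - x ord0 i))).

Lemma smooth_box_bump k a b : smooth (box_bump k a b).
Proof.
apply: smooth_prod => i; apply: smoothM; apply: smooth_sstep.
- apply: (@smoothM _ _ (cst k) (fun x => x ord0 i - a i)); first exact: smooth_cst.
  by apply: smoothD; [exact: smooth_coord|exact: smooth_cst].
- apply: (@smoothM _ _ (cst k) (fun x => b i - x ord0 i)); first exact: smooth_cst.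
  apply: (@smoothD _ _ (cst (b i)) (fun x => - x ord0 i)); first exact: smooth_cst.
  have -> : (fun x => - x ord0 i) = cst (-1) \* (fun x => x ord0 i).
    by apply/funext => x; rewrite /= mulN1r.
  by apply: smoothM; [exact: smooth_cst|exact: smooth_coord].
Qed.

Lemma box_bump_ge0 k a b x : 0 <= box_bump k a b x.
Proof. by apply: prodr_ge0 => i _; rewrite mulr_ge0 ?sstep_ge0. Qed.

Lemma box_bump_le1 k a b x : box_bump k a b x <= 1.
Proof.
apply: prodr_ile1 => i _; rewrite mulr_ge0 ?sstep_ge0//=.
by rewrite mulr_ile1 ?sstep_ge0 ?sstep_le1.
Qed.

Lemma box_bump0 k a b x : 0 <= k -> ~ box a b x -> box_bump k a b x = 0.
Proof.
move=> k0 /existsNP[i] /negP; rewrite negb_and -!leNgt => h.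
apply/eqP/prodf_eq0; exists i => //; rewrite mulf_eq0; apply/orP.
by case/orP: h => h; [left|right]; apply/eqP/sstep0; rewrite mulr_ge0_le0// subr_le0.
Qed.

Lemma box_bump1 k a b x :
  (forall i, 1 <= k * (x ord0 i - a i)) -> (forall i, 1 <= k * (b i - x ord0 i)) ->
  box_bump k a b x = 1.
Proof. by move=> ha hb; apply: big1 => i _; rewrite !sstep1// mulr1. Qed.

Lemma box_norm_le a b : exists2 M : R, 0 <= M & forall x, box a b x -> `|x| <= M.
Proof.
exists (\sum_i (`|a i| + `|b i|)); first by rewrite sumr_ge0.
move=> x xab; apply/rV_norm_le => [|i]; first by rewrite sumr_ge0// => i _; rewrite addr_ge0.
rewrite (bigD1 i)//=; apply: (@le_trans _ _ (`|a i| + `|b i|)); last first.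
  by rewrite lerDl sumr_ge0// => j _; rewrite addr_ge0.
have /andP[ax xb] := xab i; rewrite ler_norml; apply/andP; split.
- apply: le_trans (ltW ax); rewrite opprD; apply: (@le_trans _ _ (- `|a i|)).
    by rewrite gerBl.
  by rewrite lerNl -normrN ler_norm.
- by apply: le_trans (ltW xb) _; rewrite (le_trans (ler_norm _))// lerDr.
Qed.

(** Compact support is the same as bounded support in finite dimension, and a bound is easier to
    follow through shears and products. *)
Lemma test_functionP phi : test_function phi <->
  smooth phi /\ exists2 M : R, 0 <= M & forall x, phi x != 0 -> `|x| <= M.
Proof.
split=> [[sphi cphi]|[sphi [M M0 phiM]]]; split => //.
  have [M [_ MP]] := compact_bounded cphi.
  exists (`|M| + 1) => [|x xphi]; first by rewrite addr_ge0.
  apply: MP; last exact: subset_closure.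
  by rewrite ltr_pwDr// ler_norm.
apply: bounded_closed_compact; last exact: closed_closure.
exists M; split; first exact: num_real.
move=> N MN x; pose B := closed_ball_ (fun z : 'rV[R]_n => `|z|) 0 M.
have : closure [set x | phi x != 0] `<=` B.
  have /closure_id -> : closed B by exact: closed_closed_ball_.
  apply: closure_subset => z /= /phiM; by rewrite /B /closed_ball_/= sub0r normrN.
by move=> /[apply]; rewrite /B /closed_ball_/= sub0r normrN => /le_trans; apply; exact: ltW.
Qed.

Lemma test_box_bump k a b : 0 <= k -> test_function (box_bump k a b).
Proof.
move=> k0; apply/test_functionP; split; first exact: smooth_box_bump.
have [M M0 MP] := box_norm_le a b; exists M => // x; apply: contraNle => xM.
apply/eqP; apply: box_bump0 => //; move=> /MP; apply/negP; by rewrite -ltNge.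
Qed.

Lemma test_bounded phi : test_function phi -> exists2 M, 0 <= M & forall x, `|phi x| <= M.
Proof.
move=> [sphi cphi].
have [M [_ MP]] : [bounded phi x | x in closure [set x | phi x != 0]].
  have := @compact_bounded _ _ (phi @` closure [set x | phi x != 0]).
  have /[swap]/[apply] : compact (phi @` closure [set x | phi x != 0]).
    apply: continuous_compact => //; apply: continuous_subspaceT => x.
    by apply: differentiable_continuous; exact: smooth_diff.
  by move=> [M [Mr MP]]; exists M; split => // N MN x xs; apply: MP N MN _ _; exists x.
exists (`|M| + 1) => [|x]; first by rewrite addr_ge0.
have [->|x0] := eqVneq (phi x) 0; first by rewrite normr0 addr_ge0.
by apply: MP; [rewrite ltr_pwDr// ler_norm|exact: subset_closure].
Qed.

(** Every point outside the closed support has a neighbourhood where [phi] is 0, so the derivative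
    vanishes there too. *)
Lemma test_partial phi i : test_function phi -> test_function (partial i phi).
Proof.
move=> [sphi /compact_bounded[M [Mr MP]]].
apply/test_functionP; split; first exact: smooth_partial.
exists (`|M| + 1) => [|x px]; first by rewrite addr_ge0.
apply: MP; first by rewrite ltr_pwDr// ler_norm.
apply: contrapT => xs.
have : \forall z \near x, 0 = phi z.
  have /closed_openC : closed (closure [set x | phi x != 0]) by exact: closed_closure.
  rewrite openE => /(_ x xs); apply: filterS => z zs.
  by apply/esym/eqP/negPn/negP => z0; apply: zs; exact: subset_closure.
move=> /near_eq_derive E; move: px; rewrite /partial -(E (delta_mx ord0 i)).
by rewrite derive_cst eqxx.
Qed.

Lemma smooth_continuous f : smooth f -> continuous f.
Proof. by move=> sf x; apply: differentiable_continuous; exact: smooth_diff. Qed.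

Lemma continuous_measurable_rV f : continuous f -> measurable_fun setT f.
Proof.
move=> cf; apply: (measurability _ (RGenOpens.measurableE R)).
move=> _ [_ [a [b ->]] <-]; rewrite setTI; apply: sub_sigma_algebra.
by apply: open_comp => [x _|]; [exact: cf|exact: interval_open].
Qed.

Lemma smooth_measurable f : smooth f -> measurable_fun setT f.
Proof. by move=> /smooth_continuous/continuous_measurable_rV. Qed.

Lemma testM f phi : smooth f -> test_function phi -> test_function (phi \* f).
Proof.
move=> sf /test_functionP[sphi [M M0 MP]]; apply/test_functionP; split.
  exact: smoothM.
by exists M => // x; rewrite mulf_eq0 negb_or => /andP[/MP].
Qed.

End test_functions.

Section determine.
Context {R : realType} {n : nat}.
Local Open Scope ereal_scope.

(** The bumps of a box converge pointwise to its indicator and are at most 1, an integrable function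
    for a finite measure; dominated convergence gives equality on boxes. *)
Lemma test_measure_unique (m1 m2 : {measure set 'rV[R]_n -> \bar R}) :
  m1 setT < +oo -> m2 setT < +oo ->
  (forall phi, test_function phi -> \int[m1]_x (phi x)%:E = \int[m2]_x (phi x)%:E) ->
  forall A, measurable A -> m1 A = m2 A.
Proof.
move=> m1oo m2oo m12; apply: measure_box_unique; last first.
  move=> a b; apply: le_lt_trans m1oo.
  by apply: le_measure; rewrite ?inE//; exact: measurable_box.
move=> a b.
pose f (k : nat) x := (box_bump k%:R a b x)%:E.
have cvgf x : f ^~ x @ \oo --> (\1_(box a b) x)%:E.
  rewrite /f indicE; case: (boolP (x \in box a b)) => [|/negP xab]; last first.
    apply: cvg_near_cst; apply: nearW => k; rewrite box_bump0//.
    by move=> ?; apply: xab; rewrite inE.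
  rewrite inE => xab.
  (* Once k exceeds the sum of the inverse distances from x to all faces, every factor of the bump
     at x equals 1. *)
  pose K := (\sum_i ((x ord0 i - a i)^-1 + (b i - x ord0 i)^-1))%R.
  have K0 i : (0 <= (x ord0 i - a i)^-1 + (b i - x ord0 i)^-1)%R.
    by have /andP[ax xb] := xab i; rewrite addr_ge0// invr_ge0 subr_ge0 ltW.
  apply: cvg_near_cst; near=> k.
  have Kk : (K <= k%:R)%R.
    near: k; exact: nbhs_infty_ger.
  have Ki i : ((x ord0 i - a i)^-1 + (b i - x ord0 i)^-1 <= K)%R.
    by rewrite /K (bigD1 i)//= lerDl sumr_ge0.
  rewrite box_bump1// => i; have /andP[ax xb] := xab i.
  - rewrite -ler_pdivrMr ?subr_gt0// mul1r; apply: le_trans Kk; apply: le_trans (Ki i).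
    by rewrite lerDl invr_ge0 subr_ge0 ltW.
  - rewrite -ler_pdivrMr ?subr_gt0// mul1r; apply: le_trans Kk; apply: le_trans (Ki i).
    by rewrite lerDr invr_ge0 subr_ge0 ltW.
have lim (m : {measure set 'rV[R]_n -> \bar R}) : m setT < +oo ->
    \int[m]_x f k x @[k --> \oo] --> m (box a b).
  move=> moo; have h1 k : measurable_fun setT (f k).
    apply/measurable_EFinP; exact: (smooth_measurable (smooth_box_bump k%:R a b)).
  have h2 : measurable_fun setT (fun x => (\1_(box a b) x)%:E : \bar R).
    by apply/measurable_EFinP; apply: measurable_indic; exact: measurable_box.
  have h3 : {ae m, forall x, setT x -> f ^~ x @ \oo --> (\1_(box a b) x)%:E}.
    by apply: aeW => x _; exact: cvgf.
  have h4 : m.-integrable setT (EFin \o cst 1%R).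
    apply: measurable_bounded_integrable => //.
    by exists 1%R; split; [exact: num_real|move=> x /ltW x1 y _; rewrite /= normr1].
  have h5 : {ae m, forall x k, setT x -> `|f k x| <= cst 1 x}.
    apply: aeW => x k _; rewrite /f lee_fin ger0_norm ?box_bump_ge0//.
    exact: box_bump_le1.
  have [_ _] := dominated_convergence measurableT h1 h2 h3 h4 h5.
  by rewrite integral_indic ?setIT//; exact: measurable_box.
have := lim _ m1oo; have := lim _ m2oo.
have -> : (fun k => \int[m1]_x f k x) = (fun k => \int[m2]_x f k x).
  by apply/funext => k; apply: m12; exact: test_box_bump.
by move=> l2 l1; exact: cvg_unique l1 l2.
Unshelve. all: by end_near. Qed.

End determine.

(** * Densities *)

Section density.
Context d (T : measurableType d) {R : realType}.
Variables (mu : {measure set T -> \bar R}) (h : T -> R).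
Hypotheses (mh : measurable_fun setT h) (h0 : forall x, 0 <= h x).
Local Open Scope ereal_scope.

Definition density (A : set T) : \bar R := \int[mu]_(x in A) (h x)%:E.

Let meh : measurable_fun setT (EFin \o h). Proof. exact/measurable_EFinP. Qed.
Let h0E x : 0 <= (EFin \o h) x. Proof. by rewrite lee_fin. Qed.
Let density0 : density set0 = 0. Proof. exact: integral_set0. Qed.
Let density_ge0 A : 0 <= density A. Proof. by apply: integral_ge0 => x _; exact: h0E. Qed.
Let density_sigma_additive : semi_sigma_additive density.
Proof. exact: semi_sigma_additive_nng_induced. Qed.

HB.instance Definition _ := isMeasure.Build _ _ _ density
  density0 density_ge0 density_sigma_additive.

Import HBNNSimple.

(** Simple functions and monotone convergence on both sides reduce the formula to indicators, where
    it is the definition of [density]. *)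
Lemma ge0_integral_density (f : T -> \bar R) : measurable_fun setT f ->
  (forall x, 0 <= f x) ->
  \int[density]_x f x = \int[mu]_x (f x * (h x)%:E).
Proof.
move=> mf f0; pose g := nnsfun_approx measurableT mf.
have gf x : (EFin \o g n) x @[n --> \oo] --> f x.
  by apply: cvg_nnsfun_approx => // y _.
have mono x : {homo (fun n => (g n x)%:E) : m n / (m <= n)%N >-> m <= n}.
  by move=> m n mn; rewrite lee_fin; exact/lefP/nd_nnsfun_approx.
have -> : \int[density]_x f x = lim (\int[density]_x (g n x)%:E @[n --> \oo]).
  rewrite -monotone_convergence//; last 2 first.
  - by move=> n; exact/measurable_EFinP/measurable_funP.
  - by move=> n x _; rewrite lee_fin.
  by apply: eq_integral => x _; apply/esym/cvg_lim => //; exact: gf.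
have -> : \int[mu]_x (f x * (h x)%:E) =
    lim (\int[mu]_x ((g n x)%:E * (h x)%:E) @[n --> \oo]).
  rewrite -monotone_convergence//; last 3 first.
  - by move=> n; apply: emeasurable_funM => //; exact/measurable_EFinP/measurable_funP.
  - by move=> n x _; rewrite mule_ge0 ?lee_fin.
  - by move=> x _ m n mn; rewrite lee_wpmul2r ?lee_fin//; exact: mono.
  apply: eq_integral => x _; apply/esym/cvg_lim => //.
  by apply: cvgeZr; [|exact: gf].
suff -> : (fun n => \int[density]_x (g n x)%:E) =
    (fun n => \int[mu]_x ((g n x)%:E * (h x)%:E)) by [].
apply/funext => n.
transitivity (\int[density]_x
   (\sum_(y \in range (g n)) (y * \1_(g n @^-1` [set y]) x)%:E)).
  by apply: eq_integral => x _; rewrite /= fimfunE -fsumEFin.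
rewrite ge0_integral_fsum//; last 2 first.
- by move=> y; exact/measurable_EFinP/measurable_funM.
- by move=> y x _; exact: nnfun_muleindic_ge0.
transitivity (\int[mu]_x (\sum_(y \in range (g n))
    (y * \1_(g n @^-1` [set y]) x)%:E * (h x)%:E)); last first.
  apply: eq_integral => x _; rewrite -ge0_mule_fsuml => [|y].
    by rewrite fsumEFin // -(fimfunE _ x).
  exact: nnfun_muleindic_ge0.
rewrite ge0_integral_fsum//; last 2 first.
- move=> y; apply: emeasurable_funM => //.
  by apply/measurable_EFinP; exact: measurable_funM.
- by move=> y x _; rewrite mule_ge0 ?lee_fin//; exact: nnfun_muleindic_ge0.
apply: eq_fsbigr => r rg; rewrite integralZl_indic_nnsfun//.
under [RHS]eq_integral do rewrite EFinM -muleA.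
rewrite ge0_integralZl//; last 3 first.
- by apply: emeasurable_funM => //; exact/measurable_EFinP.
- by move=> x _; rewrite mule_ge0 ?lee_fin.
- by move: rg; rewrite inE => -[x _ <-]; rewrite lee_fin.
congr (_ * _); rewrite integral_indic// setIT /density [LHS]integral_mkcond.
by apply: eq_integral => x _; rewrite epatch_indic/= muleC.
Qed.

End density.

Section finite_density.
Context d d' (T : measurableType d) (T' : measurableType d') {R : realType}.
Variables (mu : {measure set T -> \bar R}) (h : T -> R) (S : T -> T').
Hypotheses (ih : mu.-integrable setT (EFin \o h)) (h0 : forall x, 0 <= h x).
Hypothesis mS : measurable_fun setT S.
Local Open Scope ereal_scope.

Let mh : measurable_fun setT h.
Proof. exact/measurable_EFinP/(measurable_int mu). Qed.

(** Taken with the positive and the negative part of a density, it supplies the two finite measures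
    whose difference is the image of a signed measure. *)
Definition density_image : set T' -> \bar R := pushforward (density mu h) S.

Let density_image0 : density_image set0 = 0.
Proof. exact: measure0. Qed.

Let density_image_ge0 A : 0 <= density_image A.
Proof. exact: measure_ge0. Qed.

Let density_image_sigma_additive : semi_sigma_additive density_image.
Proof. exact: measure_semi_sigma_additive. Qed.

HB.instance Definition _ := isMeasure.Build _ _ _ density_image
  density_image0 density_image_ge0 density_image_sigma_additive.

Let density_image_fin : fin_num_fun density_image.
Proof.
move=> A mA; rewrite /density_image /pushforward /density.
apply: integrable_fin_num.
  by rewrite -[X in measurable X]setTI; exact: mS.
by apply: integrableS ih => //; rewrite -[X in measurable X]setTI; exact: mS.
Qed.

HB.instance Definition _ := Measure_isFinite.Build _ _ _ density_image
  density_image_fin.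

Lemma density_imageE A : density_image A = \int[mu]_(x in S @^-1` A) (h x)%:E.
Proof. by []. Qed.

Lemma ge0_integral_density_image (f : T' -> \bar R) : measurable_fun setT f ->
  (forall x, 0 <= f x) ->
  \int[density_image]_x f x = \int[mu]_x (f (S x) * (h x)%:E).
Proof.
move=> mf f0; rewrite ge0_integral_pushforward//.
rewrite preimage_setT ge0_integral_density//; first exact: measurableT_comp.
by move=> x; exact: f0.
Qed.

Lemma integral_density_image (f : T' -> R) (M : R) : measurable_fun setT f ->
  (forall x, `|f x| <= M)%R ->
  \int[density_image]_x (f x)%:E = \int[mu]_x (f (S x) * h x)%:E.
Proof.
move=> mf fM.
have mSf : measurable_fun setT (f \o S) by exact: measurableT_comp.
have intf (g : T -> R) : measurable_fun setT g -> (forall x, `|g x| <= M)%R ->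
    mu.-integrable setT (EFin \o (fun x => g x * h x)%R).
  move=> mg gM; apply: (le_integrable measurableT _ _ (integrableZl measurableT M ih)).
    by apply/measurable_EFinP; exact: measurable_funM.
  move=> x _; rewrite /= lee_fin normrM [leRHS]normrM.
  rewrite ler_wpM2r//; apply: le_trans (gM x) _; exact: ler_norm.
pose p x : R := Num.max (f x) 0%R; pose q x : R := Num.max (- f x)%R 0%R.
have fpq x : (f x = p x - q x)%R.
  by rewrite /p /q /Num.max; case: ifPn; case: ifPn => //; lra.
have mp : measurable_fun setT p by apply: measurable_maxr => //; exact: measurable_cst.
have mq : measurable_fun setT q.
  by apply: measurable_maxr => //; exact: measurableT_comp.
have p0 x : (0 <= p x)%R by rewrite /p le_max lexx orbT.
have q0 x : (0 <= q x)%R by rewrite /q le_max lexx orbT.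
have pM x : (`|p x| <= M)%R.
  by rewrite ger0_norm// ge_max (le_trans (ler_norm _) (fM x)) (le_trans _ (fM x)).
have qM x : (`|q x| <= M)%R.
  rewrite ger0_norm// ge_max (le_trans (normr_ge0 _) (fM x)) andbT.
  by apply: le_trans (fM x); rewrite -normrN; exact: ler_norm.
have -> : (fun x => (f x)%:E) = (fun x => (p x)%:E - (q x)%:E).
  by apply/funext => x; rewrite fpq EFinB.
have -> : (fun x => (f (S x) * h x)%:E) =
    (fun x => (p (S x) * h x)%:E - (q (S x) * h x)%:E).
  by apply/funext => x; rewrite fpq mulrBl EFinB.
rewrite integralB//; [|exact: integrable_bounded mp pM|exact: integrable_bounded mq qM].
rewrite integralB//; last 2 first.
- by apply: (intf (p \o S)) => [|x]; [exact: measurableT_comp|exact: pM].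
- by apply: (intf (q \o S)) => [|x]; [exact: measurableT_comp|exact: qM].
congr (_ - _); rewrite (@ge0_integral_density_image (fun x => (_ x)%:E))//;
  by [exact/measurable_EFinP|move=> x; rewrite lee_fin].
Qed.

End finite_density.

(** * Change of variables for shears *)

Section insertion.
Context {R : realType} {m : nat}.
Implicit Types (k : 'I_m.+1) (s : R) (v : 'rV[R]_m).

Definition ins k s v : 'rV[R]_m.+1 :=
  \row_j if unlift k j is Some i then v ord0 i else s.

Lemma insE k s v : ins k s v ord0 k = s.
Proof. by rewrite mxE unlift_none. Qed.

Lemma ins_lift k s v j : ins k s v ord0 (lift k j) = v ord0 j.
Proof. by rewrite mxE liftK. Qed.

Lemma insP k (x : 'rV[R]_m.+1) : x = ins k (x ord0 k) (\row_j x ord0 (lift k j)).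
Proof.
apply/rowP => j; rewrite mxE; case: unliftP => [i ->|->//].
by rewrite mxE.
Qed.

Lemma cons_rVE (p : measurableTypeR R * 'rV[R]_m) : cons_rV p = ins ord0 p.1 p.2.
Proof.
apply/rowP => j; rewrite !mxE; case: splitP => i ji.
  have -> : j = ord0 by apply/val_inj => /=; rewrite ji (ord1 i).
  by rewrite unlift_none (ord1 i) mxE eqxx.
have -> : j = lift ord0 i by apply/val_inj => /=; rewrite ji.
by rewrite liftK.
Qed.

Lemma ins_line k s v : ins k s v = ins k 0 v + s *: delta_mx ord0 k.
Proof.
apply/rowP => j; rewrite !mxE eqxx/=; case: unliftP => [i ->|->].
  by rewrite eq_sym (negbTE (neq_lift _ _)) mulr0 addr0.
by rewrite eqxx mulr1 add0r.
Qed.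

Lemma continuous_ins k v : continuous (fun s => ins k s v).
Proof.
move=> s; under eq_fun do rewrite ins_line.
apply: (@continuousD _ _ _ (cst (ins k 0 v)) (fun r : R => r *: delta_mx ord0 k)).
  exact: cst_continuous.
exact: scalel_continuous.
Qed.

Definition insp k (p : measurableTypeR R * 'rV[R]_m) := ins k p.1 p.2.

Lemma measurable_insp k : measurable_fun setT (insp k).
Proof.
apply: measurable_fun_rV => i; rewrite /insp.
case: (unliftP k i) => [j ->|->].
- under eq_fun do rewrite ins_lift.
  apply: (@measurableT_comp _ _ _ _ _ _ (fun v : 'rV[R]_m => v ord0 j : R)).
    exact: measurable_rV_coord.
  exact: measurable_snd.
- by under eq_fun do rewrite insE; exact: measurable_fst.
Qed.

Lemma insp_box k (a b : 'I_m.+1 -> R) : insp k @^-1` box a b =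
  (`]a k, b k[%classic : set (measurableTypeR R)) `*` box (a \o lift k) (b \o lift k).
Proof.
apply/seteqP; split => -[s v] /=.
  move=> h; split => [|j]; first by have := h k; rewrite insE /= in_itv.
  by have := h (lift k j); rewrite ins_lift.
rewrite in_itv/= => -[h1 h2] i; rewrite /insp/=.
by case: (unliftP k i) => [j ->|->]; [rewrite ins_lift; exact: h2|rewrite insE].
Qed.

End insertion.

(** * Lebesgue measure and Tonelli along any coordinate *)

Section lebesgue_box.
Context {R : realType}.
Local Open Scope ereal_scope.

Lemma lebesgue_rV_box n (a b : 'I_n -> R) : lebesgue_rV n (box a b) =
  \prod_(i < n) lebesgue_measure (`]a i, b i[%classic : set R).
Proof.
elim: n a b => [|n ih] a b.
  rewrite big_ord0 /= diracE mem_set//.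
  by case.
rewrite big_ord_recl [LHS]/= /lebesgue_rV_step /pushforward.
have -> : cons_rV = insp ord0 :> (_ -> 'rV[R]_n.+1).
  by apply/funext => p; exact: cons_rVE.
rewrite insp_box product_measure1E//; last exact: measurable_box.
by rewrite ih.
Qed.

Lemma lebesgue_rV_box_lty n (a b : 'I_n -> R) : lebesgue_rV n (box a b) < +oo.
Proof.
rewrite lebesgue_rV_box ltey_eq; apply/orP; left.
elim/big_ind : _ => [//|x y|i _]; first exact: fin_numM.
by rewrite lebesgue_measure_itv/=; case: ifPn.
Qed.

(** [lebesgue_rV] is built by splitting off the first coordinate, but its value on boxes is a
    product symmetric in the coordinates, so any coordinate k may be split off instead. *)
Lemma lebesgue_rV_ins m (k : 'I_m.+1) (A : set 'rV[R]_m.+1) : measurable A ->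
  lebesgue_rV m.+1 A = (lebesgue_measure \x lebesgue_rV m) (insp k @^-1` A).
Proof.
have mi := @measurable_insp R m k.
move=> mA; rewrite (@measure_box_unique R m.+1 (lebesgue_rV m.+1)
  (pushforward (lebesgue_measure \x lebesgue_rV m) (insp k)))//.
  move=> a b.
  transitivity ((lebesgue_measure \x lebesgue_rV m) (insp k @^-1` box a b)); last by [].
  rewrite insp_box product_measure1E//; last exact: measurable_box.
  have E := lebesgue_rV_box a b; rewrite (bigD1_ord k)//= in E.
  apply: (etrans E); congr (_ * _); symmetry; exact: (lebesgue_rV_box (a \o lift k)).
exact: lebesgue_rV_box_lty.
Qed.

Lemma ge0_integral_rV_ins m (k : 'I_m.+1) (f : 'rV[R]_m.+1 -> \bar R) :
  measurable_fun setT f -> (forall x, 0 <= f x) ->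
  \int[lebesgue_rV m.+1]_x f x =
  \int[lebesgue_rV m]_v \int[lebesgue_measure]_s f (ins k s v).
Proof.
move=> mf f0; have mi := @measurable_insp R m k.
transitivity (\int[pushforward (lebesgue_measure \x lebesgue_rV m) (insp k)]_x f x).
  by apply: eq_measure_integral => ? A mA; exact: lebesgue_rV_ins.
rewrite ge0_integral_pushforward// preimage_setT.
rewrite (fubini_tonelli2 (f \o insp k))//; last by move=> x; exact: f0.
exact: measurableT_comp.
Qed.

End lebesgue_box.

Section change_of_variables.
Context {R : realType}.
Variables (tau dtau : R -> R) (M : R).
Hypotheses (tauD : forall s : R, is_derive s 1 tau (dtau s))
           (dtau_cont : continuous dtau)
           (dtau_gt0 : forall s, 0 < dtau s)
           (tau_near : forall s, `|tau s - s| <= M).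

Let tau_cont : continuous tau.
Proof.
move=> s; apply: differentiable_continuous.
by apply/derivable1_diffP; have [] := tauD s.
Qed.

Lemma change_increasing : {mono tau : x y / x <= y}.
Proof.
apply: le_mono => x y xy.
have [|c _] := @MVT R tau dtau x y xy (fun r _ => tauD r).
  exact: continuous_subspaceT.
by move/eqP; rewrite subr_eq => /eqP ->; rewrite ltrDr mulr_gt0// subr_gt0.
Qed.

(** Bounded displacement forces tau (y - M) <= y <= tau (y + M); the intermediate value theorem does
    the rest. *)
Lemma change_surjective y : exists s, tau s = y.
Proof.
have M0 : 0 <= M by apply: le_trans (tau_near 0); exact: normr_ge0.
have [|||c _ <-] := @IVT R tau (y - M) (y + M) y; last by exists c.
- by rewrite lerD2l; lra.
- exact: continuous_subspaceT.
- have := tau_near (y - M); have := tau_near (y + M).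
  rewrite !ler_norml => /andP[h1 h2] /andP[h3 h4].
  by rewrite ge_min le_max; apply/andP; split; apply/orP; [left|right]; lra.
Qed.

Local Open Scope ereal_scope.
Let dtau_ge0 s : (0 <= dtau s)%R. Proof. exact: ltW. Qed.
Let mdtau : measurable_fun setT (dtau : measurableTypeR R -> R).
Proof. exact: continuous_measurable_fun. Qed.
Let mtau : measurable_fun setT (tau : measurableTypeR R -> measurableTypeR R).
Proof. exact: continuous_measurable_fun. Qed.

(** The image under [tau] of [dtau] times Lebesgue measure gives mass b - a to ]a, b], by the
    fundamental theorem of calculus on the preimage interval. Hence it is Lebesgue measure. *)
Lemma ge0_integral_change (g : R -> \bar R) :
  measurable_fun setT (g : measurableTypeR R -> \bar R) -> (forall s, 0 <= g s) ->
  \int[lebesgue_measure]_s (g (tau s) * (dtau s)%:E) =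
  \int[lebesgue_measure]_s g s.
Proof.
move=> mg g0.
rewrite -(@ge0_integral_density _ _ _ lebesgue_measure dtau mdtau dtau_ge0 (g \o tau));
  [|exact: measurableT_comp|by move=> s; exact: g0].
pose nu := density lebesgue_measure dtau.
transitivity (\int[pushforward nu (tau : measurableTypeR R -> measurableTypeR R)]_s g s).
  rewrite ge0_integral_pushforward ?preimage_setT//.
apply/esym; apply: (@eq_measure_integral _ (measurableTypeR R)) => A mA _; apply: lebesgue_measure_unique => //.
move=> _ [[a b] _ <-].
have [ba|ab] := leP b a.
  rewrite (_ : [set` _] = set0) ?measure0//.
  by apply/seteqP; split => // z; rewrite /= in_itv/= => /andP[az zb]; lra.
have [a' a'E] := change_surjective a; have [b' b'E] := change_surjective b.
have ab' : (a' < b')%R by rewrite -(leW_mono change_increasing) a'E b'E.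
have pE : tau @^-1` `]a, b]%classic = `]a', b']%classic.
  apply/seteqP; split => z; rewrite /= !in_itv/= -a'E -b'E;
    by rewrite (leW_mono change_increasing) change_increasing.
transitivity (nu (tau @^-1` `]a, b]%classic)); last by [].
rewrite pE /nu /density integral_itv_obnd_cbnd; last first.
  by apply/measurable_EFinP; exact: measurable_funS mdtau.
rewrite (@continuous_FTC2 R dtau tau)//.
- by rewrite lebesgue_measure_itv/= lte_fin ab -a'E -b'E.
- exact: continuous_subspaceT.
- split => [z _||]; first by have [] := tauD z.
  + apply: cvg_at_right_filter; exact: tau_cont.
  + apply: cvg_at_left_filter; exact: tau_cont.
- by move=> z _; rewrite derive1E; have [_ ->] := tauD z.
Qed.

End change_of_variables.

(** * Shears: inverse, Jacobian, substitution *)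

Section shear_change_of_variables.
Context {R : realType} {m : nat}.
Variables (k : 'I_m.+1) (b : 'rV[R]_m.+1 -> R) (M : R).
Hypotheses (sb : smooth b) (bM : forall x, `|b x| <= M)
           (jac_gt0 : forall x, 0 < 1 + partial k b x).
Implicit Types (x y : 'rV[R]_m.+1) (v : 'rV[R]_m) (s : R).

Let T := shear 1 b k.

(** The action of the shear on the line of direction e_k given by v: an increasing map of one
    variable. *)
Let tau v s := s + b (ins k s v).
Let dtau v s := 1 + partial k b (ins k s v).

Let shear_ins v s : T (ins k s v) = ins k (tau v s) v.
Proof.
apply/rowP => j; rewrite /T /shear /tau !mxE eqxx/= mul1r.
case: unliftP => [i ->|->].
  by rewrite eq_sym (negbTE (neq_lift _ _)) mulr0 addr0.
by rewrite eqxx mulr1.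
Qed.

Let tauD v s : is_derive s 1 (tau v) (dtau v s).
Proof.
have h := @is_derive_line _ _ b (delta_mx ord0 k) (ins k 0 v) s (smooth_diff _ sb).
have -> : tau v = (id : R -> R) + (fun r => b (ins k 0 v + r *: delta_mx ord0 k)).
  by apply/funext => r; rewrite /tau [ins k r v]ins_line.
by rewrite /dtau [ins k s v]ins_line; exact: is_deriveD.
Qed.

Let dtau_cont v : continuous (dtau v).
Proof.
move=> s; rewrite /continuous_at /dtau; apply: cvgD; first exact: cvg_cst.
apply: (@continuous_comp _ _ _ (fun r => ins k r v) (partial k b)).
  exact: continuous_ins.
exact/smooth_continuous/smooth_partial.
Qed.

Let tau_near v s : `|tau v s - s| <= M.
Proof. by rewrite /tau addrAC subrr add0r. Qed.

Let mb : measurable_fun setT b. Proof. exact: smooth_measurable. Qed.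

Lemma measurable_shear : measurable_fun setT T.
Proof.
apply: measurable_fun_rV => i; rewrite /T /shear.
under eq_fun do rewrite !mxE mul1r.
apply: measurable_funD; first exact: measurable_rV_coord.
by apply: measurable_funM => //; exact: measurable_cst.
Qed.

Definition jac x := 1 + partial k b x.

Lemma measurable_jac : measurable_fun setT jac.
Proof.
apply: measurable_funD; first exact: measurable_cst.
exact: (smooth_measurable (smooth_partial k sb)).
Qed.

(** On each line of direction e_k the shear is an increasing bijection. The inverse is picked
    pointwise by choice, so its measurability has to be recovered from monotonicity. *)
Lemma shear_inverse : exists2 S, measurable_fun setT S & cancel T S /\ cancel S T.
Proof.
pose w y := \row_j y ord0 (lift k j) : 'rV[R]_m.
have sol y : exists s, tau (w y) s = y ord0 k.
  exact: (change_surjective (tauD _) (tau_near _)).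
have [sy syE] := boolp.choice sol.
have mono v : {mono tau v : x y / x <= y}.
  exact: (change_increasing (tauD v) (fun s => jac_gt0 _)).
pose S y := ins k (sy y) (w y).
have TS : cancel S T.
  by move=> y; rewrite /S shear_ins syE [RHS](insP k).
exists S; last first.
  split => // x; rewrite [in RHS](insP k x) [in LHS](insP k x).
  set v := \row_j _; set s := x ord0 k.
  have wE : w (T (ins k s v)) = v.
    by apply/rowP => j; rewrite shear_ins mxE ins_lift.
  rewrite /S wE; congr (ins k _ v).
  apply: (inc_inj (mono v)); have := syE (T (ins k s v)).
  by rewrite wE => ->; rewrite shear_ins insE.
apply: measurable_fun_rV => i; case: (unliftP k i) => [j ->|->].
  rewrite /S; under eq_fun do rewrite ins_lift mxE; exact: measurable_rV_coord.
rewrite /S; under eq_fun do rewrite insE.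
apply: (measurability _ (RGenCInfty.measurableE R)).
move=> _ [_ [c ->] <-]; rewrite setTI.
(* By monotonicity on the line, the solution is at least c exactly when y_k is at least the image of
   c, and this second condition is explicit in y. *)
have -> : sy @^-1` `[c, +oo[%classic =
    (fun y => y ord0 k - tau (w y) c) @^-1` `[0, +oo[%classic.
  apply/seteqP; split => y; rewrite /= !in_itv/= !andbT subr_ge0;
  by rewrite -syE mono.
rewrite -[X in measurable X]setTI.
have mw : measurable_fun setT w.
  apply: measurable_fun_rV => j; rewrite /w; under eq_fun do rewrite mxE.
  exact: measurable_rV_coord.
suff : measurable_fun setT (fun y => y ord0 k - tau (w y) c).
  by apply => //; exact: measurable_itv.
apply: measurable_funB; first exact: measurable_rV_coord.
apply: measurable_funD => //; apply: measurableT_comp => //.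
apply: measurable_fun_rV => j; case: (unliftP k j) => [j' ->|->].
  by under eq_fun do rewrite ins_lift mxE; exact: measurable_rV_coord.
by under eq_fun do rewrite insE; exact: measurable_cst.
Qed.

Local Open Scope ereal_scope.

(** Tonelli in the direction e_k, then the one-dimensional substitution on each line. *)
Lemma ge0_integral_shear (f : 'rV[R]_m.+1 -> \bar R) :
  measurable_fun setT f -> (forall x, 0 <= f x) ->
  \int[lebesgue_rV m.+1]_x (f (T x) * (jac x)%:E) = \int[lebesgue_rV m.+1]_x f x.
Proof.
move=> mf f0.
have mT := measurable_shear.
have mJ := measurable_jac.
rewrite (ge0_integral_rV_ins k)//; last 2 first.
- apply: emeasurable_funM; last exact/measurable_EFinP.
  exact: measurableT_comp.
- by move=> x; rewrite mule_ge0// lee_fin ltW// jac_gt0.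
rewrite [RHS](ge0_integral_rV_ins k)//; apply: eq_integral => v _.
under eq_integral do rewrite shear_ins.
apply: (ge0_integral_change (tauD v) (@dtau_cont v) (fun s => jac_gt0 _) (tau_near v) (g := fun s => f (ins k s v)))=> //.
have : measurable_fun setT (f \o insp k).
  by apply: measurableT_comp => //; exact: measurable_insp.
move=> mfi; exact: (measurableT_comp mfi (@pair2_measurable _ _ _ _ v)).
Qed.

Variable S : 'rV[R]_m.+1 -> 'rV[R]_m.+1.
Hypotheses (mS : measurable_fun setT S) (TS : cancel T S) (ST : cancel S T).

Lemma ge0_integral_shear_set (E : set 'rV[R]_m.+1) (f : 'rV[R]_m.+1 -> \bar R) :
  measurable E -> measurable_fun setT f -> (forall x, 0 <= f x) ->
  \int[lebesgue_rV m.+1]_(y in S @^-1` E) f y =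
  \int[lebesgue_rV m.+1]_(x in E) (f (T x) * (jac x)%:E).
Proof.
move=> mE mf f0.
have mSE : measurable (S @^-1` E) by rewrite -[X in measurable X]setTI; exact: mS.
rewrite integral_mkcond -ge0_integral_shear; last 2 first.
- exact/(measurable_restrictT _ _).1/measurable_funTS.
- by move=> x; rewrite erestrict_ge0.
rewrite [RHS]integral_mkcond; apply: eq_integral => x _; rewrite !patchE.
have -> : (T x \in S @^-1` E) = (x \in E).
  by apply/idP/idP; rewrite !inE /= TS.
by case: ifP => // _; rewrite mul0e.
Qed.

Lemma integral_shear_set (E : set 'rV[R]_m.+1) (f : 'rV[R]_m.+1 -> R) :
  measurable E -> measurable_fun setT f ->
  \int[lebesgue_rV m.+1]_(y in S @^-1` E) (f y)%:E =
  \int[lebesgue_rV m.+1]_(x in E) (f (T x) * jac x)%:E.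
Proof.
move=> mE mf; rewrite integralE [RHS]integralE.
have mef : measurable_fun setT (EFin \o f) by exact/measurable_EFinP.
have jac_ge0 x : 0 <= (jac x)%:E by rewrite lee_fin ltW// jac_gt0.
congr (_ - _).
- rewrite (ge0_integral_shear_set mE (measurable_funepos mef))//.
  by apply: eq_integral => x _; rewrite !funeposE EFinM maxe_pMl// mul0e.
- rewrite (ge0_integral_shear_set mE (measurable_funeneg mef))//.
  by apply: eq_integral => x _; rewrite !funenegE EFinM -mulNe maxe_pMl// mul0e.
Qed.

End shear_change_of_variables.

(** * Deformation by shears *)

Section dilation_field.
Context {R : realType} {n : nat}.
Implicit Types (k i j : 'I_n) (x z : 'rV[R]_n) (r : R).

(** Equal to 1 on the sup-norm ball of radius 3 and to 0 beyond radius 4. The plateau exceeds the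
    unit ball because the shears may double the coordinates of a point. *)
Definition cutoff x : R := box_bump 1 (fun=> -4) (fun=> 4) x.

Definition field k x : R := x ord0 k * cutoff x.

(** Scaling values by r and arguments by 1/r leaves the bounds on first derivatives independent of
    r, while the field equals x_k on |x| <= 3r and vanishes for |x| >= 4r. *)
Definition scaled_field r k x : R := r * field k (r^-1 *: x).

Lemma test_field k : test_function (field k).
Proof.
have -> : field k = cutoff \* (fun x => x ord0 k).
  by apply/funext => x; rewrite /field mulrC.
by apply: testM; [exact: smooth_coord|exact: test_box_bump].
Qed.

Lemma scale_shear r k x : r *: x = shear r (cst 0) k x.
Proof. by rewrite /shear scale0r addr0. Qed.

Lemma smooth_scaled_field r k : smooth (scaled_field r k).
Proof.
apply: (@smoothM _ _ (cst r) (fun x => field k (r^-1 *: x))); first exact: smooth_cst.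
have -> : (fun x => field k (r^-1 *: x)) = field k \o shear r^-1 (cst 0) k.
  by apply/funext => x; rewrite /= -scale_shear.
by apply: smooth_shear; [have [] := test_field k|exact: smooth_cst].
Qed.

Lemma partial_scaled_field r k i x : r != 0 ->
  partial i (scaled_field r k) x = partial i (field k) (r^-1 *: x).
Proof.
move=> r0; have sf : smooth (field k) by have [] := test_field k.
have E : (fun x => field k (r^-1 *: x)) = field k \o shear r^-1 (cst 0) k.
  by apply/funext => y; rewrite /= -scale_shear.
have sE : smooth (fun x => field k (r^-1 *: x)).
  by rewrite E; exact: (smooth_shear _ _ sf (smooth_cst 0)).
pose G := fun x => field k (r^-1 *: x).
have dG y : differentiable G y by exact: smooth_diff sE.
have e1 : partial i (scaled_field r k) x = r * partial i G x + G x * partial i (cst r) x.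
  have dr y : differentiable (cst r : 'rV[R]_n -> R) y by exact: differentiable_cst.
  exact: (congr1 (fun h => h x) (partialM i dr dG)).
have e2 : partial i G x = r^-1 * partial i (field k) (r^-1 *: x).
  have d0 : differentiable (cst 0 : 'rV[R]_n -> R) x by exact: differentiable_cst.
  have := partial_shear i d0 (smooth_diff (shear r^-1 (cst 0) k x) sf).
  by rewrite -E -scale_shear partial_cst mul0r addr0.
have e3 : partial i (cst r) x = 0 by rewrite partial_cst.
have aux (p q c d e : R) : p = r * q + c * d -> q = r^-1 * e -> d = 0 -> p = e.
  by move=> -> -> ->; rewrite mulr0 addr0 mulrA (divff r0) mul1r.
exact: aux e1 e2 e3.
Qed.

Lemma field_bounds : exists2 C : R, 0 < C &
  forall k x, `|field k x| <= C /\ forall i, `|partial i (field k) x| <= C.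
Proof.
have /boolp.choice[B hB] k : exists B : R, 0 <= B /\ forall x, `|field k x| <= B.
  by have [B B0 h] := test_bounded (test_field k); exists B.
have /boolp.choice[D hD] (ki : 'I_n * 'I_n) : exists D : R,
    0 <= D /\ forall x, `|partial ki.2 (field ki.1) x| <= D.
  by have [D D0 h] := test_bounded (test_partial ki.2 (test_field ki.1)); exists D.
have B0 : 0 <= \sum_k B k by apply: sumr_ge0 => k _; case: (hB k).
have D0 : 0 <= \sum_ki D ki by apply: sumr_ge0 => k _; case: (hD k).
exists (\sum_k B k + \sum_ki D ki + 1); first by rewrite ltr_wpDl// addr_ge0.
move=> k x; split => [|i].
- apply: le_trans ((hB k).2 x) _; rewrite -addrA (bigD1 k)//= -addrA lerDl.
  rewrite !addr_ge0//; apply: sumr_ge0 => j _; by case: (hB j).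
- apply: le_trans ((hD (k, i)).2 x) _; rewrite -addrA addrCA (bigD1 (k, i))//= -addrA lerDl.
  rewrite !addr_ge0//; apply: sumr_ge0 => j _; by case: (hD j).
Qed.

Lemma cutoff1 x : `|x| <= 3 -> cutoff x = 1.
Proof.
move=> x3; have h i : -3 <= x ord0 i <= 3.
  by rewrite -ler_norml; apply: le_trans x3; exact: rV_coord_le.
by apply: box_bump1 => i; have /andP[? ?] := h i; rewrite mul1r; lra.
Qed.

Lemma cutoff0 x : 4 <= `|x| -> cutoff x = 0.
Proof.
move=> x4; apply: box_bump0 => // h; move: x4; apply/negP; rewrite -ltNge.
apply: le_lt_trans (_ : `|x| <= \big[Num.max/0]_i `|x ord0 i|) _.
  apply/rV_norm_le => [|i]; first by apply: bigmax_ge_id.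
  exact: le_bigmax.
apply/bigmax_ltP; split => // i _; rewrite ltr_norml; have /andP[-> ->//] := h i.
Qed.

Lemma norm_scale_le r x (c : R) : 0 < r -> (`|r^-1 *: x| <= c) = (`|x| <= r * c).
Proof. by move=> r0; rewrite normrZ gtr0_norm ?invr_gt0// ler_pdivrMl. Qed.

Lemma scaled_field_small r k x : 0 < r -> `|x| <= r * 3 -> scaled_field r k x = x ord0 k.
Proof.
move=> r0 xr; rewrite /scaled_field /field cutoff1 ?norm_scale_le// mulr1 mxE mulrA.
by rewrite divff ?mul1r// gt_eqF.
Qed.

Lemma scaled_field_large r k x : 0 < r -> r * 4 <= `|x| -> scaled_field r k x = 0.
Proof.
move=> r0 xr; rewrite /scaled_field /field cutoff0 ?mulr0//.
by rewrite normrZ gtr0_norm ?invr_gt0// ler_pdivlMl.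
Qed.

Lemma test_scaled_field r k : 0 < r -> test_function (scaled_field r k).
Proof.
move=> r0; apply/test_functionP; split; first exact: smooth_scaled_field.
exists (r * 4) => [|x]; first by rewrite mulr_ge0// ltW.
by apply: contraNle => /ltW h; apply/eqP; exact: scaled_field_large.
Qed.

Lemma partial_scaled_field_small r k i x : 0 < r -> `|x| < r * 3 ->
  partial i (scaled_field r k) x = (i == k)%:R.
Proof.
move=> r0 xr; rewrite -[RHS]/((cst (i == k)%:R : 'rV[R]_n -> R) x) -partial_coord.
apply: near_eq_derive; near=> y; apply: scaled_field_small => //.
near: y; have : \forall y \near x, `|y| < r * 3.
  apply/nbhs_ballP; exists (r * 3 - `|x|); first by rewrite /= subr_gt0.
  move=> y; rewrite -ball_normE /ball_ /= distrC => yx.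
  have -> : y = x + (y - x) by rewrite addrC subrK.
  by apply: le_lt_trans (ler_normD _ _) _; rewrite addrC -ltrBrDr.
by apply: filterS => y; exact: ltW.
Unshelve. all: by end_near. Qed.

End dilation_field.

(** * Effect of one shear on gradient and volume *)

Section representation.
Context {R : realType} {m : nat}.
Let n := m.+1.
Implicit Types (E : set 'rV[R]_n) (S : 'rV[R]_n -> 'rV[R]_n) (i j k : 'I_n).
Local Notation leb := (lebesgue_rV n).
Local Open Scope ereal_scope.

(* [grad_rep E mu S g] says that the distributional gradient of the indicator
   of E is the image under S of the vector measure g mu. *)
Definition grad_rep E (mu : {finite_measure set 'rV[R]_n -> \bar R}) S
    (g : 'I_n -> 'rV[R]_n -> R) :=
  [/\ measurable_fun setT S, forall i, mu.-integrable setT (EFin \o g i) &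
    forall phi, test_function phi -> forall i,
    \int[leb]_(x in E) (partial i phi x)%:E = - \int[mu]_z (phi (S z) * g i z)%:E].

(** The volume analogue of [grad_rep]: [w] plays the Jacobian of [S] from E0 onto E, recorded only
    through its effect on integrals. *)
Definition vol_rep E E0 S (w : 'rV[R]_n -> R) :=
  [/\ measurable E, measurable_fun setT w, (forall z, 0 <= w z)%R &
    forall f : 'rV[R]_n -> \bar R, measurable_fun setT f -> (forall x, 0 <= f x) ->
    \int[leb]_(x in E) f x = \int[leb]_(z in E0) (f (S z) * (w z)%:E)].

Lemma integrable_boundedM (mu : {measure set 'rV[R]_n -> \bar R}) (D : set 'rV[R]_n)
    (f g : 'rV[R]_n -> R) (M : R) : measurable D ->
  measurable_fun setT f -> (forall x, `|f x| <= M)%R ->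
  mu.-integrable D (EFin \o g) -> mu.-integrable D (fun x => (f x * g x)%:E).
Proof.
move=> mD mf fM ig.
apply: (le_integrable mD _ _ (integrableZl mD M ig)).
  apply/measurable_EFinP; apply: measurable_funM.
    exact: measurable_funS mf.
  by apply/measurable_EFinP; exact: measurable_int ig.
move=> x _; rewrite /= lee_fin normrM [leRHS]normrM.
rewrite ler_wpM2r//; apply: le_trans (fM x) _; exact: ler_norm.
Qed.

Lemma integrable_bounded_set E (f : 'rV[R]_n -> R) (M : R) : measurable E ->
  leb E < +oo -> measurable_fun setT f -> (forall x, `|f x| <= M)%R ->
  leb.-integrable E (EFin \o f).
Proof.
move=> mE Eoo mf fM; apply: measurable_bounded_integrable => //.
  exact: measurable_funS mf.
exists M; split; first exact: num_real.
by move=> N MN x _; apply: le_trans (fM x) _; exact: ltW.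
Qed.

Section step.
Variables (k : 'I_n) (a : 'rV[R]_n -> R).
Hypotheses (ta : test_function a) (jac_gt0 : forall x, (0 < jac k a x)%R).
Let T := shear 1 a k.
Let sa : smooth a. Proof. by case: ta. Qed.
Variable Tinv : 'rV[R]_n -> 'rV[R]_n.
Hypotheses (mTinv : measurable_fun setT Tinv) (TK : cancel T Tinv).

Lemma test_shear phi : test_function phi -> test_function (phi \o T).
Proof.
move=> /test_functionP[sphi [M M0 phiM]]; have [N N0 aN] := test_bounded ta.
apply/test_functionP; split; first exact: smooth_shear.
exists (M + N)%R => [|x]; first exact: addr_ge0.
move=> /phiM TM; apply/rV_norm_le => [|i]; first exact: addr_ge0.
have := le_trans (rV_coord_le (T x) i) TM.
rewrite /T /shear !mxE eqxx/= mul1r => h.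
have aN' : (`|a x * (i == k)%:R| <= N)%R.
  by case: eqP => _; rewrite ?mulr1 ?aN// mulr0 normr0.
have -> : (x ord0 i = (x ord0 i + a x * (i == k)%:R) - a x * (i == k)%:R)%R by rewrite addrK.
by apply: le_trans (ler_normB _ _) _; exact: lerD.
Qed.

(** With psi = phi o T and J = 1 + d_k a, one has J (d_i phi) o T = d_i (psi J) - d_k (psi d_i a):
    the second derivatives of [a] cancel by symmetry. Both terms on the right are partials of test
    functions, so the representation of E applies to each and yields the density J g_i - (d_i a)
    g_k. For i = k this is g_k itself. *)
Lemma grad_rep_shear E mu S g : measurable E -> leb E < +oo ->
  grad_rep E mu S g ->
  grad_rep (Tinv @^-1` E) mu (T \o S)
    (fun i z => jac k a (S z) * g i z - partial i a (S z) * g k z)%R.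
Proof.
move=> mE Eoo [mS ig rep].
have [A A0 aA] := test_bounded ta.
have pa i : test_function (partial i a) by exact: test_partial.
have mT : measurable_fun setT T by exact: measurable_shear.
have mpa i : measurable_fun setT (partial i a \o S).
  by apply: measurableT_comp => //; apply: smooth_measurable; case: (pa i).
have sJ : smooth (jac k a).
  by apply: (@smoothD _ _ (cst 1%R) (partial k a)); [exact: smooth_cst|case: (pa k)].
have mJ : measurable_fun setT (jac k a \o S).
  by apply: measurableT_comp => //; exact: smooth_measurable.
have [B B0 paB] : exists2 B : R, (0 <= B)%R & forall x, (`|jac k a x| <= B)%R.
  have [B B0 h] := test_bounded (pa k); exists (1 + B)%R; first exact: addr_ge0.
  by move=> x; rewrite (le_trans (ler_normD _ _))// normr1 lerD2l.
split.
- exact: measurableT_comp.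
- move=> i; have [D D0 paD] := test_bounded (pa i).
  have := integrableB measurableT
    (integrable_boundedM measurableT mJ (fun x => paB (S x)) (ig i))
    (integrable_boundedM measurableT (mpa i) (fun x => paD (S x)) (ig k)).
  by apply: eq_integrable => // z _; rewrite /= EFinB.
move=> phi tphi i.
have [sphi _] := tphi.
rewrite (integral_shear_set sa aA jac_gt0 mTinv TK mE); last first.
  by apply: smooth_measurable; exact: smooth_partial.
have tpsi := test_shear tphi.
set psi := phi \o T in tpsi *.
have [spsi _] := tpsi.
have t1 : test_function (psi \* jac k a)%R by exact: testM.
have t2 : test_function (psi \* partial i a)%R by apply: testM => //; case: (pa i).
have E1 x : (partial i phi (T x) * jac k a x =
    partial i (psi \* jac k a) x - partial k (psi \* partial i a) x)%R.
  have ppsi j : partial j psi x = (partial j phi (T x) + partial j a x * partial k phi (T x))%R.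
    rewrite /psi partial_shear; [|exact: smooth_diff|exact: smooth_diff].
    by rewrite mul1r.
  have pM j f : smooth f -> partial j (psi \* f)%R x =
      (psi x * partial j f x + f x * partial j psi x)%R.
    move=> sf; rewrite partialM// => y; exact: smooth_diff.
  rewrite !pM//; last by case: (pa i).
  have -> : partial i (jac k a) x = partial k (partial i a) x.
    rewrite (partialC k i sa).
    have -> : jac k a = (cst 1 \+ partial k a)%R by [].
    rewrite partialD; [|by move=> y; exact: differentiable_cst|].
      by rewrite /= partial_cst add0r.
    by move=> y; apply: smooth_diff; case: (pa k).
  rewrite !ppsi /jac.
  have aux (pi pk ai ak ps c : R) : (pi * (1 + ak) =
      ps * c + (1 + ak) * (pi + ai * pk) - (ps * c + ai * (pk + ak * pk)))%R by ring.
  exact: aux.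
have int_test h j : test_function h -> leb.-integrable E (EFin \o partial j h).
  move=> th; have tj := test_partial j th; have [D D0 hD] := test_bounded tj.
  by apply: integrable_bounded_set hD => //; apply: smooth_measurable; case: tj.
under eq_integral do rewrite E1 EFinB.
rewrite integralB//; [|exact: int_test|exact: int_test].
rewrite !rep//.
have [P P0 psiP] := test_bounded t1; have [Q Q0 psiQ] := test_bounded t2.
have iP : mu.-integrable setT (fun z => ((psi \* jac k a)%R (S z) * g i z)%:E).
  apply: (integrable_boundedM (f := (psi \* jac k a)%R \o S) _ _ (fun z => psiP (S z))) => //.
  by apply: measurableT_comp => //; apply: smooth_measurable; case: t1.
have iQ : mu.-integrable setT (fun z => ((psi \* partial i a)%R (S z) * g k z)%:E).
  apply: (integrable_boundedM (f := (psi \* partial i a)%R \o S) _ _ (fun z => psiQ (S z))) => //.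
  by apply: measurableT_comp => //; apply: smooth_measurable; case: t2.
have -> : \int[mu]_z (phi ((T \o S) z) *
      (jac k a (S z) * g i z - partial i a (S z) * g k z))%:E =
    \int[mu]_z ((psi \* jac k a)%R (S z) * g i z)%:E -
    \int[mu]_z ((psi \* partial i a)%R (S z) * g k z)%:E.
  rewrite -integralB//; apply: eq_integral => z _; rewrite -EFinB; congr EFin.
  by rewrite /psi /=; ring.
rewrite oppeK fin_num_oppeB//.
exact: (integrable_fin_num measurableT iQ).
Qed.

Lemma vol_rep_shear E E0 S w : measurable_fun setT S -> measurable E0 ->
  vol_rep E E0 S w ->
  vol_rep (Tinv @^-1` E) E0 (T \o S) (fun z => jac k a (S z) * w z)%R.
Proof.
move=> mS mE0 [mE mw w0 rep]; have [A A0 aA] := test_bounded ta.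
have mJ : measurable_fun setT (jac k a) by exact: measurable_jac.
have mT : measurable_fun setT T by exact: measurable_shear.
split.
- by rewrite -[X in measurable X]setTI; exact: mTinv.
- by apply: measurable_funM => //; exact: measurableT_comp.
- by move=> z; rewrite mulr_ge0// ltW.
move=> f mf f0; rewrite (ge0_integral_shear_set sa aA jac_gt0 mTinv TK mE mf f0).
rewrite rep.
- by apply: eq_integral => z _; rewrite EFinM muleA.
- apply: emeasurable_funM; last exact/measurable_EFinP.
  exact: measurableT_comp.
- by move=> x; rewrite mule_ge0// lee_fin ltW.
Qed.

End step.
End representation.

(** * Composition of the shears *)

Section deformation.
Context {R : realType} {m : nat}.
Let n := m.+1.
Local Notation leb := (lebesgue_rV n).
Implicit Types (s : seq 'I_n) (z y : 'rV[R]_n).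

(** The state after the shears in the directions listed in [s]; all estimates compare with the
    initial [g0] and the initial volume. On the ball of radius r a shear in direction k multiplies
    every gradient component but the k-th by 1 + t, which the exponent [count (predC1 i) s] counts;
    [uniq s] ensures that no coordinate is stretched twice. *)
Record deformed (E0 : set 'rV[R]_n) (mu : {finite_measure set 'rV[R]_n -> \bar R})
    (g0 : 'I_n -> 'rV[R]_n -> R) (r t K B : R) s (E : set 'rV[R]_n)
    (S : 'rV[R]_n -> 'rV[R]_n) (g : 'I_n -> 'rV[R]_n -> R) (w : 'rV[R]_n -> R) :
    Prop := Deformed {
  deformed_grad : grad_rep E mu S g;
  deformed_vol : vol_rep E E0 S w;
  deformed_g : forall z, \sum_i `|g i z - g0 i z| <= K * t * \sum_i `|g0 i z|;
  deformed_w : forall z, `|w z - 1| <= K * t;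
  deformed_g_in : uniq s -> forall z, `|z| <= r -> forall i,
    g i z = (1 + t) ^+ (count (predC1 i) s) * g0 i z;
  deformed_w_in : uniq s -> forall z, `|z| <= r -> w z = (1 + t) ^+ size s;
  deformed_S_in : uniq s -> forall z, `|z| <= r -> forall i,
    S z ord0 i = if i \in s then (1 + t) * z ord0 i else z ord0 i;
  deformed_sub : forall y, E y -> exists2 z, E0 z & y = S z;
  deformed_out : forall z, r * 4 <= `|z| -> S z = z;
  deformed_near : forall z, `|S z - z| <= (size s)%:R * (t * (r * B)) }.

Lemma vol_rep_lty (E0 E : set 'rV[R]_n) S w (M : R) : measurable E0 ->
  (leb E0 < +oo)%E -> vol_rep E E0 S w -> (forall z, w z <= M) -> (leb E < +oo)%E.
Proof.
move=> mE0 E0oo [mE mw w0 rep] wM.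
have := rep (cst 1%E) (measurable_cst _) (fun=> lee01).
rewrite integral_cst// mul1e => ->.
apply: (@le_lt_trans _ _ (\int[leb]_(z in E0) (cst M%:E) z)%E).
  apply: ge0_le_integral => //.
  - by move=> z _; rewrite mul1e lee_fin.
  - by under eq_fun do rewrite mul1e; apply/measurable_EFinP; exact: measurable_funS mw.
  - by move=> z _; rewrite mul1e lee_fin.
rewrite integral_cst// lte_mul_pinfty// ?lee_fin//.
exact: le_trans (w0 0) (wM 0).
Qed.

(** The order of the quantifiers matters: [t0] and [B] come from the field alone and [K] depends
    only on [s], all before the set, the radius and t. The radius can thus be chosen in terms of K,
    and t afterwards. *)
Lemma deformation_exists : exists t0 B : R, [/\ 0 < t0, t0 <= 1 &
  forall s, exists2 K : R, 0 <= K &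
  forall E0 (mu : {finite_measure set 'rV[R]_n -> \bar R}) g0, measurable E0 ->
    (leb E0 < +oo)%E -> grad_rep E0 mu id g0 ->
  forall r t : R, 0 < r -> 0 <= t -> t <= t0 ->
  exists E S g w, deformed E0 mu g0 r t K B s E S g w].
Proof.
have [C C0 hC] := @field_bounds R n.
(* With t <= 1/(2C) every partial of the displacement is at most t C <= 1/2 in absolute value, so
   the Jacobians 1 + d_k a are positive. *)
exists (Num.min 1 (C *+ 2)^-1), C; split.
- by rewrite lt_min ltr01 invr_gt0 pmulrn_lgt0.
- by rewrite ge_min lexx.
elim=> [|k s [K K0 IH]].
  exists 0 => // E0 mu g0 mE0 E0oo rep r t r0 t0 tle.
  exists E0, id, g0, (cst 1); split => //.
  - split => //.
    by move=> f mf f0; apply: eq_integral => z _; rewrite mule1.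
  - by move=> z; rewrite big1 ?mul0r// => i _; rewrite subrr normr0.
  - by move=> z; rewrite subrr normr0 mul0r.
  - by move=> _ z _ i; rewrite expr0 mul1r.
  - by move=> y Ey; exists y.
  - by move=> z; rewrite subrr normr0 mul0r.
(* A further shear changes component i by at most t C (|g_i| + |g_k|). Summed over i this is at most
   (n + 1) t C times the sum of the |g_i|, itself at most 1 + K times the initial sum. *)
exists (K + C * n.+1%:R * (1 + K)).
  by apply: addr_ge0 => //; apply: mulr_ge0; [apply: mulr_ge0 => //; exact: ltW|exact: addr_ge0].
move=> E0 mu g0 mE0 E0oo rep r t r0 t0 tle.
have [E [S [g [w D]]]] := IH E0 mu g0 mE0 E0oo rep r t r0 t0 tle.
have t1 : t <= 1 by apply: le_trans tle _; rewrite ge_min lexx.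
have tC : t * C <= 2^-1.
  apply: (@le_trans _ _ ((C *+ 2)^-1 * C)).
    by apply: ler_wpM2r; [exact: ltW|apply: le_trans tle _; rewrite ge_min lexx orbT].
  have -> // : (C *+ 2)^-1 * C = 2^-1 by rewrite -(mulr_natr C); field; rewrite gt_eqF.
pose a := cst t \* scaled_field r k.
have ta : test_function a.
  have -> : a = scaled_field r k \* cst t by apply/funext => x; rewrite /a /= mulrC.
  by apply: testM; [exact: smooth_cst|exact: test_scaled_field].
have pa i x : partial i a x = t * partial i (scaled_field r k) x.
  have sf : smooth (scaled_field r k) by exact: smooth_scaled_field.
  have dt y : differentiable (cst t : 'rV[R]_n -> R) y by exact: differentiable_cst.
  have := congr1 (fun h => h x) (partialM i dt (fun y => smooth_diff y sf)).
  have e0 : partial i (cst t) x = 0 by rewrite partial_cst.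
  by move=> /= ->; rewrite e0 mulr0 addr0.
have paC i x : `|partial i a x| <= t * C.
  rewrite pa normrM (ger0_norm t0) ler_wpM2l// partial_scaled_field ?gt_eqF//.
  by have [_] := hC k (r^-1 *: x); exact.
have jac_gt0 x : 0 < jac k a x.
  have := paC k x; rewrite ler_norml => /andP[h _]; rewrite /jac; lra.
have [sa _] := ta; have [A A0 aA] := test_bounded ta.
have [Tinv mTinv [TK KT]] := shear_inverse sa aA jac_gt0.
have mS : measurable_fun setT S by case: (deformed_grad D).
have mE : measurable E by case: (deformed_vol D).
have wM z : w z <= 1 + K.
  have := deformed_w D z; rewrite ler_norml => /andP[_].
  have : K * t <= K by rewrite -[leRHS]mulr1 ler_wpM2l.
  by lra.
have Eoo := vol_rep_lty mE0 E0oo (deformed_vol D) wM.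
have gsum z : \sum_i `|g i z| <= (1 + K) * \sum_i `|g0 i z|.
  apply: (@le_trans _ _ (\sum_i (`|g i z - g0 i z| + `|g0 i z|))).
    by apply: ler_sum => i _; rewrite -[g i z in leLHS](subrK (g0 i z)) ler_normD.
  rewrite big_split/= mulrDl mul1r addrC lerD2l; apply: le_trans (deformed_g D z) _.
  by rewrite ler_wpM2r ?sumr_ge0// -[leRHS]mulr1 ler_wpM2l.
(* From |z| <= r each coordinate is stretched at most once, by 1 + t <= 2, so the point stays in |x|
   <= 2r < 3r, where the field is still linear. *)
have S_in z : uniq s -> `|z| <= r -> `|S z| < r * 3.
  move=> us zr; apply: (@le_lt_trans _ _ (r * 2)); last by rewrite ltr_pM2l//; lra.
  apply/rV_norm_le => [|i]; first by rewrite mulr_ge0// ltW.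
  rewrite (deformed_S_in D us zr); have h : `|z ord0 i| <= r := le_trans (rV_coord_le z i) zr.
  case: ifPn => _; last by apply: le_trans h _; rewrite ler_peMr ?ltW//; lra.
  have e : `|1 + t| = 1 + t by rewrite ger0_norm//; lra.
  rewrite normrM e mulrC.
  by apply: ler_pM => //; lra.
exists (Tinv @^-1` E), (shear 1 a k \o S),
  (fun i z => jac k a (S z) * g i z - partial i a (S z) * g k z),
  (fun z => jac k a (S z) * w z).
split.
- exact: grad_rep_shear (deformed_grad D).
- exact: vol_rep_shear (deformed_vol D).
- move=> z.
  apply: (@le_trans _ _ (\sum_i (`|g i z - g0 i z| + t * C * (`|g i z| + `|g k z|)))).
    apply: ler_sum => i _; rewrite /jac mulrDl mul1r.
    have aux (p q u v c : R) : u + p * u - q * v - c = (u - c) + (p * u - q * v) by ring.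
    rewrite aux.
    apply: le_trans (ler_normD _ _) _; rewrite lerD2l.
    apply: le_trans (ler_normB _ _) _; rewrite mulrDr !normrM.
    by apply: lerD; rewrite ler_wpM2r// paC.
  rewrite big_split/= -mulr_sumr big_split/= sumr_const card_ord.
  have gk : `|g k z| <= \sum_i `|g i z|.
    by rewrite (bigD1 k)//= lerDl sumr_ge0.
  apply: (@le_trans _ _ (K * t * (\sum_i `|g0 i z|) +
      t * C * (n.+1%:R * ((1 + K) * \sum_i `|g0 i z|)))).
    apply: lerD; first exact: (deformed_g D z).
    apply: ler_wpM2l; first by apply: mulr_ge0; [exact: t0|exact: ltW].
    apply: (@le_trans _ _ (n.+1%:R * \sum_i `|g i z|)); last by rewrite ler_wpM2l.
    have auxn (x y : R) (p : nat) : x <= y -> y + x *+ p <= p.+1%:R * y.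
      by move=> xy; rewrite mulr_natl mulrS lerD2l lerMn2r xy orbT.
    exact: auxn.
  have aux (G c : R) : K * t * G + t * C * (c * ((1 + K) * G)) = (K + C * c * (1 + K)) * t * G.
    by ring.
  by rewrite aux.
- move=> z; rewrite /jac mulrDl mul1r.
  rewrite addrAC.
  apply: le_trans (ler_normD _ _) _; rewrite mulrDl lerD ?(deformed_w D)//.
  have w0 : 0 <= w z by case: (deformed_vol D) => _ _ + _; exact.
  rewrite normrM (ger0_norm w0).
  apply: (@le_trans _ _ (t * C * (1 + K))); first by apply: ler_pM.
  have -> : C * n.+1%:R * (1 + K) * t = n.+1%:R * (t * C * (1 + K)) by ring.
  rewrite ler_peMl ?ler1n//; apply: mulr_ge0; [apply: mulr_ge0 => //; exact: ltW|exact: addr_ge0].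
- rewrite cons_uniq => /andP[ks us] z zr i.
  have Sz := S_in z us zr.
  rewrite /jac !pa !partial_scaled_field_small// eqxx /= !(deformed_g_in D us zr).
  case: (eqVneq k i) => [->|ki] /=.
    have aux (p q : R) : (1 + t * 1) * (p * q) - t * 1 * (p * q) = p * q by ring.
    by rewrite add0n aux.
  have aux (p q u v : R) : (1 + t * 1) * (p * q) - t * 0 * (u * v) = (1 + t) * p * q by ring.
  by rewrite add1n exprS aux.
- rewrite cons_uniq => /andP[ks us] z zr.
  rewrite /jac pa partial_scaled_field_small ?S_in// eqxx (deformed_w_in D us zr).
  by rewrite mulr1 -exprS.
- rewrite cons_uniq => /andP[ks us] z zr i.
  rewrite /= /shear !mxE eqxx /= mul1r (deformed_S_in D us zr) inE.
  rewrite /a /= scaled_field_small//; last exact/ltW/S_in.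
  rewrite (deformed_S_in D us zr) (negbTE ks).
  case: (eqVneq i k) => [->|ik] /=; last by rewrite mulr0 addr0.
  by rewrite (negbTE ks); ring.
- move=> y /= /(deformed_sub D)[z E0z yz]; exists z => //.
  by rewrite /= -yz KT.
- move=> z zr; rewrite /= (deformed_out D zr) /shear /a /= scaled_field_large//.
  by rewrite mulr0 scale0r addr0 scale1r.
- move=> z /=.
  have -> : (size s).+1%:R * (t * (r * C)) = (size s)%:R * (t * (r * C)) + t * (r * C).
    by rewrite -[in LHS]natr1 mulrDl mul1r.
  have -> : shear 1 a k (S z) - z = (S z - z) + a (S z) *: delta_mx ord0 k.
    by rewrite /shear scale1r addrAC.
  apply: le_trans (ler_normD _ _) _; apply: lerD; first exact: (deformed_near D z).
  rewrite normrZ /a /= normrM (ger0_norm t0) -mulrA ler_wpM2l//.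
  rewrite /scaled_field normrM (gtr0_norm r0) -mulrA; apply: ler_wpM2l; first exact: ltW.
  have [h _] := hC k (r^-1 *: S z); apply: le_trans _ h.
  rewrite -[leRHS]mulr1 ler_wpM2l//; apply/rV_norm_le => // i.
  by rewrite mxE eqxx /=; case: eqP; rewrite ?normr1 ?normr0.
Qed.

End deformation.

(** * Gradients of sets of finite perimeter *)

Section charge_density.
Context d d' (T : measurableType d) (T' : measurableType d') {R : realType}.
Local Open Scope ereal_scope.

(** Splitting [h] into its positive and negative parts writes the charge as a difference of two
    image measures, on which [integral_chargeE] applies. *)
Lemma integral_charge_density (nu : {charge set T' -> \bar R})
    (mu : {finite_measure set T -> \bar R}) (S : T -> T') (h : T -> R)
    (f : T' -> R) (M : R) :
  measurable_fun setT S -> mu.-integrable setT (EFin \o h) ->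
  (forall A, measurable A -> nu A = \int[mu]_(x in S @^-1` A) (h x)%:E) ->
  measurable_fun setT f -> (forall x, `|f x| <= M)%R ->
  integral_charge nu f = \int[mu]_x (f (S x) * h x)%:E.
Proof.
move=> mS ih nuE mf fM.
pose p x : R := Num.max (h x) 0%R; pose q x : R := Num.max (- h x)%R 0%R.
have p0 x : (0 <= p x)%R by rewrite /p le_max lexx orbT.
have q0 x : (0 <= q x)%R by rewrite /q le_max lexx orbT.
have hpq x : (h x = p x - q x)%R.
  by rewrite /p /q /Num.max; case: ifPn; case: ifPn => //; lra.
have mh : measurable_fun setT h by exact/measurable_EFinP/(measurable_int mu).
have mp : measurable_fun setT p by apply: measurable_maxr => //; exact: measurable_cst.
have mq : measurable_fun setT q.
  by apply: measurable_maxr => //; exact: measurableT_comp.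
have hp x : (`|p x| <= `|h x|)%R.
  by rewrite ger0_norm// ge_max ler_norm normr_ge0.
have hq x : (`|q x| <= `|h x|)%R.
  by rewrite ger0_norm// ge_max -(normrN (h x)) ler_norm normr_ge0.
have ip : mu.-integrable setT (EFin \o p).
  apply: (le_integrable measurableT _ _ ih); first exact/measurable_EFinP.
  by move=> x _; rewrite /= lee_fin hp.
have iq : mu.-integrable setT (EFin \o q).
  apply: (le_integrable measurableT _ _ ih); first exact/measurable_EFinP.
  by move=> x _; rewrite /= lee_fin hq.
have intf (g : T -> R) : mu.-integrable setT (EFin \o g) ->
    mu.-integrable setT (EFin \o (fun x => f (S x) * g x)%R).
  move=> ig; apply: (le_integrable measurableT _ _ (integrableZl measurableT M ig)).
    apply/measurable_EFinP; apply: measurable_funM; first exact: measurableT_comp.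
    exact/measurable_EFinP/(measurable_int mu).
  move=> x _; rewrite /= lee_fin normrM [leRHS]normrM.
  rewrite ler_wpM2r//; apply: le_trans (fM (S x)) _; exact: ler_norm.
rewrite (@integral_chargeE _ _ _ nu (density_image mu p S) (density_image mu q S) f M)//.
  rewrite (integral_density_image ip p0 mS mf fM) (integral_density_image iq q0 mS mf fM).
  rewrite -integralB//; [|exact: intf|exact: intf].
  by apply: eq_integral => x _; rewrite -EFinB -mulrBr -hpq.
move=> A mA; rewrite nuE// /= !density_imageE.
have mSA : measurable (S @^-1` A) by rewrite -[X in measurable X]setTI; exact: mS.
rewrite -integralB//; [|exact: integrableS ip|exact: integrableS iq].
by apply: eq_integral => x _; rewrite -EFinB -hpq.
Qed.

End charge_density.

Section charge_unique.
Context {R : realType} {n : nat}.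
Local Open Scope ereal_scope.

(** With Jordan parts moved across, the claim reads p + q' = p' + q, an equality of finite measures
    that test functions decide. *)
Lemma charge_test_unique (nu nu' : {charge set 'rV[R]_n -> \bar R}) :
  (forall phi, test_function phi -> integral_charge nu phi = integral_charge nu' phi) ->
  forall A, measurable A -> nu A = nu' A.
Proof.
move=> E A mA.
have [P [N PN]] := Hahn_decomposition nu.
have [P' [N' PN']] := Hahn_decomposition nu'.
pose p : {finite_measure set 'rV[R]_n -> \bar R} := jordan_pos PN.
pose q : {finite_measure set 'rV[R]_n -> \bar R} := jordan_neg PN.
pose p' : {finite_measure set 'rV[R]_n -> \bar R} := jordan_pos PN'.
pose q' : {finite_measure set 'rV[R]_n -> \bar R} := jordan_neg PN'.
have nuE B : measurable B -> nu B = p B - q B.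
  by move=> mB; rewrite (jordan_decomp PN mB) /cadd/= cscaleN1.
have nu'E B : measurable B -> nu' B = p' B - q' B.
  by move=> mB; rewrite (jordan_decomp PN' mB) /cadd/= cscaleN1.
have key B : measurable B -> measure_add p q' B = measure_add p' q B.
  have oo (a b : {finite_measure set 'rV[R]_n -> \bar R}) : measure_add a b setT < +oo.
    by rewrite measure_addE; apply: lte_add_pinfty; rewrite ltey_eq fin_num_measure.
  apply: test_measure_unique => [||phi tphi]; [exact: oo|exact: oo|].
  have [M M0 phiM] := test_bounded tphi.
  have mphi : measurable_fun setT phi by apply: smooth_measurable; case: tphi.
  have ip (mu : {finite_measure set 'rV[R]_n -> \bar R}) : mu.-integrable setT (EFin \o phi).
    exact: integrable_bounded phiM.
  have fp (mu : {finite_measure set 'rV[R]_n -> \bar R}) : \int[mu]_x (phi x)%:E \is a fin_num.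
    exact: (integrable_fin_num measurableT (ip mu)).
  rewrite (@integral_measure_add _ _ _ p q' _ measurableT (EFin \o phi) (ip p) (ip q')).
  rewrite (@integral_measure_add _ _ _ p' q _ measurableT (EFin \o phi) (ip p') (ip q)).
  have := E phi tphi.
  rewrite (integral_chargeE nuE mphi phiM) (integral_chargeE nu'E mphi phiM).
  have := fp p; have := fp q; have := fp p'; have := fp q'; rewrite /comp.
  move: (\int[p]_x _) (\int[q]_x _) (\int[p']_x _) (\int[q']_x _).
  move=> [x||] [y||] [z||] [t||] // _ _ _ _; rewrite -!EFinB -!EFinD => -[h].
  by congr EFin; lra.
have : p A + q' A = p' A + q A by have := key A mA; rewrite !measure_addE.
rewrite nuE// nu'E//.
have : p A \is a fin_num by exact: fin_num_measure.
have : q A \is a fin_num by exact: fin_num_measure.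
have : p' A \is a fin_num by exact: fin_num_measure.
have : q' A \is a fin_num by exact: fin_num_measure.
move: (p A) (q A) (p' A) (q' A) => [x||] [y||] [z||] [t||] // _ _ _ _.
by rewrite -!EFinB -!EFinD => -[h]; congr EFin; lra.
Qed.

End charge_unique.

(** * Polar decomposition of a vector measure *)

Section polar.
Context d (T : measurableType d) {R : realType} (n : nat).
Variable D : 'I_n -> {charge set T -> \bar R}.
Local Open Scope ereal_scope.

Let mu : {finite_measure set T -> \bar R} := Defs.variation D.

Definition polar_density i x : R := fine (Radon_Nikodym (D i) mu x).

Lemma coord_le_enorm (v : 'rV[R]_n) i : (`|v ord0 i| <= enorm v)%R.
Proof.
rewrite -sqrtr_sqr ler_wsqrtr// /dotr (bigD1 i)//= -expr2 lerDl sumr_ge0// => j _.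
by rewrite -expr2 sqr_ge0.
Qed.

(** The partition of A into A and empty sets already contributes the Euclidean norm of D(A). *)
Lemma charge_le_variation i A : measurable A -> `|D i A| <= Defs.variation D A.
Proof.
move=> mA; rewrite /Defs.variation le_max; apply/orP; right.
pose F (k : nat) := if k is 0%N then A else set0.
apply: (@le_trans _ _ (enorm (vec_charge D A))%:E).
  have -> : `|D i A| = (`|fine (D i A)|)%:E.
    by rewrite -abse_EFin fineK// fin_num_measure.
  have -> : fine (D i A) = vec_charge D A ord0 i by rewrite mxE.
  by rewrite lee_fin coord_le_enorm.
apply: ereal_sup_ubound; exists F.
  split; first by move=> [|k]; rewrite /F.
  - by apply/trivIsetP => -[|a] [|b] _ _ // _; rewrite ?(set0I, setI0).
  - by apply/seteqP; split => [x [[|a] _]//|x Ax]; exists 0%N.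
apply/cvg_lim => //; rewrite -cvg_shiftS.
rewrite (_ : [sequence _]_N = cst (enorm (vec_charge D A))%:E); first exact: cvg_cst.
apply/funext => N /=; rewrite big_nat_recl//= big1 ?adde0// => a _.
rewrite (_ : vec_charge D set0 = 0%R) ?enorm0//.
by apply/rowP => j; rewrite !mxE charge0.
Qed.

Lemma dominates_variation i : D i `<< mu.
Proof.
apply/null_content_dominatesP => A mA muA.
have := charge_le_variation i mA; rewrite -[Defs.variation D A]/(mu A) muA.
by move=> h; apply/eqP; rewrite -abse_eq0 eq_le h abse_ge0.
Qed.

Lemma integrable_polar i : mu.-integrable setT (EFin \o polar_density i).
Proof.
have := Radon_Nikodym_integrable (dominates_variation i).
apply: eq_integrable => // x _; rewrite /= /polar_density fineK//.
exact: Radon_Nikodym_fin_num (dominates_variation i).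
Qed.

Lemma polar_integral i A : measurable A ->
  D i A = \int[mu]_(x in A) (polar_density i x)%:E.
Proof.
move=> mA; rewrite (Radon_Nikodym_integral (dominates_variation i) mA).
apply: eq_integral => x _; rewrite /polar_density fineK//.
exact: Radon_Nikodym_fin_num (dominates_variation i).
Qed.

Lemma integral_lin_comb d' (T' : measurableType d') (m : {measure set T' -> \bar R})
    (A : set T') (u : 'rV[R]_n) (g : 'I_n -> T' -> R) :
  measurable A -> (forall i, m.-integrable A (EFin \o g i)) ->
  \int[m]_(x in A) (\sum_i u ord0 i * g i x)%:E =
  \sum_i (u ord0 i)%:E * \int[m]_(x in A) (g i x)%:E.
Proof.
move=> mA ig; under eq_integral do rewrite -sumEFin.
rewrite integral_sum//; last first.
  move=> i; under eq_fun do rewrite EFinM.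
  exact: (integrableZl mA (u ord0 i) (ig i)).
apply: eq_bigr => i _; under eq_integral do rewrite EFinM.
exact: (integralZl mA (ig i) (u ord0 i)).
Qed.

Lemma integrable_lin_comb d' (T' : measurableType d') (m : {measure set T' -> \bar R})
    (u : 'rV[R]_n) (g : 'I_n -> T' -> R) :
  (forall i, m.-integrable setT (EFin \o g i)) ->
  m.-integrable setT (fun x => (\sum_i u ord0 i * g i x)%:E).
Proof.
move=> ig; under eq_fun do rewrite -sumEFin.
apply: integrable_sum => // i _; under eq_fun do rewrite EFinM.
exact: (integrableZl measurableT (u ord0 i) (ig i)).
Qed.

(* The left-hand side is the total variation of the scalar measure u . D. *)
Lemma polar_variation_le d' (T' : measurableType d') (m : {measure set T' -> \bar R})
    (S : T' -> T) (g : 'I_n -> T' -> R) (u : 'rV[R]_n) :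
  measurable_fun setT S -> (forall i, m.-integrable setT (EFin \o g i)) ->
  (forall i A, measurable A -> D i A = \int[m]_(z in S @^-1` A) (g i z)%:E) ->
  \int[mu]_x `|\sum_i u ord0 i * polar_density i x|%:E <=
  \int[m]_z `|\sum_i u ord0 i * g i z|%:E.
Proof.
move=> mS ig DE.
set f := fun x => (\sum_i u ord0 i * polar_density i x)%R.
set h := fun z => (\sum_i u ord0 i * g i z)%R.
have iff : mu.-integrable setT (EFin \o f) by exact/integrable_lin_comb/integrable_polar.
have ih : m.-integrable setT (EFin \o h) by exact: integrable_lin_comb.
have mf : measurable_fun setT f by exact/measurable_EFinP/(measurable_int mu).
have mh : measurable_fun setT h by exact/measurable_EFinP/(measurable_int m).
have fE A : measurable A -> \int[mu]_(x in A) (f x)%:E = \int[m]_(z in S @^-1` A) (h z)%:E.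
  move=> mA; have mSA : measurable (S @^-1` A) by rewrite -[X in measurable X]setTI; exact: mS.
  rewrite integral_lin_comb//; last first.
    by move=> i; apply: integrableS (integrable_polar i).
  rewrite integral_lin_comb//; last by move=> i; apply: integrableS (ig i).
  apply: eq_bigr => i _.
  by rewrite -DE// -polar_integral.
(* P and its complement form a Hahn decomposition of u . D. On each part the integral of |f| is, up
   to sign, the mass of u . D, which the other representation bounds by the integral of |h| over the
   preimage. *)
pose P := f @^-1` `[0%R, +oo[.
have mP : measurable P by rewrite -[P]setTI; exact: mf.
have mN : measurable (~` P) by exact: measurableC.
have dP : [disjoint P & ~` P] by rewrite disj_set2E setICr.
have mSP : measurable (S @^-1` P) by rewrite -[X in measurable X]setTI; exact: mS.
have mSN : measurable (S @^-1` (~` P)) by rewrite -[X in measurable X]setTI; exact: mS.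
have dSP : [disjoint (S @^-1` P) & S @^-1` (~` P)].
  by rewrite disj_set2E preimage_setC setICr.
have finf A : measurable A -> \int[mu]_(x in A) (f x)%:E \is a fin_num.
  by move=> mA; apply: integrable_fin_num => //; exact: integrableS iff.
have split1 : \int[mu]_x `|f x|%:E =
    \int[mu]_(x in P) (f x)%:E - \int[mu]_(x in ~` P) (f x)%:E.
  rewrite -(setUv P) ge0_integral_setU//; last first.
    by apply: measurable_funTS; apply/measurable_EFinP; exact: measurableT_comp.
  rewrite -[X in _ = _ - X](oppeK) -integralN; last first.
    apply: fin_num_adde_defl; rewrite fin_numN.
    by apply: integrable_neg_fin_num => //; exact: integrableS iff.
  rewrite oppeK; congr (_ + _); apply: eq_integral => x; rewrite inE /P /= in_itv/= andbT.
    by move=> fx; rewrite ger0_norm.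
  by move=> /negP; rewrite -ltNge => fx; rewrite ltr0_norm// EFinN.
have split2 : \int[m]_z `|h z|%:E =
    \int[m]_(z in S @^-1` P) `|h z|%:E + \int[m]_(z in S @^-1` (~` P)) `|h z|%:E.
  rewrite -ge0_integral_setU//; first by rewrite -preimage_setU setUv preimage_setT.
  by apply: measurable_funTS; apply/measurable_EFinP; exact: measurableT_comp.
rewrite split1 split2 !fE//; apply: leeD.
  apply: le_trans (lee_abs _) _; apply: le_abse_integral => //.
  exact: measurable_funTS (measurable_int _ ih).
apply: le_trans (lee_abs _) _; rewrite abseN; apply: le_abse_integral => //.
exact: measurable_funTS (measurable_int _ ih).
Qed.

End polar.

(** * Borel approximation of Lebesgue measurable sets *)

Section volume.
Context {R : realType} {n : nat}.
Local Notation leb := (@lebesgue_rV R n).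
Local Notation cara := (caratheodory_type ((@lebesgue_rV R n)^*)%mu).
Local Open Scope ereal_scope.
Implicit Types (A E : set 'rV[R]_n).

Lemma vol_borel A : measurable A -> vol A = leb A.
Proof. by move=> mA; exact: measurable_mu_extE. Qed.

Lemma borel_lebesgue A : measurable A -> lebesgue_measurable A.
Proof. exact: caratheodory_measurable_mu_ext. Qed.

Let cid0 : cara -> 'rV[R]_n := id.

Let mid : measurable_fun setT cid0.
Proof. by move=> _ A mA; rewrite setTI; exact: borel_lebesgue. Qed.

Lemma borel_measurable_cara d (T : measurableType d) (f : 'rV[R]_n -> T) :
  measurable_fun setT f -> measurable_fun setT (f : cara -> T).
Proof. by move=> mf; exact: (measurableT_comp mf mid). Qed.

Lemma ge0_integral_vol (f : 'rV[R]_n -> \bar R) : measurable_fun setT f ->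
  (forall x, 0 <= f x) -> \int[vol]_x f x = \int[leb]_x f x.
Proof.
move=> mf f0; transitivity (\int[pushforward vol cid0]_x f x).
  by rewrite ge0_integral_pushforward ?preimage_setT.
by apply: eq_measure_integral => ? A mA; exact: vol_borel.
Qed.

Lemma integral_vol (f : 'rV[R]_n -> R) : measurable_fun setT f ->
  \int[vol]_x (f x)%:E = \int[leb]_x (f x)%:E.
Proof.
move=> mf; have mef : measurable_fun setT (EFin \o f) by exact/measurable_EFinP.
rewrite integralE [RHS]integralE; congr (_ - _); apply: ge0_integral_vol => //.
- exact: measurable_funepos.
- exact: measurable_funeneg.
Qed.

(** On an arbitrary set [vol] is the outer measure: intersect over k countable Borel covers of
    excess at most 1/(k+1). *)
Lemma borel_hull A : vol A < +oo ->
  exists B, [/\ measurable B, A `<=` B & leb B = vol A].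
Proof.
move=> Aoo.
have H (k : nat) : exists F, [/\ measurable F, A `<=` F & leb F <= vol A + k.+1%:R^-1%:E].
  have fA : vol A \is a fin_num by rewrite ge0_fin_numE// measure_ge0.
  have k0 : (0 < k.+1%:R^-1 :> R)%R by rewrite invr_gt0.
  have [_ [F [mF AF] <-] lt] := lb_ereal_inf_adherent k0 fA.
  exists (\bigcup_j F j); split => //; first exact: bigcupT_measurable.
  apply: le_trans (ltW lt); apply: measure_sigma_subadditive => //.
  exact: bigcupT_measurable.
have [F FP] := boolp.choice H.
pose B := \bigcap_k F k.
have mB : measurable B by apply: bigcapT_measurable => k; case: (FP k).
have AB : A `<=` B by move=> x Ax k _; case: (FP k) => _ /(_ _ Ax).
exists B; split => //; apply/eqP; rewrite eq_le; apply/andP; split.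
  apply/lee_addgt0Pr => e e0.
  have [k ke] : exists k : nat, (k.+1%:R^-1 <= e)%R.
    exists (Num.trunc e^-1); rewrite -[leRHS]invrK lef_pV2 ?posrE ?invr_gt0//.
    exact/ltW/truncnS_gt.
  have [mF AF Fle] := FP k.
  apply: (@le_trans _ _ (leb (F k))).
    by apply: le_measure; rewrite ?inE//; move=> x /(_ k Logic.I).
  by apply: le_trans Fle _; rewrite leeD2l// lee_fin.
rewrite -vol_borel//; exact: le_outer_measure.
Qed.

(** From a Borel hull B of E, remove a Borel hull of the null set B \ E. *)
Lemma borel_core E : lebesgue_measurable E -> vol E < +oo ->
  exists E0, [/\ measurable E0, E0 `<=` E, leb E0 = vol E & vol (E `\` E0) = 0].
Proof.
move=> mE Eoo; have [B [mB EB BE]] := borel_hull Eoo.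
have mBc := borel_lebesgue mB.
have fE : vol E \is a fin_num by rewrite ge0_fin_numE// measure_ge0.
have BE0 : vol (B `\` E) = 0.
  have := @measureD _ cara R vol B E mBc mE.
  have Boo : vol B < +oo by rewrite vol_borel// BE.
  rewrite (setIidr EB) => /(_ Boo) h.
  have e : vol B = vol E by rewrite vol_borel// BE.
  by apply: (etrans h); apply: (etrans (congr1 (fun z => z - vol E) e)); exact: subee.
have [N [mN BN N0]] : exists B', [/\ measurable B', B `\` E `<=` B' & leb B' = vol (B `\` E)].
  by apply: borel_hull; rewrite BE0.
rewrite BE0 in N0.
exists (B `\` N).
have sub : B `\` N `<=` E by move=> x [Bx Nx]; apply: contrapT => Ex; exact: Nx (BN x (conj Bx Ex)).
have mBN : measurable (B `\` N) by exact: measurableD.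
have null : vol (E `\` (B `\` N)) = 0.
  apply/eqP; rewrite eq_le measure_ge0 andbT -N0 -vol_borel//.
  apply: le_outer_measure => x [Ex nBN]; apply: contrapT => Nx.
  by apply: nBN; split => //; exact: EB.
split => //.
have := @measureD _ cara R vol E (B `\` N) mE (borel_lebesgue mBN) Eoo.
rewrite (setIidr sub) => h; rewrite -vol_borel//.
have {}h : vol E - vol (B `\` N) = 0 by rewrite -null; exact/esym.
have fBN : vol (B `\` N) \is a fin_num.
  by rewrite ge0_fin_numE ?measure_ge0//; apply: le_lt_trans Eoo; exact: le_outer_measure.
move: h fE fBN; move: (vol E) (vol (B `\` N)) => [x||] [y||] // + _ _.
by rewrite -EFinB => -[h]; congr EFin; lra.
Qed.

(** Passage from the completed measure of the definitions to Borel sets, for which Tonelli and the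
    substitution formula are established. *)
Lemma integral_indic_core E E0 (f : 'rV[R]_n -> R) : lebesgue_measurable E ->
  measurable E0 -> E0 `<=` E -> vol (E `\` E0) = 0 -> measurable_fun setT f ->
  \int[vol]_x (\1_E x * f x)%:E = \int[leb]_(x in E0) (f x)%:E.
Proof.
move=> mE mE0 sub null mf.
have mE0c := borel_lebesgue mE0.
transitivity (\int[vol]_x (\1_E0 x * f x)%:E).
  have m1 : measurable_fun setT (fun x : cara => (\1_E x * f x)%:E).
    apply/measurable_EFinP; apply: measurable_funM; last exact: borel_measurable_cara.
    exact: (@measurable_indic _ cara R setT E mE).
  have m2 : measurable_fun setT (fun x : cara => (\1_E0 x * f x)%:E).
    apply/measurable_EFinP; apply: measurable_funM; last exact: borel_measurable_cara.
    exact: (@measurable_indic _ cara R setT E0 mE0c).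
  apply: (@ae_eq_integral _ cara R vol setT _ _ measurableT m1 m2).
  exists (E `\` E0); split; [|exact: null|].
    exact: (@measurableD _ cara E E0 mE mE0c).
  move=> x /= /not_implyP[_]; rewrite !indicE.
  have [xE|xE] := boolP (x \in E); have [xE0|xE0] := boolP (x \in E0) => // _.
  - by split; [exact: set_mem|move=> /mem_set; exact/negP].
  - by exfalso; move/negP: xE; apply; rewrite inE; apply: sub; exact: set_mem.
rewrite integral_vol; last by apply: measurable_funM.
rewrite [RHS]integral_mkcond; apply: eq_integral => x _.
by rewrite patchE indicE; case: ifP => _; rewrite ?mul1r ?mul0r.
Qed.

End volume.

(** * Gradient representations and membership in BV *)

Section bounded_variation.
Context {R : realType} {m : nat}.
Let n := m.+1.
Local Notation leb := (lebesgue_rV n).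
Local Open Scope ereal_scope.
Implicit Types (E : set 'rV[R]_n) (u : 'rV[R]_n).

Lemma distributional_gradientP (f : 'rV[R]_n -> R) : BV f ->
  is_distributional_gradient f (distributional_gradient f).
Proof.
move=> [_ h]; rewrite /distributional_gradient; case: pselect => // h'.
by case: cid.
Qed.

Lemma directional_variationE (f : 'rV[R]_n -> R) u : directional_variation f u =
  \int[grad_variation f]_x
    `|\sum_i u ord0 i * polar_density (distributional_gradient f) i x|%:E.
Proof.
apply: eq_integral => x _; congr (`|_|%:E); apply: eq_bigr => i _; by rewrite mxE.
Qed.

Lemma integral_charge_polar (D : 'I_n -> {charge set 'rV[R]_n -> \bar R}) i phi :
  test_function phi ->
  integral_charge (D i) phi = \int[Defs.variation D]_z (phi z * polar_density D i z)%:E.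
Proof.
move=> tphi; have [M M0 phiM] := test_bounded tphi.
apply: (integral_charge_density (S := id) (M := M)) => //.
- exact: integrable_polar.
- by move=> A mA; exact: polar_integral.
- by apply: smooth_measurable; case: tphi.
Qed.

(** The initial state of the deformation, with [S] the identity. The Borel core E0 has the same
    distributional gradient as E since they differ by a null set. *)
Lemma grad_rep_BV E E0 : lebesgue_measurable E -> measurable E0 -> E0 `<=` E ->
  vol (E `\` E0) = 0 -> BV (\1_E : 'rV[R]_n -> R) ->
  grad_rep E0 (grad_variation (\1_E)) id
    (polar_density (distributional_gradient (\1_E : 'rV[R]_n -> R))).
Proof.
move=> mE mE0 sub null bv; split => //; first by move=> i; exact: integrable_polar.
move=> phi tphi i.
have := distributional_gradientP bv tphi i.
rewrite (integral_indic_core mE mE0 sub null); last first.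
  by apply: smooth_measurable; case: (test_partial i tphi).
by move=> ->; rewrite integral_charge_polar.
Qed.

(** The images under S of the charges g_i mu satisfy the integration by parts, so the indicator is
    in BV. The gradient picked by choice coincides with them because test functions separate
    charges. Cancellation under S can only lower the variation, hence an inequality. *)
Lemma BV_grad_rep E (mu : {finite_measure set 'rV[R]_n -> \bar R}) S g :
  measurable E -> leb E < +oo -> grad_rep E mu S g ->
  BV (\1_E : 'rV[R]_n -> R) /\ forall u,
    directional_variation (\1_E) u <= \int[mu]_z `|\sum_i u ord0 i * g i z|%:E.
Proof.
move=> mE Eoo [mS ig rep].
have mEc := borel_lebesgue mE.
have null : vol (E `\` E) = 0 by rewrite setDv measure0.
pose D' i : {charge set 'rV[R]_n -> \bar R} := pushforward (induced_charge (ig i)) S.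
pose D i : {charge set 'rV[R]_n -> \bar R} := D' mS i.
have DE i A : measurable A -> D i A = \int[mu]_(z in S @^-1` A) (g i z)%:E by [].
have ic i phi : test_function phi ->
    integral_charge (D i) phi = \int[mu]_z (phi (S z) * g i z)%:E.
  move=> tphi; have [M M0 phiM] := test_bounded tphi.
  apply: (integral_charge_density (M := M)) => //.
  by apply: smooth_measurable; case: tphi.
have gradD : is_distributional_gradient (\1_E : 'rV[R]_n -> R) D.
  move=> phi tphi i; rewrite (integral_indic_core mEc mE (@subset_refl _ E) null).
    by rewrite rep// ic.
  by apply: smooth_measurable; case: (test_partial i tphi).
have bv : BV (\1_E : 'rV[R]_n -> R).
  split; last by exists D.
  apply/integrableP; split.
    by apply/measurable_EFinP; exact: borel_measurable_cara (measurable_indic mE).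
  have e : \int[vol]_x `|(EFin \o \1_E) x| = \int[vol]_x (\1_E x)%:E.
    by apply: eq_integral => x _; rewrite /= ger0_norm.
  rewrite e integral_vol; last exact: measurable_indic.
  by rewrite integral_indic// setIT.
split => // u; rewrite directional_variationE.
apply: (polar_variation_le u mS ig) => i A mA; transitivity (D i A); last exact: DE.
apply: charge_test_unique mA => phi tphi.
apply: oppe_inj; rewrite -(gradD phi tphi i).
by rewrite (distributional_gradientP bv tphi i).
Qed.

End bounded_variation.

(** * Affine perimeter *)

Section ereal_inverse.
Context {R : realType}.
Local Open Scope ereal_scope.
Implicit Types x y : \bar R.

Lemma le_inve x y : 0 <= x -> x <= y -> y^-1 <= x^-1.
Proof.
case: (inveP x) => [_ _||//|r r0]; first by rewrite leey.
  by move=> _; rewrite leye_eq => /eqP ->; rewrite invey.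
case: (inveP y) => [||//|s s0]; rewrite !lee_fin.
- by move=> r1 r2; case/eqP: r0; apply/eqP; rewrite eq_le r1 r2.
- by move=> r1 _; rewrite invr_ge0.
- move=> r1 rs; rewrite lef_pV2// posrE lt_neqAle eq_sym.
    by rewrite s0 (le_trans r1 rs).
  by rewrite r0 r1.
Qed.

Lemma le_expe x y n : 0 <= x -> x <= y -> x ^+ n <= y ^+ n.
Proof.
move=> x0 xy; elim: n => [|n ih]; first by rewrite !expe0.
by rewrite !expeS; apply: lee_pmul => //; exact: expe_ge0.
Qed.

(** The integral of a nonnegative function is the supremum over the simple functions below it, and a
    larger integrand admits more of them. In this form integrands can be compared without
    measurability proofs. *)
Lemma ge0_integral_mono d (T : measurableType d) (mu : {measure set T -> \bar R})
    (D : set T) (f g : T -> \bar R) : (forall z, D z -> 0 <= f z) ->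
  (forall z, D z -> f z <= g z) -> \int[mu]_(x in D) f x <= \int[mu]_(x in D) g x.
Proof.
move=> f0 fg; have g0 z : D z -> 0 <= g z by move=> Dz; exact: le_trans (f0 _ Dz) (fg _ Dz).
rewrite !ge0_integralE//; apply: le_ereal_sup => _ [h hf <-]; exists h => // z.
by apply: le_trans (hf z) _; rewrite !patchE; case: ifPn => // /set_mem; exact: fg.
Qed.

End ereal_inverse.

(** * Volume of the ball and area of the sphere *)

Section sphere.
Context {R : realType} {m : nat}.
Let n := m.+1.
Local Notation leb := (lebesgue_rV n).
Local Notation sphere := (@unit_sphere R n).
Local Notation uball := (@unit_ball R n).
Local Open Scope ereal_scope.

Lemma measurable_unit_sphere : measurable sphere.
Proof.
rewrite (_ : sphere = setT `&` @enorm R n @^-1` [set 1%R]).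
  exact: measurable_enorm.
by rewrite setTI.
Qed.

Lemma unit_sphere_coord (u : 'rV[R]_n) i : sphere u -> (`|u ord0 i| <= 1)%R.
Proof. by move=> /= <-; exact: coord_le_enorm. Qed.

(** The Euclidean norm 1 is at most the sum of the |u_j|, hence at most n times the largest. *)
Lemma unit_sphere_max (u : 'rV[R]_n) : sphere u ->
  exists i, [/\ (n%:R^-1 <= `|u ord0 i|)%R & forall j, (`|u ord0 j| <= `|u ord0 i|)%R].
Proof.
move=> u1; pose i := [arg max_(i > (ord0 : 'I_n)) (`|u ord0 i|)%R]%O.
have imax j : (`|u ord0 j| <= `|u ord0 i|)%R.
  by rewrite /i; case: Order.TotalTheory.arg_maxP => // k _; apply.
exists i; split => //.
rewrite -(@ler_pM2l _ n%:R) ?ltr0n// mulfV ?pnatr_eq0//.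
apply: (@le_trans _ _ (enorm u)); first by rewrite u1.
apply: le_trans (enorm_le u) _.
apply: (@le_trans _ _ (\sum_(j < n) `|u ord0 i|)%R); first exact: ler_sum.
by rewrite sumr_const card_ord mulr_natl.
Qed.

Lemma enorm_scale (c : R) (x : 'rV[R]_n) : enorm (c *: x) = (`|c| * enorm x)%R.
Proof.
rewrite /enorm -sqrtr_sqr -sqrtrM ?sqr_ge0//; congr Num.sqrt.
rewrite /dotr mulr_sumr; apply: eq_bigr => i _; rewrite !mxE; ring.
Qed.

Lemma enorm_eq0 (x : 'rV[R]_n) : enorm x = 0%R -> x = 0%R.
Proof.
move=> x0; apply/rowP => i; rewrite mxE; apply/eqP; rewrite -normr_eq0 eq_le normr_ge0 andbT.
by rewrite -x0 coord_le_enorm.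
Qed.

Let measurable_origin : measurable [set 0%R : 'rV[R]_n].
Proof.
rewrite (_ : [set 0%R] = setT `&` @enorm R n @^-1` [set 0%R]); first exact: measurable_enorm.
rewrite setTI; apply/seteqP; split => x /=; first by move=> ->; exact: enorm0.
exact: enorm_eq0.
Qed.

(** The set contains ]0, 1/n[^n and lies in ]-2, 2[^n. The origin is removed because [normalize]
    sends it to 0, off the sphere: the area of the sphere is n times this volume. *)
Lemma lebesgue_punctured_ball : exists2 r : R, (0 < r)%R & leb (uball `&` ~` [set 0%R]) = r%:E.
Proof.
have mB : measurable uball by exact: measurable_unit_ball.
have mD : measurable (uball `&` ~` [set 0%R : 'rV[R]_n]).
  by apply: measurableI => //; apply: measurableC; exact: measurable_origin.
pose v := leb (uball `&` ~` [set 0%R]).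
have voo : v < +oo.
  apply: le_lt_trans (@lebesgue_rV_box_lty R n (fun=> (- 2)%R) (fun=> 2%R)).
  apply: le_measure; rewrite ?inE//; first exact: measurable_box.
  move=> x [xB _] i; rewrite -ltr_norml; apply: le_lt_trans (coord_le_enorm _ _) _.
  by apply: le_lt_trans xB _; rewrite ltr1n.
have v0 : 0 < v.
  apply: (@lt_le_trans _ _ (leb (box (fun=> 0%R) (fun=> n%:R^-1%R)))).
    rewrite lebesgue_rV_box; elim/big_ind : _ => [//|x y|i _]; first exact: mule_gt0.
    by rewrite lebesgue_measure_itv/= lte_fin invr_gt0 ltr0n/= sube0 lte_fin invr_gt0 ltr0n.
  apply: le_measure; rewrite ?inE//; first exact: measurable_box.
  move=> x xb; split.
    apply: le_trans (enorm_le x) _; apply: (@le_trans _ _ (\sum_(j < n) n%:R^-1)%R).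
      by apply: ler_sum => i _; have /andP[x0 x1] := xb i; rewrite gtr0_norm// ltW.
    by rewrite sumr_const card_ord -(mulr_natl n%:R^-1%R n) mulfV// pnatr_eq0.
  move=> /= x0; have /andP[+ _] := xb ord0.
  by rewrite x0 mxE ltxx.
exists (fine v); last by rewrite fineK// ge0_fin_numE// ltW.
by rewrite fine_gt0// v0.
Qed.

Lemma surface_measure_sphere : exists2 r : R, (0 < r)%R & @surface_measure R n sphere = r%:E.
Proof.
have [r r0 rE] := lebesgue_punctured_ball; exists (n%:R * r)%R; first by rewrite mulr_gt0// ltr0n.
rewrite surface_measureE EFinM -rE; congr (_ * leb _).
apply/seteqP; split => x /=.
  move=> [x1 xB]; split => // x0; move: x1; rewrite /unit_sphere /normalize /= x0 scaler0 enorm0 => /esym/eqP.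
  by rewrite oner_eq0.
move=> [xB x0]; split => //; rewrite /unit_sphere /normalize /= enorm_scale.
rewrite ger0_norm ?invr_ge0 ?enorm_ge0// mulVf//.
by apply/eqP => /enorm_eq0.
Qed.

Lemma omega_pos : exists2 r : R, (0 < r)%R & @omega R n = r%:E.
Proof.
have mB : measurable uball by exact: measurable_unit_ball.
have [r r0 rE] := lebesgue_punctured_ball.
have E : @omega R n = leb (uball) by exact: vol_borel.
have oo : leb (uball) < +oo.
  apply: le_lt_trans (@lebesgue_rV_box_lty R n (fun=> (- 2)%R) (fun=> 2%R)).
  apply: le_measure; rewrite ?inE//; first exact: measurable_box.
  move=> x xB i; rewrite -ltr_norml; apply: le_lt_trans (coord_le_enorm _ _) _.
  by apply: le_lt_trans xB _; rewrite ltr1n.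
exists (fine (leb (uball))); last by rewrite E fineK// ge0_fin_numE.
rewrite fine_gt0// oo andbT; apply: (@lt_le_trans _ _ r%:E); first by rewrite lte_fin.
rewrite -rE; apply: le_measure; rewrite ?inE//.
by apply: measurableI => //; apply: measurableC; exact: measurable_origin.
Qed.

End sphere.

(** * Monotonicity and homogeneity of the affine norm *)

Section affine_norm.
Context {R : realType} {m : nat}.
Let n := m.+1.
Local Notation sphere := (@unit_sphere R n).
Local Notation surf := (@surface_measure R n).
Implicit Types (f : 'rV[R]_n -> R) (u : 'rV[R]_n).
Local Open Scope ereal_scope.

Lemma directional_variation_ge0 f u : 0 <= directional_variation f u.
Proof. by apply: integral_ge0 => x _; rewrite lee_fin. Qed.

Lemma measurable_directional_variation f :
  measurable_fun setT (directional_variation f).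
Proof.
pose D := distributional_gradient f.
pose h (p : 'rV[R]_n * 'rV[R]_n) := `|\sum_i p.1 ord0 i * polar_density D i p.2|%:E.
have mh : measurable_fun setT h.
  apply/measurable_EFinP; apply: measurableT_comp => //.
  apply: measurable_sum => i; apply: measurable_funM.
    by apply: (measurableT_comp (measurable_rV_coord i)); exact: measurable_fst.
  have mp : measurable_fun setT (polar_density D i).
    by apply/measurable_EFinP; exact: (measurable_int _ (integrable_polar D i)).
  by apply: (measurableT_comp mp); exact: measurable_snd.
have h0 p : 0 <= h p by rewrite lee_fin.
have := measurable_fun_fubini_tonelli_F (m2 := grad_variation f) h mh h0.
by apply: eq_measurable_fun => u _; rewrite directional_variationE.
Qed.

Let G f u := (directional_variation f u ^+ n)^-1 / (n%:R%:E * @omega R n).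

Lemma affine_BV_normE f :
  affine_BV_norm f = ((\int[surf]_(u in sphere) G f u) `^ n%:R^-1)^-1.
Proof. by []. Qed.

Let nomega : exists2 K : R, (0 < K)%R & n%:R%:E * @omega R n = K%:E.
Proof.
have [r r0 rE] := @omega_pos R m.
by exists (n%:R * r)%R; rewrite ?rE// mulr_gt0// ltr0n.
Qed.

Let integral_sphere_cst (c : R) : exists2 s : R, (0 < s)%R &
  \int[surf]_(u in sphere) c%:E = (c * s)%:E.
Proof.
have [s s0 sE] := @surface_measure_sphere R m.
exists s => //; rewrite (integral_cst _ measurable_unit_sphere) EFinM.
by congr (_ * _); exact: sE.
Qed.

Lemma affine_BV_norm_lty f (C : R) : (0 < C)%R ->
  (forall u, sphere u -> directional_variation f u <= C%:E) ->
  affine_BV_norm f < +oo.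
Proof.
move=> C0 fC; rewrite affine_BV_normE.
have [K K0 KE] := nomega.
have [s s0 sE] := integral_sphere_cst ((C ^+ n)^-1 * K^-1)%R.
rewrite ltey inve_eqy gt_eqF// poweR_gt0//.
apply: (@lt_le_trans _ _ (((C ^+ n)^-1 * K^-1) * s)%:E).
  by rewrite lte_fin !mulr_gt0// invr_gt0// exprn_gt0.
rewrite -sE; apply: ge0_integral_mono => u uS.
  by rewrite lee_fin mulr_ge0// invr_ge0 ?exprn_ge0// ltW.
rewrite /G KE EFinM inver (gt_eqF K0) lee_wpmul2r//.
  by rewrite lee_fin invr_ge0 ltW.
have -> : ((C ^+ n)^-1)%:E = (C%:E ^+ n)^-1.
  by rewrite -EFin_expe inver gt_eqF// exprn_gt0.
apply: le_inve; first by apply: expe_ge0; exact: directional_variation_ge0.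
apply: le_expe; [exact: directional_variation_ge0|exact: fC].
Qed.

(** The norm is monotone and 1-homogeneous in the directional variations. The bounds c and C keep
    the integral of their powers of exponent -n in ]0, +oo[, so that the norm of [f] is a positive
    real, away from the conventions at 0 and +oo. *)
Lemma affine_BV_norm_scale f f' (k c C : R) : (0 < k)%R -> (0 < c)%R ->
  (forall u, sphere u -> c%:E <= directional_variation f u) ->
  (forall u, sphere u -> directional_variation f u <= C%:E) ->
  (forall u, sphere u -> directional_variation f' u <= k%:E * directional_variation f u) ->
  exists p : R, [/\ (0 < p)%R, affine_BV_norm f = p%:E & affine_BV_norm f' <= (k * p)%:E].
Proof.
move=> k0 c0 fc fC ff'; have [K K0 KE] := nomega.
pose h u := fine (directional_variation f u).
have hE u : sphere u -> directional_variation f u = (h u)%:E.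
  move=> uS; rewrite /h fineK// ge0_fin_numE ?directional_variation_ge0//.
  by apply: le_lt_trans (fC u uS) _; exact: ltry.
have hc u : sphere u -> (c <= h u)%R.
  by move=> uS; rewrite -lee_fin -hE//; exact: fc.
have hC u : sphere u -> (h u <= C)%R.
  by move=> uS; rewrite -lee_fin -hE//; exact: fC.
have h0 u : sphere u -> (0 < h u)%R by move=> /hc; exact: lt_le_trans.
have GE u : sphere u -> G f u = ((h u ^+ n)^-1 * K^-1)%:E.
  move=> uS; rewrite /G KE hE// -EFin_expe !inver (gt_eqF K0).
  by rewrite gt_eqF// exprn_gt0// h0.
have G0 u : sphere u -> 0 <= G f u.
  move=> uS; rewrite GE// lee_fin mulr_ge0// invr_ge0 ?exprn_ge0//; last exact: ltW.
  exact/ltW/h0.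
have mG : measurable_fun sphere (G f).
  have : measurable_fun sphere (fun u => ((h u `^ (- n%:R)) * K^-1)%R%:E).
    apply/measurable_EFinP; apply: measurable_funM => //.
    apply: (@measurableT_comp _ _ _ _ _ _ (fun x : R => x `^ (- n%:R))%R).
      exact: measurable_powR.
    apply: (measurableT_comp (fine_measurable (@measurableT _ _))).
    exact: measurable_funTS (measurable_directional_variation f).
  apply: eq_measurable_fun => u /set_mem uS; rewrite GE// powRN powR_mulrn//.
  exact/ltW/h0.
have [s s0 sE] := integral_sphere_cst ((c ^+ n)^-1 * K^-1)%R.
have [s' s'0 s'E] := integral_sphere_cst ((C ^+ n)^-1 * K^-1)%R.
have [u0 u0S] : exists u, sphere u.
  apply/not_existsP => no; have := @surface_measure_sphere R m => -[r r0 rE].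
  have sp0 : sphere = set0 by apply/seteqP; split => // x /no.
  by move: rE; rewrite sp0 measure0 => -[] r00; rewrite -r00 ltxx in r0.
have C0 : (0 < C)%R by apply: lt_le_trans (h0 _ u0S) (hC _ u0S).
have Ioo : \int[surf]_(u in sphere) G f u < +oo.
  apply: (@le_lt_trans _ _ (((c ^+ n)^-1 * K^-1) * s)%:E); last exact: ltry.
  rewrite -sE; apply: ge0_integral_mono => // u uS.
  rewrite GE// lee_fin ler_wpM2r ?invr_ge0 ?(ltW K0)//.
  rewrite lef_pV2 ?posrE ?exprn_gt0 ?h0//.
  by apply: lerXn2r; rewrite ?nnegrE ?(ltW c0) ?(ltW (h0 u uS)) ?hc.
have Igt0 : 0 < \int[surf]_(u in sphere) G f u.
  apply: (@lt_le_trans _ _ (((C ^+ n)^-1 * K^-1) * s')%:E).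
    by rewrite lte_fin !mulr_gt0// invr_gt0// exprn_gt0.
  rewrite -s'E; apply: ge0_integral_mono => u uS.
    by rewrite lee_fin mulr_ge0// invr_ge0 ?exprn_ge0// ltW.
  rewrite GE// lee_fin ler_wpM2r ?invr_ge0 ?(ltW K0)//.
  rewrite lef_pV2 ?posrE ?exprn_gt0 ?h0//.
  by apply: lerXn2r; rewrite ?nnegrE ?(ltW C0) ?(ltW (h0 u uS)) ?hC.
pose i := fine (\int[surf]_(u in sphere) G f u).
have iE : \int[surf]_(u in sphere) G f u = i%:E.
  by rewrite fineK// ge0_fin_numE// ltW.
have i0 : (0 < i)%R by rewrite -lte_fin -iE.
have n0 : (n%:R != 0 :> R)%R by rewrite pnatr_eq0.
exists ((i `^ n%:R^-1)^-1)%R; split.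
- by rewrite invr_gt0 powR_gt0.
- by rewrite affine_BV_normE iE poweR_EFin inver gt_eqF// powR_gt0.
have ki0 : 0 <= (k^-1 ^+ n)%:E :> \bar R by rewrite lee_fin exprn_ge0// invr_ge0 ltW.
have I' : (k^-1 ^+ n)%:E * i%:E <= \int[surf]_(u in sphere) G f' u.
  rewrite -iE -(ge0_integralZl _ measurable_unit_sphere mG G0 ki0).
  apply: ge0_integral_mono => u uS.
    by rewrite mule_ge0 ?G0// lee_fin exprn_ge0// invr_ge0 ltW.
  rewrite GE// -EFinM mulrA -exprVn -exprMn -invfM.
  rewrite /G KE EFinM (inver K) (gt_eqF K0) lee_wpmul2r//.
    by rewrite lee_fin invr_ge0 ltW.
  have kh : (0 < k * h u)%R by rewrite mulr_gt0// h0.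
  have -> : (((k * h u)^-1) ^+ n)%:E = ((k * h u)%:E ^+ n)^-1.
    by rewrite -EFin_expe inver gt_eqF ?exprn_gt0// exprVn.
  apply: le_inve; first by apply: expe_ge0; exact: directional_variation_ge0.
  apply: le_expe; first exact: directional_variation_ge0.
  by rewrite EFinM -hE//; exact: ff'.
rewrite affine_BV_normE.
have -> : (k * (i `^ n%:R^-1)^-1)%:E = (((k^-1 ^+ n)%:E * i%:E) `^ n%:R^-1)^-1.
  rewrite -EFinM poweR_EFin powRM; [|by rewrite exprn_ge0// invr_ge0 ltW|exact: ltW].
  rewrite -powR_mulrn ?invr_ge0 ?ltW// -powRrM mulfV// powRr1 ?invr_ge0 ?ltW//.
  rewrite inver gt_eqF ?mulr_gt0 ?invr_gt0 ?powR_gt0//.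
  by rewrite invfM invrK.
apply: le_inve; first exact: poweR_ge0.
apply: gt0_ler_poweR; last exact: I'.
- by rewrite invr_ge0.
- by rewrite in_itv/= leey andbT mule_ge0// lee_fin ltW.
- by rewrite in_itv/= leey andbT (le_trans _ I')// mule_ge0// lee_fin ltW.
Qed.

End affine_norm.

(** * Finiteness of the affine Cheeger constant *)

Section affine_cheeger_finite.
Context {R : realType} {m : nat}.
Let n := m.+1.
Local Notation leb := (lebesgue_rV n).
Local Open Scope ereal_scope.
Implicit Types (a b : 'I_n -> R).

Lemma directional_variation_bounded (f : 'rV[R]_n -> R) : exists2 C : R, (0 < C)%R &
  forall u, unit_sphere u -> directional_variation f u <= C%:E.
Proof.
pose D := distributional_gradient f.
pose I i := \int[grad_variation f]_x `|(EFin \o polar_density D i) x|.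
have Ifin i : I i \is a fin_num.
  apply: integrable_fin_num => //; apply: integrable_abse; exact: integrable_polar.
have I0 i : 0 <= I i by exact: integral_ge0.
exists (1 + \sum_i fine (I i))%R.
  by apply: ltr_wpDr => //; apply: sumr_ge0 => i _; exact: fine_ge0.
move=> u uS; rewrite directional_variationE.
apply: (@le_trans _ _ (\int[grad_variation f]_x \sum_i `|(EFin \o polar_density D i) x|)).
  apply: ge0_integral_mono => x _; first by rewrite lee_fin.
  rewrite /= sumEFin lee_fin; apply: le_trans (ler_norm_sum _ _ _) _.
  by apply: ler_sum => i _; rewrite normrM ler_piMl// unit_sphere_coord.
rewrite ge0_integral_sum//; last first.
  by move=> i; apply: measurableT_comp => //; exact: measurable_int (integrable_polar D i).
rewrite EFinD -sumEFin.
have -> : \sum_(i < n) (fine (I i))%:E = \sum_(i < n) I i.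
  by apply: eq_bigr => i _; rewrite fineK.
by rewrite leeDr.
Qed.

Lemma integral_rV_ins (k : 'I_n) (f : 'rV[R]_n -> \bar R) : leb.-integrable setT f ->
  \int[leb]_x f x = \int[lebesgue_rV m]_v \int[lebesgue_measure]_s f (ins k s v).
Proof.
move=> fi; have mi := @measurable_insp R m k.
have [mf foo] := integrableP _ _ _ fi.
have IE (g : 'rV[R]_n -> \bar R) : \int[leb]_x g x =
    \int[pushforward (lebesgue_measure \x lebesgue_rV m) (insp k)]_x g x.
  by apply: eq_measure_integral => ? A mA; exact: lebesgue_rV_ins.
have fi2 : (lebesgue_measure \x lebesgue_rV m).-integrable setT (f \o insp k).
  apply/integrableP; split; first exact: measurableT_comp.
  apply: le_lt_trans foo; rewrite IE.
  by rewrite ge0_integral_pushforward ?preimage_setT//; exact: measurableT_comp.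
rewrite IE integral_pushforward ?preimage_setT//.
by rewrite -(integral21_prod_meas1 fi2).
Qed.

Lemma integral_partial_line (k : 'I_n) phi (v : 'rV[R]_m) (c d : R) : smooth phi -> (c < d)%R ->
  \int[lebesgue_measure]_(s in `]c, d[) (partial k phi (ins k s v))%:E =
  (phi (ins k d v) - phi (ins k c v))%:E.
Proof.
move=> sphi cd; pose f s := partial k phi (ins k s v).
have cf : continuous f.
  move=> s; apply: (@continuous_comp _ _ _ (fun r => ins k r v) (partial k phi)).
    exact: continuous_ins.
  exact/smooth_continuous/smooth_partial.
pose F s := phi (ins k s v).
have dF (s : R) : is_derive s 1%R F (f s).
  have h := @is_derive_line _ _ phi (delta_mx ord0 k) (ins k 0%R v) s (smooth_diff _ sphi).
  have -> : F = fun r => phi (ins k 0%R v + r *: delta_mx ord0 k)%R.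
    by apply/funext => r; rewrite /F [ins k r v]ins_line.
  by rewrite /f [ins k s v]ins_line; exact: h.
have cF : continuous F.
  by move=> s; apply/differentiable_continuous/derivable1_diffP; have [] := dF s.
transitivity (\int[lebesgue_measure]_(s in `[c, d]) (f s)%:E).
  symmetry; apply: integral_itv_bndoo; apply/measurable_EFinP.
  by apply: measurable_funTS; exact: continuous_measurable_fun.
rewrite (@continuous_FTC2 _ f F)//.
- exact: continuous_subspaceT.
- split; first by move=> s _; have [] := dF s.
  + by apply: cvg_at_right_filter; exact: cF.
  + by apply: cvg_at_left_filter; exact: cF.
- by move=> s _; rewrite derive1E; have [_ ->] := dF s.
Qed.

(** The area measure of the face x_k = c of a box, as the image of Lebesgue measure restricted to
    the projection of the box along e_k. Such faces carry the gradient of the indicator of the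
    box. *)
Lemma face_measure (k : 'I_n) (c : R) a b : exists mu : {finite_measure set 'rV[R]_n -> \bar R},
  forall phi, test_function phi -> \int[mu]_x (phi x)%:E =
  \int[lebesgue_rV m]_(v in box (a \o lift k) (b \o lift k)) (phi (ins k c v))%:E.
Proof.
set B := box _ _; have mB : measurable B by exact: measurable_box.
have iB : (lebesgue_rV m).-integrable setT (EFin \o (\1_B : 'rV[R]_m -> R)).
  apply/integrableP; split; first by apply/measurable_EFinP; exact: measurable_indic.
  under eq_integral do rewrite /= ger0_norm//.
  by rewrite integral_indic// setIT; exact: lebesgue_rV_box_lty.
have B0 v : (0 <= (\1_B : 'rV[R]_m -> R) v)%R by [].
have mc : measurable_fun setT (ins k c : 'rV[R]_m -> 'rV[R]_n).
  exact: (measurableT_comp (measurable_insp k) (pair1_measurable c)).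
pose mu : {finite_measure set 'rV[R]_n -> \bar R} :=
  density_image (lebesgue_rV m) (\1_B : 'rV[R]_m -> R) (ins k c).
exists (mu iB B0 mc) => phi tphi; have [M M0 phiM] := test_bounded tphi.
have mphi : measurable_fun setT phi by apply: smooth_measurable; case: tphi.
transitivity (\int[lebesgue_rV m]_v (phi (ins k c v) * \1_B v)%:E).
  exact: (integral_density_image iB B0 mc mphi phiM).
rewrite [RHS]integral_mkcond; apply: eq_integral => v _.
by rewrite patchE indicE; case: ifPn => _; rewrite ?mulr1 ?mulr0.
Qed.

(** Fubini and the fundamental theorem of calculus in direction e_k: the k-th derivative is the
    measure of the face x_k = a_k minus that of the face x_k = b_k. *)
Lemma BV_box a b : (forall i, a i < b i)%R -> BV (\1_(box a b) : 'rV[R]_n -> R).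
Proof.
move=> ab; have mbox := measurable_box a b.
have boxoo := lebesgue_rV_box_lty a b.
split.
  apply/integrableP; split.
    by apply/measurable_EFinP; exact: borel_measurable_cara (measurable_indic mbox).
  have e : \int[vol]_x `|(EFin \o \1_(box a b)) x| = \int[vol]_x (\1_(box a b) x)%:E.
    by apply: eq_integral => x _; rewrite /= ger0_norm.
  rewrite e integral_vol; last exact: measurable_indic.
  by rewrite integral_indic// setIT.
have [ma maE] := boolp.choice (fun k => face_measure k (a k) a b).
have [mb mbE] := boolp.choice (fun k => face_measure k (b k) a b).
exists (fun k => cadd (charge_of_finite_measure (ma k))
  (cscale (-1) (charge_of_finite_measure (mb k)))) => phi tphi k.
have [sphi _] := tphi; have mphi := smooth_measurable sphi.
have [M M0 phiM] := test_bounded tphi.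
have sp := smooth_partial k sphi; have mp := smooth_measurable sp.
have [N N0 pN] := test_bounded (test_partial k tphi).
have null : vol (box a b `\` box a b) = 0 by rewrite setDv measure0.
rewrite (integral_indic_core (borel_lebesgue mbox) mbox (@subset_refl _ _) null mp).
rewrite (@integral_chargeE _ _ _ _ (ma k) (mb k) phi M _ mphi phiM); last first.
  move=> A mA; transitivity (ma k A + (-1)%:E * mb k A); first by [].
  by rewrite EFinN mulN1e.
rewrite maE// mbE//.
set B := box (a \o lift k) _.
have mB : measurable B by exact: measurable_box.
have ic c : (lebesgue_rV m).-integrable B (EFin \o (fun v => phi (ins k c v))).
  apply: measurable_bounded_integrable => //; first exact: lebesgue_rV_box_lty.
    apply: measurable_funTS; apply: (measurableT_comp mphi).
    exact: (measurableT_comp (measurable_insp k) (pair1_measurable c)).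
  exists M; split; first exact: num_real.
  by move=> x Mx v _; apply: le_trans (phiM _) (ltW Mx).
have fin c : \int[lebesgue_rV m]_(v in B) (phi (ins k c v))%:E \is a fin_num.
  exact: integrable_fin_num (ic c).
rewrite fin_num_oppeB// addeC -integralB_EFin//.
rewrite [LHS]integral_mkcond.
have ib : leb.-integrable setT ((fun x => (partial k phi x)%:E) \_ (box a b)).
  by apply/(integrable_mkcond _ mbox); exact: integrable_bounded_set pN.
apply: (etrans (integral_rV_ins k ib)).
rewrite [RHS]integral_mkcond; apply: eq_integral => v _.
rewrite [RHS]patchE; case: ifPn => vB.
  rewrite -EFinB -integral_partial_line// [RHS]integral_mkcond.
  apply: eq_integral => s _; rewrite !patchE.
  suff -> : (ins k s v \in box a b) = (s \in `]a k, b k[%classic) by [].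
  have := insp_box k a b => /seteqP[h1 h2].
  apply/idP/idP; rewrite !inE => h.
    by have [] := h1 (s, v) h.
  by apply: (h2 (s, v)); split => //; move: vB; rewrite inE.
apply: integral0_eq => s _; rewrite patchE ifF//; apply/negbTE; apply: contra vB.
rewrite !inE => h; have /seteqP[h1 _] := insp_box k a b.
by have [] := h1 (s, v) h.
Qed.

(** A small box inside O is a competitor whose indicator is in BV. Finiteness of the infimum later
    excludes a minimizer of perimeter +oo. *)
Lemma affine_cheeger_lty (q : R) (O : set 'rV[R]_n) : open O -> O !=set0 ->
  affine_cheeger q O < +oo.
Proof.
move=> oO [x Ox].
have /nbhs_ballP[e /= e0 eO] : nbhs x O by exact: open_nbhs_nbhs.
pose a i := (x ord0 i - e / 2)%R; pose b i := (x ord0 i + e / 2)%R.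
have ab i : (a i < b i)%R by rewrite /a /b; lra.
have mbox := measurable_box a b.
have bO : box a b `<=` O.
  move=> y yb; apply: eO; rewrite -ball_normE /ball_/=.
  apply: (@le_lt_trans _ _ (e / 2)%R); last by lra.
  apply/rV_norm_le => [|i]; first by lra.
  by have := yb i; rewrite /a /b !mxE ler_norml => /andP[? ?]; apply/andP; split; lra.
have bpos : 0 < leb (box a b).
  rewrite lebesgue_rV_box; elim/big_ind : _ => [//|y z|i _]; first exact: mule_gt0.
  by rewrite lebesgue_measure_itv/= lte_fin ab -EFinB lte_fin subr_gt0.
have volb : vol (box a b) = leb (box a b) by exact: vol_borel.
have boo := lebesgue_rV_box_lty a b.
apply: (@le_lt_trans _ _ (affine_perimeter (box a b) / vol (box a b) `^ q^-1)).
  apply: ereal_inf_lbound; exists (box a b) => //; split => //.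
    exact: borel_lebesgue.
  by rewrite volb.
rewrite volb /affine_perimeter; case: pselect => [bv|nbv]; last by case: nbv; exact: BV_box.
have [C C0 hC] := directional_variation_bounded (\1_(box a b) : 'rV[R]_n -> R).
have lt := affine_BV_norm_lty C0 hC.
have -> : leb (box a b) = (fine (leb (box a b)))%:E.
  by rewrite fineK// ge0_fin_numE// ltW.
have p0 : (0 < fine (leb (box a b)))%R by rewrite fine_gt0// bpos.
rewrite poweR_EFin inver gt_eqF ?powR_gt0//.
case: (affine_BV_norm _) lt => [r|//|] _; first by rewrite -EFinM ltry.
by rewrite mulNyr gtr0_sg ?mul1e// invr_gt0 powR_gt0.
Qed.

End affine_cheeger_finite.

(** * Dilation of a minimizer *)

Section tails.
Context {R : realType} {n : nat}.
Local Open Scope ereal_scope.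

Lemma measurable_outside (r : R) : measurable [set x : 'rV[R]_n | (r < `|x|)%R].
Proof.
have mN : measurable_fun setT (fun x : 'rV[R]_n => `|x|%R : R).
  by apply: continuous_measurable_rV; exact: norm_continuous.
have := mN measurableT `]r, +oo[%classic (measurable_itv _); rewrite setTI.
by congr measurable; apply/seteqP; split => x /=; rewrite in_itv/= andbT.
Qed.

(** Dominated convergence for the restrictions to |x| > k; the tails decrease in r, so one good k
    serves all larger radii. *)
Lemma integral_tail (mu : {measure set 'rV[R]_n -> \bar R}) (g : 'rV[R]_n -> R) :
  mu.-integrable setT (EFin \o g) -> (forall x, 0 <= g x)%R ->
  forall e : R, (0 < e)%R -> exists N : R, forall r, (N <= r)%R ->
  \int[mu]_(x in [set x | (r < `|x|)%R]) (g x)%:E <= e%:E.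
Proof.
move=> ig g0 e e0; have mg := measurable_int _ ig.
pose out (r : R) := [set x : 'rV[R]_n | (r < `|x|)%R].
pose f (k : nat) := (EFin \o g) \_ (out k%:R).
have h1 k : measurable_fun setT (f k).
  by apply/(measurable_restrictT _ (measurable_outside _)); exact: measurable_funTS.
have h2 : measurable_fun setT (cst 0 : 'rV[R]_n -> \bar R) by [].
have h3 : {ae mu, forall x, setT x -> f ^~ x @ \oo --> cst 0 x}.
  apply: aeW => x _; apply: cvg_near_cst; near=> k.
  rewrite /f patchE ifF//; apply/negbTE; rewrite notin_setE /out /=.
  by apply/negP; rewrite -leNgt; near: k; exact: nbhs_infty_ger.
have h4 : {ae mu, forall x k, setT x -> `|f k x| <= (EFin \o g) x}.
  apply: aeW => x k _; rewrite /f patchE; case: ifPn => _.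
    by rewrite /= lee_fin ger0_norm.
  by rewrite abse0 lee_fin.
have [_ _] := dominated_convergence measurableT h1 h2 h3 ig h4.
rewrite integral0 => lim.
have : nbhs (0 : \bar R) [set y | y < e%:E].
  by apply: open_nbhs_nbhs; split; [exact: open_ereal_lt_ereal|rewrite /= lte_fin].
move=> /lim [k _ /(_ k (leqnn k))] /= lt.
exists k%:R => r kr; apply: le_trans (ltW lt).
rewrite /f -integral_mkcond; apply: ge0_subset_integral.
- exact: measurable_outside.
- exact: measurable_outside.
- exact: measurable_funTS.
- by move=> x _; rewrite /= lee_fin.
- by move=> x /=; exact: le_lt_trans.
Unshelve. all: by end_near. Qed.

Lemma lebesgue_tail (E : set 'rV[R]_n) : measurable E -> lebesgue_rV n E < +oo ->
  forall e : R, (0 < e)%R -> exists N : R, forall r, (N <= r)%R ->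
  lebesgue_rV n (E `&` [set x | (r < `|x|)%R]) <= e%:E.
Proof.
move=> mE Eoo e e0.
have iE : (lebesgue_rV n).-integrable setT (EFin \o (\1_E : 'rV[R]_n -> R)).
  apply/integrableP; split; first by apply/measurable_EFinP; exact: measurable_indic.
  under eq_integral do rewrite /= ger0_norm//.
  by rewrite integral_indic// setIT.
have [N hN] := integral_tail iE (fun x => ler0n _ _) e0.
exists N => r /hN; rewrite integral_indic//; exact: measurable_outside.
Qed.

End tails.

(** * Uniform lower bound on the directional variations *)

Section nondegenerate.
Context {R : realType} {m : nat}.
Let n := m.+1.
Local Notation leb := (lebesgue_rV n).
Local Open Scope ereal_scope.

(* Test against the compactly supported field r a_i(x/r), where the i-th coordinate
   of u is the largest one. *)
Lemma directional_lower_bound (E : set 'rV[R]_n)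
    (mu : {finite_measure set 'rV[R]_n -> \bar R}) g :
  measurable E -> 0 < leb E -> leb E < +oo -> grad_rep E mu id g ->
  exists2 c : R, (0 < c)%R & forall u, unit_sphere u ->
    c%:E <= \int[mu]_z `|\sum_i u ord0 i * g i z|%:E.
Proof.
move=> mE E0 Eoo [_ ig rep].
pose V := fine (leb E).
have VE : leb E = V%:E by rewrite fineK// ge0_fin_numE// ltW.
have V0 : (0 < V)%R by rewrite -lte_fin -VE.
have [C C0 hC] := @field_bounds R n.
(* Outside the ball |u_i - psi| is at most K |u_i|, so a tail of volume at most V / (2K) costs no
   more than half of the main term |u_i| V. The radius found in this way does not depend on u. *)
pose K := (n%:R * (C + 1))%R; have K0 : (0 < K)%R by rewrite mulr_gt0// ?ltr0n// addr_gt0.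
have d0 : (0 < V / 2 / K)%R by rewrite !divr_gt0.
have [N hN] := lebesgue_tail mE Eoo d0.
pose r : R := Num.max 1%R N.
have r0 : (0 < r)%R by rewrite lt_max ltr01.
have tail : leb (E `&` [set x | (r < `|x|)%R]) <= (V / 2 / K)%:E.
  by apply: hN; rewrite le_max lexx orbT.
have rC0 : (0 < r * C)%R by exact: mulr_gt0.
exists (n%:R^-1 * (V / 2) / (r * C))%R.
  by rewrite divr_gt0// mulr_gt0 ?divr_gt0// invr_gt0 ltr0n.
move=> u uS; have [i [ui umax]] := unit_sphere_max uS.
pose phi := scaled_field r i; have tphi : test_function phi by exact: test_scaled_field.
have [sphi _] := tphi.
(* The derivative of [phi] in the direction u. On the ball of radius r, where [phi] is the
   coordinate x_i, it equals u_i. *)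
pose psi x := (\sum_j u ord0 j * partial j phi x)%R.
pose h z := (\sum_j u ord0 j * g j z)%R.
have pC j x : (`|partial j phi x| <= C)%R.
  rewrite /phi partial_scaled_field ?gt_eqF//.
  by have [_] := hC i (r^-1 *: x)%R; exact.
have phiC x : (`|phi x| <= r * C)%R.
  rewrite /phi /scaled_field normrM (gtr0_norm r0) ler_pM2l//.
  by have [h1 _] := hC i (r^-1 *: x)%R.
have mp j : measurable_fun setT (partial j phi).
  by apply: smooth_measurable; exact: smooth_partial.
have ip j : leb.-integrable E (EFin \o partial j phi).
  by apply: (integrable_bounded_set mE Eoo (mp j)) => x; exact: pC.
have mphi := smooth_measurable sphi.
have ipg j : mu.-integrable setT (fun z => (phi z * g j z)%:E).
  exact: integrable_boundedM (ig j).
have psiE : \int[leb]_(x in E) (psi x)%:E = - \int[mu]_z (phi z * h z)%:E.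
  rewrite (integral_lin_comb u mE ip).
  have -> : \int[mu]_z (phi z * h z)%:E =
      \int[mu]_z (\sum_j u ord0 j * (phi z * g j z))%:E.
    apply: eq_integral => z _; congr EFin; rewrite /h mulr_sumr.
    by apply: eq_bigr => j _; rewrite mulrCA.
  rewrite (@integral_lin_comb _ _ _ _ mu setT u (fun j z => phi z * g j z)%R measurableT ipg).
  rewrite -sumeN; last first.
    move=> j k _ _; rewrite fin_num_adde_defl// fin_numM//.
    exact: integrable_fin_num (ipg k).
  by apply: eq_bigr => j _; rewrite (rep phi tphi j) muleN.
have psi_near x : (`|u ord0 i - psi x| <= `|u ord0 i| * K * \1_[set x | r < `|x|] x)%R.
  rewrite indicE; case: (boolP (x \in _)) => [_|].
    rewrite mulr1; apply: le_trans (ler_normB _ _) _.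
    apply: (@le_trans _ _ (`|u ord0 i| + \sum_(j < n) `|u ord0 i| * C)%R).
      rewrite lerD2l; apply: le_trans (ler_norm_sum _ _ _) _.
      by apply: ler_sum => j _; rewrite normrM ler_pM.
    rewrite sumr_const card_ord -mulr_natl /K.
    have n1 : (1 <= n%:R :> R)%R by rewrite ler1n.
    have -> : (`|u ord0 i| * (n%:R * (C + 1)) =
      `|u ord0 i| * n%:R + n%:R * (`|u ord0 i| * C))%R by ring.
    by rewrite lerD2r ler_peMr.
  rewrite notin_setE /= => /negP; rewrite -leNgt => xr.
  suff -> : psi x = u ord0 i by rewrite subrr normr0 mulr0.
  have xr3 : (`|x| < r * 3)%R.
    by apply: le_lt_trans xr _; rewrite ltr_pMr// ltr1n.
  rewrite /psi (bigD1 i)//= big1 ?addr0.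
    by rewrite /phi partial_scaled_field_small// eqxx mulr1.
  by move=> j /negbTE ji; rewrite /phi partial_scaled_field_small// ji mulr0.
have mpsi : measurable_fun setT psi.
  by apply: measurable_sum => j; apply: measurable_funM.
have ipsi : leb.-integrable E (EFin \o psi).
  apply: (integrable_bounded_set (M := (\sum_(j < n) C)%R) mE Eoo mpsi) => x.
  apply: le_trans (ler_norm_sum _ _ _) _; apply: ler_sum => j _.
  rewrite normrM -[leRHS]mul1r ler_pM//; exact: unit_sphere_coord.
have icst : leb.-integrable E (EFin \o cst (u ord0 i)).
  by apply: (integrable_bounded_set (M := `|u ord0 i|%R) mE Eoo).
have idiff : leb.-integrable E (EFin \o (fun x => u ord0 i - psi x)%R).
  have -> : EFin \o (fun x => u ord0 i - psi x)%R =
      (EFin \o cst (u ord0 i)) \- (EFin \o psi) by apply/funext => x; rewrite /= EFinB.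
  exact: integrableB.
have hle : `|\int[leb]_(x in E) (psi x)%:E| <= (r * C)%:E * \int[mu]_z `|h z|%:E.
  have mh : measurable_fun setT h.
    by apply/measurable_EFinP; exact: (measurable_int _ (integrable_lin_comb u ig)).
  rewrite psiE abseN; apply: le_trans (le_abse_integral _ _ _) _ => //.
    by apply/measurable_EFinP; exact: measurable_funM.
  rewrite -ge0_integralZl//; last 2 first.
  - by apply/measurable_EFinP; exact: measurableT_comp.
  - by rewrite lee_fin ltW.
  apply: ge0_integral_mono => z _; first exact: abse_ge0.
  by rewrite -EFinM lee_fin normrM ler_wpM2r.
have dle : `|\int[leb]_(x in E) (u ord0 i - psi x)%:E| <= (`|u ord0 i| * (V / 2))%:E.
  apply: le_trans (le_abse_integral _ mE _) _; first exact: measurable_int idiff.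
  pose out := [set x : 'rV[R]_n | (r < `|x|)%R].
  apply: (@le_trans _ _ (\int[leb]_(x in E) ((`|u ord0 i| * K)%:E * (\1_out x)%:E))).
    apply: ge0_integral_mono => x _; first exact: abse_ge0.
    by rewrite -EFinM lee_fin; exact: psi_near.
  have mo : measurable out by exact: measurable_outside.
  rewrite ge0_integralZl//; last 2 first.
  - by apply/measurable_EFinP; apply: measurable_funTS; exact: measurable_indic.
  - by rewrite lee_fin mulr_ge0// ltW.
  rewrite integral_indic// setIC.
  apply: (@le_trans _ _ ((`|u ord0 i| * K)%:E * (V / 2 / K)%:E)).
    by apply: lee_wpmul2l => //; rewrite lee_fin mulr_ge0// ltW.
  have -> : (`|u ord0 i| * (V / 2) = `|u ord0 i| * K * (V / 2 / K))%R.
    by field; rewrite gt_eqF.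
  by rewrite -EFinM.
have : (`|u ord0 i| * V)%:E <= (r * C)%:E * \int[mu]_z `|h z|%:E + (`|u ord0 i| * (V / 2))%:E.
  apply: le_trans (leeD hle dle); apply: le_trans (lee_abs_add _ _).
  have <- : \int[leb]_(x in E) ((psi x)%:E + (u ord0 i - psi x)%:E) =
      \int[leb]_(x in E) (psi x)%:E + \int[leb]_(x in E) (u ord0 i - psi x)%:E.
    exact: (integralD mE ipsi idiff).
  have -> : \int[leb]_(x in E) ((psi x)%:E + (u ord0 i - psi x)%:E) = (u ord0 i * V)%:E.
    transitivity (\int[leb]_(x in E) (cst (u ord0 i)%:E x)).
      by apply: eq_integral => x _; rewrite -EFinD addrC subrK.
    by apply: (etrans (integral_cst _ mE _)); rewrite EFinM -VE.
  by rewrite lee_fin normrM (gtr0_norm V0).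
rewrite -leeBlDr// -EFinB => le.
rewrite EFinM muleC lee_pdivrMl//; apply: le_trans le.
rewrite lee_fin.
have -> : (`|u ord0 i| * V - `|u ord0 i| * (V / 2) = `|u ord0 i| * (V / 2))%R by field.
by rewrite ler_pM2r// divr_gt0.
Qed.

End nondegenerate.

(** * The gain from subcriticality of q *)

Section exponents.
Context {R : realType}.
Implicit Types (n : nat) (q t : R).

Lemma expr_1D_le n t : 0 <= t <= 1 -> (1 + t) ^+ n <= 1 + 3 ^+ n * t.
Proof.
move=> /andP[t0 t1]; elim: n => [|n ih]; first by rewrite !expr0 mul1r lerDl.
have p1 : 1 <= 3 ^+ n :> R by rewrite exprn_ege1// ler1n.
rewrite !exprS; apply: (@le_trans _ _ ((1 + t) * (1 + 3 ^+ n * t))).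
  by rewrite ler_wpM2l// addr_ge0.
move: (3 ^+ n) p1 => p p1.
have : p * t * t <= p * t.
  by rewrite -[leRHS]mulr1 ler_wpM2l// mulr_ge0// (le_trans ler01).
have : t <= p * t by rewrite -[leLHS]mul1r ler_wpM2r.
by lra.
Qed.

(* With p = n/q - (n-1) in (0,1], the factor (1+t)^p beats the two error factors. *)
Lemma scaling_gain n q : (2 <= n)%N -> 1 <= q -> q < n%:R / (n%:R - 1) ->
  exists2 e : R, 0 < e <= 8^-1 & forall t, 0 < t <= 1 ->
    (1 + t) ^+ n.-1 * (1 + t * e) < ((1 + t) ^+ n * (1 - t * e)) `^ q^-1.
Proof.
move=> n2 q1 qn.
have n1 : 0 < n%:R - 1 :> R by rewrite subr_gt0 ltr1n.
have q0 : 0 < q by apply: lt_le_trans q1.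
have nE : n.-1%:R = n%:R - 1 :> R by case: n n2 {qn n1} => // n _; rewrite -natr1 addrK.
pose p := n%:R / q - (n%:R - 1).
have p0 : 0 < p by rewrite subr_gt0 ltr_pdivlMr// mulrC -ltr_pdivlMr.
have iq1 : q^-1 <= 1 by rewrite invf_le1.
have p1 : p <= 1.
  have : n%:R / q <= n%:R by rewrite ler_piMr.
  by rewrite /p; lra.
exists (p / 8); first by apply/andP; split; lra.
move=> t /andP[t0 t1]; set e := p / 8.
have e0 : 0 < e by rewrite /e; lra.
have te : t * e <= 8^-1.
  rewrite -[leRHS]mul1r ler_pM//; [exact: ltW|exact: ltW|by rewrite /e; lra].
have te0 : 0 < t * e by exact: mulr_gt0.
have t10 : 0 < 1 + t by lra.
rewrite powRM; [|by rewrite exprn_ge0// ltW|by lra].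
have -> : ((1 + t) ^+ n) `^ q^-1 = (1 + t) ^+ n.-1 * (1 + t) `^ p.
  rewrite -!powR_mulrn; [|exact: ltW..].
  rewrite -powRrM -powRD; last by rewrite (gt_eqF t10) implybT.
  by rewrite nE /p; congr powR; ring.
rewrite -mulrA ltr_pM2l ?exprn_gt0//.
(* The base lies in ]0, 1] and the exponent 1/q is at most 1, so the power does not decrease the
   base. *)
have h1 : 1 - t * e <= (1 - t * e) `^ q^-1.
  rewrite -[leLHS]powRr1; last by lra.
  by apply: ger_powR => //; apply/andP; split; lra.
(* The power is exp(p ln(1 + t)), and ln(1 + t) >= t / (1 + t) >= t / 2 for t <= 1. *)
have h2 : 1 + p * t / 2 <= (1 + t) `^ p.
  rewrite /powR gt_eqF//; apply: le_trans (expR_ge1Dx _); rewrite lerD2l -mulrA ler_pM2l//.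
  have : ln (1 + - (t / (1 + t))) <= - (t / (1 + t)).
    apply: le_ln1Dx; rewrite ltrN2 ltr_pdivrMr//; lra.
  have -> : 1 + - (t / (1 + t)) = (1 + t)^-1 by field; rewrite gt_eqF.
  rewrite lnV ?posrE// lerN2; apply: le_trans.
  by rewrite ler_pM2l// lef_pV2 ?posrE//; lra.
(* With x = t e and e = p/8 the two bounds multiply to (1 + 4x)(1 - x) = 1 + 3x - 4x^2, which
   exceeds 1 + x because x <= 1/8. *)
apply: lt_le_trans (ler_pM _ _ h2 h1); last by lra.
  have -> : p * t / 2 = 4 * (t * e) by rewrite /e; lra.
  have : t * e * (t * e) <= t * e * 8^-1 by rewrite ler_pM2l.
  move: (t * e) te te0 => x x8 x0 xx; lra.
by have := mulr_gt0 p0 t0; lra.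
Qed.

End exponents.

(** * From boundaries to a margin inside O *)

Section topology.
Context {R : realType} {n : nat}.
Implicit Types A O : set 'rV[R]_n.

(** A point of closure A outside O adheres to both sets and is interior to neither, so it lies on
    both boundaries. *)
Lemma closure_sub_open A O : A `<=` O -> boundary A `&` boundary O = set0 ->
  closure A `<=` O.
Proof.
move=> AO AO0 x Ax; apply: contrapT => nOx.
have : (boundary A `&` boundary O) x.
  split; split => //.
  - by move=> /interior_subset /AO.
  - exact: closure_subset Ax.
  - by move=> /interior_subset.
by rewrite AO0.
Qed.

(** If the ball of radius e around x lies in O, every radius below e/2 is admissible for all points
    within e/2 of x; compactness makes the radius uniform. *)
Lemma compact_thickening (K O : set 'rV[R]_n) : compact K -> open O -> K `<=` O ->
  exists2 d : R, 0 < d & forall x y, K x -> `|y - x| < d -> O y.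
Proof.
move=> cK oO KO.
have /compact_near_coveringP/(_ R ((0 : R)^'+) (fun d x => forall y, `|y - x| < d -> O y) _) := cK.
move=> H; have {H} /H : forall x, K x ->
    \forall z \near x & d \near (0 : R)^'+, forall y, `|y - z| < d -> O y.
  move=> x Kx; have /nbhs_ballP[e /= e0 eO] : nbhs x O by apply: open_nbhs_nbhs; split => //; exact: KO.
  exists (ball x (e / 2), [set d | d < e / 2]) => /=.
    by split; [apply: nbhsx_ballx; rewrite divr_gt0|apply: nbhs_right_lt; rewrite divr_gt0].
  move=> [z d] /= []; rewrite -ball_normE /ball_/= => xz de y yz.
  apply: eO; rewrite -ball_normE /ball_/= -(subrKA z).
  apply: le_lt_trans (ler_normD _ _) _; rewrite (splitr e) ltrD// distrC.
  exact: lt_trans yz de.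
move=> H2.
have [d [d0 dP]] : exists d : R, 0 < d /\ K `<=` (fun x => forall y, `|y - x| < d -> O y).
  near (0 : R)^'+ => d; exists d; split.
    by near: d; exact: nbhs_right_gt.
  by near: d.
by exists d => // x y Kx; exact: dP.
Unshelve. all: by end_near. Qed.

End topology.

(** * The dilated competitor *)

Section dilation.
Context {R : realType} {m : nat}.
Let n := m.+1.
Local Notation leb := (lebesgue_rV n).
Local Open Scope ereal_scope.

(* On |z| <= r the deformation is the homothety of ratio 1 + t; outside, it changes
   the gradient and the volume by a factor 1 + O(t), and there the masses are small. *)
Lemma dilation_profile (E0 : set 'rV[R]_n) (mu : {finite_measure set 'rV[R]_n -> \bar R})
    g0 (e : R) : measurable E0 -> 0 < leb E0 -> leb E0 < +oo ->
  grad_rep E0 mu id g0 -> (0 < e)%R ->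
  exists r t0 L : R, [/\ (0 < r)%R, (0 < t0 <= 1)%R, (0 < L)%R & forall t, (0 < t <= t0)%R ->
  exists E S g, [/\ measurable E, leb E < +oo, grad_rep E mu S g,
    [/\ forall u, unit_sphere u -> \int[mu]_z `|\sum_i u ord0 i * g i z|%:E <=
      ((1 + t) ^+ n.-1 * (1 + t * e))%:E * \int[mu]_z `|\sum_i u ord0 i * g0 i z|%:E &
    ((1 + t) ^+ n * (1 - t * e))%:E * leb E0 <= leb E] &
    forall y, E y -> exists2 z, E0 z & (`|y - z| <= L * t)%R /\ ((r * 4 <= `|z|)%R -> y = z)]].
Proof.
move=> mE0 E0pos E0oo rep e0; have [_ ig0 _] := rep.
have [t0 [B [t00 t01 HK]]] := @deformation_exists R m.
have [K K0 {}HK] := HK (enum 'I_n).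
have {}HK := HK E0 mu g0 mE0 E0oo rep.
have [c c0 hc] := directional_lower_bound mE0 E0pos E0oo rep.
pose V := fine (leb E0).
have VE : leb E0 = V%:E by rewrite fineK// ge0_fin_numE// ltW.
have V0 : (0 < V)%R by rewrite -lte_fin -VE.
pose G z := (\sum_i `|g0 i z|)%R.
have G0 z : (0 <= G z)%R by exact: sumr_ge0.
have iG : mu.-integrable setT (EFin \o G).
  have -> : EFin \o G = (fun z => \sum_i (`|g0 i z|)%:E).
    by apply/funext => z; rewrite sumEFin.
  by apply: integrable_sum => // i _; exact: integrable_abse (ig0 i).
have mG : measurable_fun setT G by apply/measurable_EFinP; exact: measurable_int iG.
(* Outside the ball (1 + t)^n <= 1 + 3^n t and w >= 1 - K t, so w falls short of (1 + t)^n by at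
   most K1 t. *)
pose K1 := (3 ^+ n + K)%R.
have K10 : (0 < K1)%R by rewrite ltr_pwDl// exprn_gt0.
(* The two tolerances are chosen so that K t times the gradient tail is at most t e c, hence at most
   t e times any directional variation, and K1 t times the volume tail is at most t e V. Neither
   involves t, so the radius can be fixed first. *)
have d1 : (0 < c * e / (K + 1))%R by rewrite !mulr_gt0// invr_gt0 ltr_wpDl.
have d2 : (0 < V * e / K1)%R by rewrite !mulr_gt0// invr_gt0.
have [N1 hN1] := integral_tail iG G0 d1.
have [N2 hN2] := lebesgue_tail mE0 E0oo d2.
pose r : R := Num.max 1%R (Num.max N1 N2).
have r0 : (0 < r)%R by rewrite lt_max ltr01.
pose out := [set x : 'rV[R]_n | (r < `|x|)%R].
have mout : measurable out by exact: measurable_outside.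
have tail1 : \int[mu]_(x in out) (G x)%:E <= (c * e / (K + 1))%:E.
  by apply: hN1; rewrite /r !le_max lexx orbT.
have tail2 : leb (E0 `&` out) <= (V * e / K1)%:E.
  by apply: hN2; rewrite /r !le_max lexx !orbT.
(* The displacement bound is n t r B. The absolute value is taken because no sign of B is recorded,
   and + 1 makes L positive. *)
exists r, t0, (n%:R * (r * `|B|) + 1)%R; split => //.
- by rewrite t00 t01.
- by rewrite ltr_wpDl// !mulr_ge0// ltW.
move=> t /andP[tpos tle]; have t1 : (t <= 1)%R by apply: le_trans tle t01.
have tn : (0 <= t)%R by exact: ltW.
have [E [S [g [w D]]]] := HK r t r0 tn tle.
have uI : uniq (enum 'I_n) by exact: enum_uniq.
have sI : size (enum 'I_n) = n by rewrite size_enum_ord.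
have gr := deformed_grad D; have vr := deformed_vol D.
have [mE mw w0 wrep] := vr; have [mS ig _] := gr.
have p1 : (1 <= (1 + t) ^+ n.-1 :> R)%R by rewrite exprn_ege1// lerDl.
have te0 : (0 <= t * e)%R by rewrite mulr_ge0// ltW.
have p0 : (0 <= (1 + t) ^+ n.-1 :> R)%R by exact: le_trans p1.
have g_in z i : (`|z| <= r)%R -> g i z = ((1 + t) ^+ n.-1 * g0 i z)%R.
  move=> zr; rewrite (deformed_g_in D uI zr); congr (_ ^+ _ * _)%R.
  have := count_predC (pred1 i) (enum 'I_n).
  rewrite -[count (pred1 i) _]/(count_mem i _) count_uniq_mem// mem_enum sI.
  by rewrite inE add1n => -[].
exists E, S, g; split => //.
- apply: (vol_rep_lty (M := (1 + K)%R) mE0 E0oo vr) => z.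
  have := deformed_w D z; rewrite ler_norml => /andP[_].
  have : (K * t <= K)%R by rewrite -[leRHS]mulr1 ler_wpM2l.
  by lra.
- split.
    move=> u uS; have chu := hc u uS.
    set f := fun z => (\sum_i u ord0 i * g0 i z)%R.
    have mf : measurable_fun setT f.
      by apply/measurable_EFinP; exact: (measurable_int _ (integrable_lin_comb u ig0)).
    have pointwise z : (`|\sum_i u ord0 i * g i z| <=
        (1 + t) ^+ n.-1 * `|f z| + K * t * (G z * \1_out z))%R.
      rewrite indicE; case: (boolP (z \in _)) => [_|].
        rewrite mulr1; apply: (@le_trans _ _ (`|f z| + K * t * G z)%R).
          have -> : (\sum_i u ord0 i * g i z = f z + \sum_i u ord0 i * (g i z - g0 i z))%R.
            by rewrite /f -big_split/=; apply: eq_bigr => i _; ring.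
          apply: le_trans (ler_normD _ _) _; rewrite lerD2l.
          apply: le_trans (deformed_g D z); apply: le_trans (ler_norm_sum _ _ _) _.
          apply: ler_sum => i _; rewrite normrM ler_piMl//; exact: unit_sphere_coord.
        by rewrite lerD2r ler_peMl.
      rewrite notin_setE /= => /negP; rewrite -leNgt => zr.
      rewrite mulr0 mulr0 addr0 -[X in (X * _)%R]ger0_norm ?(le_trans ler01)//.
      rewrite -normrM mulr_sumr; under eq_bigr do rewrite g_in// mulrCA.
      by [].
    apply: (@le_trans _ _ (\int[mu]_z ((((1 + t) ^+ n.-1)%:E * `|f z|%:E) +
        ((K * t)%:E * ((EFin \o G) \_ out) z)))).
      apply: ge0_integral_mono => z _; first by rewrite lee_fin.
      apply: (@le_trans _ _ ((1 + t) ^+ n.-1 * `|f z| + K * t * (G z * \1_out z))%:E).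
        by rewrite lee_fin.
      rewrite patchE indicE EFinD !EFinM; case: ifPn => _; rewrite ?mule1//.
      by rewrite mule0.
    have mfa : measurable_fun setT (fun z => `|f z|%:E).
      by apply/measurable_EFinP; exact: measurableT_comp.
    have mGo : measurable_fun setT ((EFin \o G) \_ out).
      apply/(measurable_restrictT _ mout); apply: measurable_funTS.
      exact/measurable_EFinP.
    have Go0 z : 0 <= ((EFin \o G) \_ out) z.
      by rewrite patchE; case: ifPn => _ //; rewrite /= lee_fin.
    have Kt0 : 0 <= (K * t)%:E by rewrite lee_fin mulr_ge0.
    have pn0 : 0 <= ((1 + t) ^+ n.-1)%:E by rewrite lee_fin (le_trans ler01).
    rewrite ge0_integralD//; last 4 first.
    + by move=> z _; apply: mule_ge0 => //; rewrite lee_fin.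
    + exact: measurable_funeM.
    + by move=> z _; exact: mule_ge0.
    + exact: measurable_funeM.
    rewrite ge0_integralZl//.
    rewrite ge0_integralZl// -integral_mkcond.
    have -> : ((1 + t) ^+ n.-1 * (1 + t * e) =
        (1 + t) ^+ n.-1 + (1 + t) ^+ n.-1 * (t * e))%R by ring.
    rewrite EFinD ge0_muleDl//; last by rewrite lee_fin mulr_ge0.
    apply: leeD2l; apply: (@le_trans _ _ ((t * e)%:E * c%:E)).
      apply: (@le_trans _ _ ((K * t)%:E * (c * e / (K + 1))%:E)); first exact: lee_wpmul2l.
      rewrite -!EFinM lee_fin; have K11 : (0 < K + 1)%R by rewrite ltr_wpDl.
      have -> : (K * t * (c * e / (K + 1)) = (t * e * c) * (K / (K + 1)))%R by field; rewrite gt_eqF.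
      apply: ler_piMr; first by rewrite mulr_ge0// ltW.
      by rewrite (ler_pdivrMr _ _ K11) mul1r lerDl.
    apply: lee_pmul => //; first by rewrite lee_fin ltW.
    by rewrite lee_fin ler_peMl.
  have volE : leb E = \int[leb]_(z in E0) (w z)%:E.
    have := wrep (cst 1) (measurable_cst _) (fun=> lee01).
    rewrite integral_cst// mul1e => ->.
    by apply: eq_integral => z _; rewrite mul1e.
  have pointwise z : ((1 + t) ^+ n <= w z + K1 * t * \1_out z)%R.
    rewrite indicE; case: (boolP (z \in _)) => [_|].
      rewrite mulr1; have := deformed_w D z; rewrite ler_norml => /andP[h _].
      have h2 : ((1 + t) ^+ n <= 1 + 3 ^+ n * t)%R by apply: expr_1D_le; rewrite tn t1.
      by rewrite /K1 mulrDl; lra.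
    rewrite notin_setE /= => /negP; rewrite -leNgt => zr.
    by rewrite (deformed_w_in D uI zr) sI mulr0 addr0.
  have le : ((1 + t) ^+ n)%:E * leb E0 <= leb E + (K1 * t)%:E * leb (E0 `&` out).
    rewrite -integral_cst// volE setIC -integral_indic//.
    rewrite -ge0_integralZl//; last 2 first.
    + by apply/measurable_EFinP; apply: measurable_funTS; exact: measurable_indic.
    + by rewrite lee_fin mulr_ge0// ltW.
    rewrite -ge0_integralD//; last 4 first.
    + by move=> z _; rewrite lee_fin.
    + by apply/measurable_EFinP; exact: measurable_funTS mw.
    + by move=> z _; rewrite -EFinM lee_fin !mulr_ge0// ltW.
    + apply: measurable_funeM; apply/measurable_EFinP; apply: measurable_funTS.
      exact: measurable_indic.
    apply: ge0_integral_mono => z _; first by rewrite lee_fin exprn_ge0// addr_ge0.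
    by rewrite -EFinM -EFinD lee_fin.
  have -> : ((1 + t) ^+ n * (1 - t * e) = (1 + t) ^+ n - (1 + t) ^+ n * (t * e))%R by ring.
  rewrite VE -EFinM mulrBl EFinB leeBlDr//.
  move: le; rewrite VE -EFinM => /le_trans; apply; apply: leeD2l.
  apply: (@le_trans _ _ ((K1 * t)%:E * (V * e / K1)%:E)).
    by apply: lee_wpmul2l => //; rewrite lee_fin mulr_ge0// ltW.
  rewrite -EFinM lee_fin.
  have -> : (K1 * t * (V * e / K1) = t * e * V)%R by field; rewrite gt_eqF.
  by rewrite ler_pM2r// ler_peMl// exprn_ege1// lerDl.
- move=> y /(deformed_sub D)[z E0z ->]; exists z => //; split; last exact: (deformed_out D).
  apply: le_trans (deformed_near D z) _; rewrite sI.
  have -> : (n%:R * (t * (r * B)) = (n%:R * (r * B)) * t)%R by ring.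
  rewrite ler_wpM2r//; apply: (@le_trans _ _ (n%:R * (r * `|B|))%R); last by rewrite lerDl.
  by rewrite ler_wpM2l// ler_wpM2l ?ler_norm// ltW.
Qed.

End dilation.

(** The dilated set E' would be a competitor whose affine perimeter is at most [k] times that of E
    and whose volume is at least [kv] times that of E, while [scaling_gain] gives k < kv^(1/q): its
    ratio would be strictly smaller than the infimum. *)
Lemma cheeger_minimizer_closure (R : realType) (m : nat) (q : R) (O E : set 'rV[R]_m.+1) :
  (2 <= m.+1)%N -> 1 <= q -> q < m.+1%:R / (m.+1%:R - 1) ->
  open O -> (vol O < +oo)%E -> lebesgue_measurable E -> E `<=` O -> (0 < vol E)%E ->
  affine_cheeger q O = (affine_perimeter E / vol E `^ q^-1)%E -> ~ (closure E `<=` O).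
Proof.
move=> n2 q1 qn oO Ooo mE EO Epos hmin cEO.
set n := m.+1 in n2 qn *.
have q0 : 0 < q by exact: lt_le_trans q1.
have Eoo : (vol E < +oo)%E by apply: le_lt_trans Ooo; exact: le_outer_measure.
pose V := fine (vol E).
have VE : vol E = V%:E by rewrite fineK// ge0_fin_numE// ltW.
have V0 : 0 < V by rewrite -lte_fin -VE.
have VqE : (vol E `^ q^-1)%E = (V `^ q^-1)%:E by rewrite VE poweR_EFin.
have Vq0 : 0 < V `^ q^-1 by rewrite powR_gt0.
have iVq : ((vol E `^ q^-1)^-1)%E = ((V `^ q^-1)^-1)%:E by rewrite VqE inver gt_eqF.
have hlt : (affine_cheeger q O < +oo)%E.
  apply: affine_cheeger_lty => //; apply/set0P/negP => /eqP O0.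
  by move: Epos; rewrite (_ : E = set0) ?measure0 ?ltxx//; apply/seteqP; split => // x /EO; rewrite O0.
(* Otherwise the perimeter of E, and with it the infimum, would be +oo. *)
have bv : BV (\1_E : 'rV[R]_n -> R).
  apply: contrapT => nbv; move: hlt; rewrite hmin /affine_perimeter.
  case: pselect => [//|nbv']; rewrite iVq.
  by rewrite mulyr gtr0_sg ?invr_gt0// mul1e ltxx.
have [E0 [mE0 E0E E0V null]] := borel_core mE Eoo.
have rep := grad_rep_BV mE mE0 E0E null bv.
have E0pos : (0 < lebesgue_rV n E0)%E by rewrite E0V.
have E0oo : (lebesgue_rV n E0 < +oo)%E by rewrite E0V.
have [c c0 hc] := directional_lower_bound mE0 E0pos E0oo rep.
have [C C0 hC] := directional_variation_bounded (\1_E : 'rV[R]_n -> R).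
have [e /andP[e0 e8] gain] := scaling_gain n2 q1 qn.
have [r [t0 [L [r0 /andP[t00 t01] L0 def]]]] := dilation_profile mE0 E0pos E0oo rep e0.
(* Closure E need not be compact. Points with |z| >= 4r are fixed, so a margin inside O is needed
   only for the part of closure E in the ball of radius 4r. *)
pose K := closure E `&` [set x | `|x| <= r * 4].
have cK : compact K.
  apply: bounded_closed_compact.
    exists (r * 4); split; first exact: num_real.
    by move=> M Mr x [_ xr]; apply: le_trans xr (ltW Mr).
  apply: closedI; first exact: closed_closure.
  rewrite (_ : [set x | _] = closed_ball_ (fun z : 'rV[R]_n => `|z|) 0 (r * 4)).
    exact: closed_closed_ball_.
  by apply/seteqP; split => x; rewrite /closed_ball_ /= sub0r normrN.
have [d d0 dP] := compact_thickening cK oO (subset_trans (@subIsetl _ _ _) cEO).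
(* This makes the displacement, at most L t, no larger than d / 2. *)
pose t := Num.min t0 (d / (2 * L)).
have tpos : 0 < t by rewrite lt_min t00 divr_gt0// mulr_gt0.
have tle : t <= t0 by rewrite ge_min lexx.
have tL : L * t < d.
  apply: (@le_lt_trans _ _ (L * (d / (2 * L)))).
    by rewrite ler_pM2l// ge_min lexx orbT.
  have -> : L * (d / (2 * L)) = d / 2 by field; rewrite gt_eqF.
  by rewrite ltr_pdivrMr// ltr_pMr// ltr1n.
have t1 : t <= 1 by exact: le_trans t01.
have [|E' [S [g [mE' E'oo rep' [hgrad hvol] sub]]]] := def t; first by rewrite tpos.
have E'O : E' `<=` O.
  move=> y /sub[z E0z [yz zout]].
  have [zr|/ltW zr] := leP (r * 4) `|z|; first by rewrite zout//; exact/EO/E0E.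
  apply: (dP z) => //; last exact: le_lt_trans tL.
  by split => //; apply: subset_closure; exact: E0E.
have [bv' dv'] := BV_grad_rep mE' E'oo rep'.
pose k := (1 + t) ^+ n.-1 * (1 + t * e).
pose kv := (1 + t) ^+ n * (1 - t * e).
have t10 : 0 < 1 + t by rewrite addr_gt0.
have te1 : t * e < 1.
  apply: (@le_lt_trans _ _ (1 * 8^-1)); last by rewrite mul1r invf_lt1// ltr1n.
  by rewrite ler_pM// ltW.
have k0 : 0 < k by rewrite mulr_gt0 ?exprn_gt0// addr_gt0// mulr_gt0.
have kv0 : 0 < kv by rewrite mulr_gt0 ?exprn_gt0// subr_gt0.
have kkv : k < kv `^ q^-1 by apply: gain; rewrite tpos.
(* The bounds c and C make the perimeter P of E a positive real, so it can be cancelled from the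
   final inequality. *)
have [P [P0 PE P'E]] : exists p : R, [/\ 0 < p, affine_BV_norm (\1_E : 'rV[R]_n -> R) = p%:E &
    (affine_BV_norm (\1_E' : 'rV[R]_n -> R) <= (k * p)%:E)%E].
  apply: (affine_BV_norm_scale k0 c0 _ hC) => u uS.
    by rewrite directional_variationE; exact: hc.
  by apply: le_trans (dv' u) _; rewrite directional_variationE; exact: hgrad.
have E'V : vol E' = lebesgue_rV n E' by exact: vol_borel.
pose V' := fine (vol E').
have V'E : vol E' = V'%:E by rewrite /V' fineK// E'V ge0_fin_numE.
have VV' : kv * V <= V'.
  by rewrite -lee_fin -V'E E'V EFinM -VE -E0V; exact: hvol.
have V'0 : 0 < V' by apply: lt_le_trans VV'; rewrite mulr_gt0.
have V'q0 : 0 < V' `^ q^-1 by rewrite powR_gt0.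
have : (affine_cheeger q O <= affine_perimeter E' / vol E' `^ q^-1)%E.
  apply: ereal_inf_lbound; exists E' => //; split => //.
    exact: borel_lebesgue.
  by rewrite V'E lte_fin.
rewrite hmin /affine_perimeter; case: pselect => [bvE|//]; case: pselect => [bvE'|//].
rewrite iVq V'E poweR_EFin inver gt_eqF// PE => le.
have : (P%:E * ((V `^ q^-1)^-1)%:E <= (k * P)%:E * ((V' `^ q^-1)^-1)%:E)%E.
  by apply: le_trans le _; apply: lee_wpmul2r => //; rewrite lee_fin invr_ge0 ltW.
rewrite -!EFinM lee_fin ler_pdivrMr// mulrAC ler_pdivlMr//.
have -> : k * P * V `^ q^-1 = P * (k * V `^ q^-1) by ring.
rewrite ler_pM2l// leNgt => /negP; apply.
apply: (@lt_le_trans _ _ (kv `^ q^-1 * V `^ q^-1)); first by rewrite ltr_pM2r.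
rewrite -powRM; [|exact: ltW..].
apply: (ge0_ler_powR _ _ _ VV'); rewrite ?nnegrE; first by rewrite invr_ge0 ltW.
- by rewrite mulr_ge0// ltW.
- exact: ltW.
Qed.
Theorem proposition1 (R : realType) (n : nat) (q : R) (O E : set 'rV[R]_n)
    (hn : (2 <= n)%N)
    (hq1 : 1 <= q) (hq2 : q < n%:R / (n%:R - 1))
    (hO : open O) (hVO : (vol O < +oo)%E)
    (hE : lebesgue_measurable E) (hEO : E `<=` O) (hVE : (0 < vol E)%E)
    (hmin : affine_cheeger q O = (affine_perimeter E / vol E `^ q^-1)%E) :
  boundary E `&` boundary O !=set0.
Proof.
case: n O E hn hq2 hO hVO hE hEO hVE hmin => // m O E hn hq2 hO hVO hE hEO hVE hmin.
apply/set0P/negP => /eqP disj.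
exact: (cheeger_minimizer_closure hn hq1 hq2 hO hVO hE hEO hVE hmin) (closure_sub_open hEO disj).
Qed.
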